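(* Let $\mathbb P\neq\mathbb Q$ be Gaussian probability measures on $\mathbb R^d$, $\mathbb P=N(\mu,\Sigma)$, $\mathbb Q=N(\nu,\Xi)$, with $\Sigma,\Xi$ of full rank, and let $X_1,X_2,\dots$ be i.i.d. with law $\mathbb P$. Let $\widehat{\mathcal{GW}}_n=\mathcal W_2^2\big(N(\hat\mu_n,\hat\Sigma_n),\mathbb Q\big)$ be computed from $X_1,\dots,X_n$, and let $\widehat{\mathcal{GW}}{}_n^\ast$ be the same quantity computed from an independent resample with replacement $X_1^\ast,\dots,X_n^\ast$ of $X_1,\dots,X_n$. Then $$\sqrt n\,\big(\widehat{\mathcal{GW}}{}_n^\ast-\widehat{\mathcal{GW}}_n\big)\Rightarrow N(0,\upsilon^2)$$ conditionally given $X_1,X_2,\dots$ in probability, where $$\upsilon^2 = 4(\nu-\mu)^t\Sigma(\nu-\mu)+2\,\mathrm{tr}(\Sigma^2)+2\,\mathrm{tr}(\Sigma\Xi)-4\sum_{k=1}^d\kappa_k^{1/2}\,r_k^t\,\Xi^{-1/2}\Sigma\,\Xi^{1/2}r_k$$ and $\{(\kappa_k,r_k)\}_{k=1}^d$ are the orthonormal eigenpairs of $\Xi^{1/2}\Sigma\Xi^{1/2}$.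
   Context: $\mathcal W_2$ is the 2-Wasserstein distance: $\mathcal W_2^2(\mathbb P,\mathbb Q)=\inf_\pi\int\|x-y\|^2\pi(dx,dy)$ over all couplings; for Gaussians $\mathcal W_2^2(N(\mu,\Sigma),N(\nu,\Xi))=\|\mu-\nu\|^2+\mathrm{tr}(\Sigma)+\mathrm{tr}(\Xi)-2\,\mathrm{tr}[(\Sigma^{1/2}\Xi\Sigma^{1/2})^{1/2}]$ (spectral square roots). For a sample $x_1,\dots,x_n$: $\hat\mu_n=\frac1n\sum x_i$, $\hat\Sigma_n=\frac1{n-1}\sum(x_i-\hat\mu_n)(x_i-\hat\mu_n)^t$. Conditional on $X_1,\dots,X_n$, the variables $X_1^\ast,\dots,X_n^\ast$ are i.i.d. uniform draws from $\{X_1,\dots,X_n\}$ (with multiplicity). Weak convergence conditionally given $X_1,X_2,\dots$ in probability means: with $\rho$ a metric for the topology of weak convergence, the $\rho$-distance between the conditional law of the left-hand side given $X_1,\dots,X_n$ and the limit law converges to zero in probability. *)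

(* Defs.v *)
From HB Require Import structures.
From mathcomp Require Import all_boot all_order all_algebra.
From mathcomp Require Import all_classical all_reals all_analysis.
From mathcomp Require Import measurable_realfun giry.

Set Implicit Arguments.
Unset Strict Implicit.
Unset Printing Implicit Defensive.

Import Order.TTheory GRing.Theory Num.Theory.
Import numFieldNormedType.Exports.

Local Open Scope classical_set_scope.
Local Open Scope ring_scope.

(* Matrices carry the product sigma-algebra, as tuples do in the library.
   On 'cV[R]_d, which plays the role of R^d, it is the Borel sigma-algebra. *)
Section matrix_measurable.
Context {R : realType} (m n : nat).

Definition entry_cylinders : set (set 'M[R]_(m, n)) :=
  [set A | exists i j (B : set R),
    measurable B /\ A = (fun M : 'M[R]_(m, n) => M i j) @^-1` B].

HB.instance Definition _ := @isMeasurable.Build (sigma_display entry_cylinders)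
  'M[R]_(m, n) <<s entry_cylinders >>
  (@sigma_algebra0 _ setT entry_cylinders) (@sigma_algebraC _ entry_cylinders)
  (@sigma_algebra_bigcup _ setT entry_cylinders).

Lemma measurable_entry i j :
  measurable_fun [set: 'M[R]_(m, n)] (fun M : 'M[R]_(m, n) => M i j).
Proof.
move=> _ B mB; rewrite setTI; apply: sub_sigma_algebra.
by exists i, j, B.
Qed.

Lemma measurable_fun_mx d (T : measurableType d) (f : T -> 'M[R]_(m, n)) :
  (forall i j, measurable_fun [set: T] (fun x => f x i j)) ->
  measurable_fun [set: T] f.
Proof.
move=> mf; apply: (@measurability _ _ _ _ _ f entry_cylinders) => //.
move=> _ [_ [i [j [B [mB ->]]]] <-].
exact: mf.
Qed.

End matrix_measurable.

(* The library's normal_prob lives on the copy measurableTypeR R of R (same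
   sets, same sigma-algebra), takes the standard deviation, and is not a point
   mass when that is 0. normal_law m v is N(m, v) on R itself, v the variance. *)
Section normal_law.
Context {R : realType}.

Definition of_measurableTypeR : measurableTypeR R -> R := idfun.

HB.instance Definition _ := @isMeasurableFun.Build _ _ _ _
  of_measurableTypeR (@measurable_id _ _ setT).

Definition normal_law (m v : R) : probability R R :=
  if v == 0 then (dirac m : probability R R)
  else distribution (normal_prob m (Num.sqrt v)) of_measurableTypeR.

End normal_law.

(* The law on R^d of a vector of d independent N(0, 1) variables *)
Section std_gaussian.
Context {R : realType}.

Definition cons_cV d (z : R * 'cV[R]_d) : 'cV[R]_d.+1 :=
  col_mx (z.1)%:M z.2.

Lemma measurable_cons_cV d :
  measurable_fun [set: R * 'cV[R]_d] (@cons_cV d).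
Proof.
apply: measurable_fun_mx => i j; rewrite (ord1 j) {j}.
rewrite /cons_cV; case: (split_ordP (i : 'I_(1 + d))) => k -> {i}.
  under eq_fun do rewrite (@col_mxEu _ 1 d 1).
  rewrite (ord1 k); under eq_fun do rewrite mxE eqxx mulr1n.
  exact: measurable_fst.
under eq_fun do rewrite (@col_mxEd _ 1 d 1).
apply: (measurableT_comp (measurable_entry k 0)).
exact: measurable_snd.
Qed.

HB.instance Definition _ d := isMeasurableFun.Build _ _ _ _
  (@cons_cV d) (@measurable_cons_cV d).

Fixpoint std_gaussian d : probability 'cV[R]_d R :=
  match d with
  | 0 => dirac (0 : 'cV[R]_0)
  | d'.+1 => distribution (normal_law 0 1 \x std_gaussian d')%E (@cons_cV d')
  end.

End std_gaussian.

Section gaussian.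
Context {R : realType} (d : nat).

(* The spectral square root, from any eigendecomposition with nonnegative
   eigenvalues: the result does not depend on the decomposition *)
Definition sqrtmx (A : 'M[R]_d) : 'M[R]_d :=
  xget 0 [set B | exists (O : 'M[R]_d) (l : 'rV[R]_d),
    [/\ O^T *m O = 1%:M, forall i, 0 <= l 0 i,
        A = O *m diag_mx l *m O^T &
        B = O *m diag_mx (map_mx Num.sqrt l) *m O^T]].

Definition covariance_matrix (A : 'M[R]_d) :=
  A^T = A /\ forall x : 'cV[R]_d, 0 <= (x^T *m A *m x) 0 0.

Definition affine_cV (m : 'cV[R]_d) (A : 'M[R]_d) (z : 'cV[R]_d) : 'cV[R]_d :=
  m + A *m z.

Lemma measurable_affine_cV m A : measurable_fun [set: 'cV[R]_d] (affine_cV m A).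
Proof.
apply: measurable_fun_mx => i j; rewrite /affine_cV.
under eq_fun do rewrite !mxE.
apply: measurable_funD; first exact: measurable_cst.
apply: measurable_sum => k; apply: measurable_funM; first exact: measurable_cst.
exact: measurable_entry.
Qed.

HB.instance Definition _ m A := isMeasurableFun.Build _ _ _ _
  (affine_cV m A) (@measurable_affine_cV m A).

(* N(m, S) is the law of m + S^(1/2) Z with Z standard; S may be singular, as
   happens for the sample covariance of a resample *)
Definition gaussian (m : 'cV[R]_d) (S : 'M[R]_d) : probability 'cV[R]_d R :=
  distribution (std_gaussian d) (affine_cV m (sqrtmx S)).

End gaussian.

Section wasserstein.
Context {R : realType} (d : nat).

(* Euclidean: the library's norm on matrices is the sup norm *)
Definition sqnorm (x : 'cV[R]_d) : R := \sum_i x i 0 ^+ 2.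

(* Measures in the library also take (irrelevant) values on non-measurable
   sets, so laws are compared on measurable sets only *)
Definition coupling (P Q : probability 'cV[R]_d R)
    (pi : probability ('cV[R]_d * 'cV[R]_d)%type R) :=
  forall A : set 'cV[R]_d, measurable A ->
    pi (A `*` setT) = P A /\ pi (setT `*` A) = Q A.

Definition W2sq (P Q : probability 'cV[R]_d R) : \bar R :=
  ereal_inf [set (\int[pi]_z (sqnorm (z.1 - z.2))%:E)%E
            | pi in [set pi | coupling P Q pi]].

End wasserstein.

Section sample.
Context {R : realType} (d n : nat).
Implicit Type x : 'I_n -> 'cV[R]_d.

Definition sample_mean x : 'cV[R]_d := n%:R^-1 *: \sum_i x i.

Definition sample_cov x : 'M[R]_d :=
  (n.-1)%:R^-1 *: \sum_i (x i - sample_mean x) *m (x i - sample_mean x)^T.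

Definition GW (Q : probability 'cV[R]_d R) x : R :=
  fine (W2sq (gaussian (sample_mean x) (sample_cov x)) Q).

End sample.

(* With the sample x held fixed, a resample is x \o J where the indices
   J 0, ..., J (n - 1) are i.i.d. uniform on 'I_n, that is, J is uniform on
   {ffun 'I_n -> 'I_n}. The law of sqrt n (T (x \o J) - T x) is therefore the
   conditional law of the bootstrapped statistic given the sample x. *)
Section bootstrap.
Context {R : realType} (V : Type) (n : nat).
Variables (T : ('I_n -> V) -> R) (x : 'I_n -> V).

Definition bootstrap_error (J : {ffun 'I_n -> 'I_n}) : R :=
  Num.sqrt n%:R * (T (x \o J) - T x).

Definition bootstrap_law (A : set R) : \bar R :=
  ((#|{ffun 'I_n -> 'I_n}|%:R^-1)%:E *
    \sum_(J : {ffun 'I_n -> 'I_n}) \d_(bootstrap_error J) A)%E.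

Let card_gt0 : (0 < #|{ffun 'I_n -> 'I_n}|)%N.
Proof. by apply/card_gt0P; exists [ffun i => i]. Qed.

Let law0 : bootstrap_law set0 = 0%E.
Proof. by rewrite /bootstrap_law big1 ?mule0// => J _; rewrite measure0. Qed.

Let law_ge0 A : (0 <= bootstrap_law A)%E.
Proof.
rewrite /bootstrap_law mule_ge0// ?lee_fin ?invr_ge0//.
by apply: sume_ge0 => J _; exact: measure_ge0.
Qed.

Let law_sigma_additive : semi_sigma_additive bootstrap_law.
Proof.
pose J0 : {ffun 'I_n -> 'I_n} := [ffun i => i].
pose m (k : nat) : {measure set R -> \bar R} :=
  dirac (bootstrap_error (nth J0 (enum {: {ffun 'I_n -> 'I_n}}) k)).
have c_ge0 : 0 <= #|{ffun 'I_n -> 'I_n}|%:R^-1 :> R by rewrite invr_ge0.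
pose c := NngNum c_ge0.
have -> : bootstrap_law = mscale c (msum m #|{ffun 'I_n -> 'I_n}|).
  apply/funext => A; rewrite /bootstrap_law /mscale /=; congr (_ * _)%E.
  rewrite /msum (big_enum_val (A := predT)) /=.
  by apply: eq_bigr => i _; rewrite /m/= (enum_val_nth J0).
exact: measure_semi_sigma_additive.
Qed.

HB.instance Definition _ := isMeasure.Build _ _ _ bootstrap_law
  law0 law_ge0 law_sigma_additive.

Let law_setT : bootstrap_law setT = 1%E.
Proof.
rewrite /bootstrap_law (eq_bigr (fun=> 1%E)); last first.
  by move=> J _; rewrite diracT.
rewrite -[1%E]/(1%:E) sumEFin -EFinM sumr_const -[1 *+ _]/(_%:R).
by rewrite mulVf// pnatr_eq0 -lt0n.
Qed.

HB.instance Definition _ :=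
  Measure_isProbability.Build _ _ _ bootstrap_law law_setT.

End bootstrap.

Section probability_notions.
Context {R : realType}.

Definition weakly_converges (Pn : nat -> probability R R) (P : probability R R) :=
  forall f : R -> R, continuous f -> (exists M, forall x, `|f x| <= M) ->
    (\int[Pn n]_x (f x)%:E)%E @[n --> \oo] --> (\int[P]_x (f x)%:E)%E.

(* Points at distance 0 need only agree on measurable sets: elements of
   probability R R that differ elsewhere are the same law. *)
Definition metrizes_weak_convergence
    (rho : probability R R -> probability R R -> R) :=
  [/\ forall P Q, 0 <= rho P Q,
      forall P Q, rho P Q = 0 <-> measure_eq P Q,
      forall P Q, rho P Q = rho Q P,
      forall P Q S, rho P S <= rho P Q + rho Q S &
      forall Pn P, weakly_converges Pn P <->
        rho (Pn n) P @[n --> \oo] --> (0 : R)].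

Definition mutually_independent d (Omega : measurableType d)
    (Pr : probability Omega R) d' (V : measurableType d')
    (X : nat -> {RV Pr >-> V}) :=
  forall (s : seq nat) (A : nat -> set V), uniq s ->
    (forall i, measurable (A i)) ->
    Pr (\big[setI/setT]_(i <- s) (X i @^-1` A i)) =
    (\big[mule/1%E]_(i <- s) Pr (X i @^-1` A i))%E.

Definition iid_with_law d (Omega : measurableType d)
    (Pr : probability Omega R) d' (V : measurableType d')
    (X : nat -> {RV Pr >-> V}) (P : probability V R) :=
  mutually_independent X /\
  forall i, measure_eq (distribution Pr (X i)) P.

End probability_notions.

Section limit_variance.
Context {R : realType} (d : nat).

Definition orthonormal_eigenpairs (M : 'M[R]_d) (kappa : 'I_d -> R)
    (r : 'I_d -> 'cV[R]_d) :=
  (forall k, M *m r k = kappa k *: r k) /\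
  (forall j k, ((r j)^T *m r k) 0 0 = (j == k)%:R).

Definition upsilon2 (mu nu : 'cV[R]_d) (Sigma Xi : 'M[R]_d)
    (kappa : 'I_d -> R) (r : 'I_d -> 'cV[R]_d) : R :=
  4 * ((nu - mu)^T *m Sigma *m (nu - mu)) 0 0
  + 2 * \tr (Sigma *m Sigma) + 2 * \tr (Sigma *m Xi)
  - 4 * \sum_k Num.sqrt (kappa k) *
      ((r k)^T *m invmx (sqrtmx Xi) *m Sigma *m sqrtmx Xi *m r k) 0 0.

End limit_variance.

(* Main.v *)
Require Import Defs.
From HB Require Import structures.
From mathcomp Require Import all_boot all_order all_algebra.
From mathcomp Require Import all_classical all_reals all_analysis.
From mathcomp Require Import measurable_realfun giry.
From mathcomp Require Import ring lra.
From mathcomp Require complex.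

(* The squared distance between Gaussian laws is a quadratic function of the mean plus
   S |-> tr S - 2 tr (Xi^(1/2) S Xi^(1/2))^(1/2), which is differentiable at Sigma with
   derivative M |-> tr (A M), where A = 1 - H (H Sigma H)^(-1/2) H and H = Xi^(1/2), up to a
   remainder bounded by the squared Frobenius norm. Hence GW x = const + avg phi (x_i) + Rem
   with phi(u) = 2 (mu - nu)^t (u - mu) + (u - mu)^t A (u - mu) - tr (A Sigma), and Rem is
   of the order of the squared averages of the centered first and second moments. Under P
   the variance of phi is upsilon2, by diagonalising the quadratic form.

   Given the sample x, the bootstrap error is therefore n^(-1/2) times a sum of n independent
   draws from the centered phi (x_i), up to a remainder of order n^(-1/2) in mean. Replacing
   the draws by Gaussian increments one at a time (Lindeberg) bounds
   |E f (bootstrap error) - E f (N (0, upsilon2))|, for f with three bounded derivatives, by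
   C_f times a quantity b_n of the sample that does not depend on f and has expectation
   O(n^(-1/2)). Countably many smooth steps f determine weak convergence, so rho is small as
   soon as b_n is, and Markov's inequality concludes. *)

Set Implicit Arguments.
Unset Strict Implicit.
Unset Printing Implicit Defensive.

Import Order.TTheory GRing.Theory Num.Theory.
Import numFieldNormedType.Exports.

Local Open Scope classical_set_scope.
Local Open Scope ring_scope.

(** * Orthogonal matrices and the spectral theorem *)

(** [W2sq] is an infimum over all couplings, so its closed form between Gaussian laws has to be
    proved: a linear coupling bounds it above, a dual pair of quadratic functions below. Only [Xi]
    is definite there. The sample covariance of a resample may be singular, hence the shift by a
    small multiple of the identity in the dual pair, and a continuity bound for the trace of the
    square root that inverts no root. [gaussian] is built from one particular square root; that the
    law depends on the covariance alone follows from the invariance of the standard law under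
    orthogonal matrices, reduced to plane rotations and these to shears. The expansion of [GW] is
    controlled only while the deviations are at most 1. A bounded test function sees a difference
    only through its minimum with 1, which makes the bound unconditional, so that no exceptional
    event is split off. Markov's inequality concerns measurable events; as [rho] is known only
    through the metric axioms and convergent sequences, measurability comes from the sequential
    continuity of the map from samples to bootstrap laws. *)

Section orthogonal_matrices.
Import complex.
Context {R : realType}.

Definition e0 {d} : 'cV[R]_d.+1 := delta_mx 0 0.

Lemma mx11_tr (x : 'M[R]_1) : x^T = x.
Proof. by apply/matrixP => i j; rewrite mxE !ord1. Qed.

Lemma dotC d (x y : 'cV[R]_d) : x^T *m y = y^T *m x.
Proof. by rewrite -[LHS]mx11_tr trmx_mul trmxK. Qed.

Lemma dotxxE d (x : 'cV[R]_d) : (x^T *m x) 0 0 = \sum_i x i 0 ^+ 2.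
Proof. by rewrite !mxE; apply: eq_bigr => i _; rewrite !mxE expr2. Qed.

Lemma dotxx_ge0 d (x : 'cV[R]_d) : 0 <= (x^T *m x) 0 0.
Proof. by rewrite dotxxE sumr_ge0// => i _; rewrite sqr_ge0. Qed.

Lemma dotxx_eq0 d (x : 'cV[R]_d) : ((x^T *m x) 0 0 == 0) = (x == 0).
Proof.
apply/eqP/eqP => [|->]; last by rewrite mulmx0 mxE.
rewrite dotxxE => /eqP; rewrite psumr_eq0 => [/allP x0|i _]; last exact: sqr_ge0.
apply/colP => i; have := x0 i; rewrite mem_index_enum sqrf_eq0 => /(_ isT)/eqP ->.
by rewrite mxE.
Qed.

Lemma orth_tr d (U : 'M[R]_d) : U^T *m U = 1%:M -> U *m U^T = 1%:M.
Proof. exact: mulmx1C. Qed.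

Lemma orth_mul d (U V : 'M[R]_d) :
  U^T *m U = 1%:M -> V^T *m V = 1%:M -> (U *m V)^T *m (U *m V) = 1%:M.
Proof. by move=> HU HV; rewrite trmx_mul mulmxA -(mulmxA V^T) HU mulmx1. Qed.

Lemma dot_e0 d (v : 'cV[R]_d.+1) : (v^T *m e0) 0 0 = v 0 0.
Proof. by rewrite /e0 -colE !mxE. Qed.

(** Householder's reflection in the hyperplane orthogonal to [v - e0] exchanges the unit vectors
    [e0] and [v]; it degenerates only when they coincide, and then the identity serves. *)
Lemma orth_first_col d (v : 'cV[R]_d.+1) : (v^T *m v) = 1%:M ->
  exists U : 'M[R]_d.+1, U^T *m U = 1%:M /\ U *m e0 = v.
Proof.
move=> v1; have [w0|w0] := eqVneq (v - e0) 0.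
  exists 1%:M; rewrite trmx1 !mul1mx; split=> //.
  by move/eqP: w0; rewrite subr_eq0 => /eqP.
set w := v - e0 in w0; set n := (w^T *m w) 0 0.
have n0 : n != 0 by rewrite /n dotxx_eq0.
have nE : n = 2 - 2 * v 0 0.
  have wT : w^T = v^T - e0^T by rewrite /w linearB.
  rewrite /n wT /w mulmxBl !mulmxBr v1 (dotC e0 v).
  have H (A B : 'M[R]_1) : (A - B) 0 0 = A 0 0 - B 0 0 by rewrite !mxE.
  by rewrite !H !dot_e0 !mxE !eqxx /=; ring.
pose U : 'M[R]_d.+1 := 1%:M - (2 / n) *: (w *m w^T).
have UT : U^T = U by rewrite /U linearB/= trmx1 linearZ/= trmx_mul trmxK.
have wwn : w^T *m w = n%:M by rewrite [LHS]mx11_scalar.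
exists U; split.
  rewrite UT /U mulmxBl mulmxBr !mul1mx mulmxBr mulmx1.
  rewrite -scalemxAl -scalemxAr mulmxA -(mulmxA w) wwn mul_mx_scalar -scalemxAl.
  apply/matrixP => i j; rewrite !mxE.
  by field.
rewrite /U mulmxBl mul1mx -scalemxAl -mulmxA.
have -> : w^T *m e0 = (v 0 0 - 1)%:M.
  rewrite [LHS]mx11_scalar; congr (_%:M).
  by rewrite dot_e0 /w /e0 !mxE eqxx.
rewrite mul_mx_scalar scalerA.
have -> : 2 / n * (v 0 0 - 1) = -1 by move: n0; rewrite nE => n0; field.
by rewrite scaleN1r opprK /w addrC subrK.
Qed.

(** The factor is the norm of [v], a function of [v^T *m v] alone: vectors of equal norm are aligned
    with the same multiple of [e0], which [gram_eq_orth] exploits. *)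
Lemma orth_align d (v : 'cV[R]_d.+1) :
  exists (U : 'M[R]_d.+1), U^T *m U = 1%:M /\
    v = Num.sqrt ((v^T *m v) 0 0) *: (U *m e0).
Proof.
have [->|v0] := eqVneq v 0.
  by exists 1%:M; rewrite trmx1 mul1mx mulmx0 mxE sqrtr0 scale0r.
set n := (v^T *m v) 0 0; have n0 : 0 < n by rewrite lt_neqAle eq_sym dotxx_eq0 v0 dotxx_ge0.
have s0 : Num.sqrt n != 0 by rewrite gt_eqF ?sqrtr_gt0.
case: (@orth_first_col _ ((Num.sqrt n)^-1 *: v)) => [|U [U1 U2]].
  rewrite [_^T]linearZ/= -scalemxAl -scalemxAr scalerA [_ *m _]mx11_scalar -/n.
  rewrite -scalemx1 scalerA -invfM -expr2 sqr_sqrtr ?(ltW n0)// mulVf ?scale1r//.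
  by rewrite gt_eqF.
by exists U; split=> //; rewrite U2 scalerA divff ?scale1r.
Qed.

Lemma block_orth d (V : 'M[R]_d) : V^T *m V = 1%:M ->
  (block_mx (1%:M : 'M[R]_1) 0 0 V)^T *m block_mx 1%:M 0 0 V = 1%:M.
Proof.
move=> V1; rewrite tr_block_mx !trmx0 trmx1 mulmx_block V1.
by rewrite !mul0mx !mulmx0 !mul1mx !addr0 !add0r -scalar_mx_block.
Qed.

Lemma e0_block d : @e0 d = col_mx (1%:M : 'M[R]_1) (0 : 'cV[R]_d).
Proof.
apply/colP => i; rewrite [in RHS](mxE) /e0; case: (split_ordP (i : 'I_(1 + d))) => k ->.
  by rewrite !ord1 /delta_mx !mxE.
by rewrite /delta_mx !mxE.
Qed.

(** The transpose of an orthogonal matrix that fixes [e0] fixes it too, so both the first row and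
    the first column are those of the identity. *)
Lemma orth_fix_e0 d (U : 'M[R]_(1 + d)) : U^T *m U = 1%:M -> U *m e0 = e0 ->
  exists V : 'M[R]_d, V^T *m V = 1%:M /\ U = block_mx 1%:M 0 0 V.
Proof.
move=> U1 Ue; have UTe : U^T *m e0 = e0 by rewrite -{1}Ue mulmxA U1 mul1mx.
have UE : U = block_mx 1%:M 0 0 (drsubmx U).
  rewrite -[LHS]submxK; move: Ue UTe; rewrite -[in U *m _](submxK U) -[in U^T](submxK U).
  rewrite tr_block_mx e0_block !mul_block_col !mulmx1 !mulmx0 !addr0.
  move=> /eq_col_mx [-> ->] /eq_col_mx [_].
  by move=> /(congr1 trmx); rewrite trmxK trmx0 => ->.
exists (drsubmx U); split => //.
move: U1; rewrite {1 2}UE tr_block_mx mulmx_block !trmx0 trmx1.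
rewrite !mul0mx !mulmx0 !mul1mx !addr0 !add0r.
by rewrite (@scalar_mx_block _ 1 d) => /eq_block_mx[].
Qed.

(** The Givens rotation in the plane of the first two coordinates. *)
Definition rot_mx d (c s : R) : 'M[R]_(1 + (1 + d)) :=
  block_mx c%:M (row_mx (- s)%:M 0) (col_mx s%:M 0) (block_mx c%:M 0 0 1%:M).

Lemma rot_mx_orth d (c s : R) : c ^+ 2 + s ^+ 2 = 1 ->
  (rot_mx d c s)^T *m rot_mx d c s = 1%:M.
Proof.
move=> cs; rewrite /rot_mx !tr_block_mx tr_row_mx tr_col_mx !tr_scalar_mx !trmx0.
rewrite mulmx_block mul_row_col !mulmx0 !addr0 -!scalar_mxM.
rewrite mul_col_row mul_mx_row mul_row_block mul_block_col mulmx_block.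
rewrite !(mulmx0, mul0mx, mulmx1, addr0, add0r) -!scalar_mxM.
rewrite mul_col_mx mul0mx -scalar_mxM (@add_row_mx _ 1 1 d) (@add_col_mx _ 1 d 1).
rewrite (@add_block_mx _ 1 d 1 d) !(mulmx0, mul0mx, mulmx1, addr0, add0r).
rewrite -!raddfD/= !mulrN !mulNr !opprK -!expr2 cs (addrC (s ^+ 2)) cs.
rewrite [c * s]mulrC addNr !raddf0 row_mx0 col_mx0.
by rewrite -scalar_mx_block -scalar_mx_block.
Qed.

(** Only the first column [v] of [U] matters. [V1] turns its last coordinates onto one axis, a
    rotation of the first two coordinates carries [e0] to the resulting vector, and what remains
    fixes [e0], hence is a block [V2]. By induction on the dimension, invariance under orthogonal
    matrices reduces to plane rotations. *)
Lemma orth_decomp d (U : 'M[R]_(1 + (1 + d))) : U^T *m U = 1%:M ->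
  exists (V1 V2 : 'M[R]_(1 + d)) (c s : R),
  [/\ V1^T *m V1 = 1%:M, V2^T *m V2 = 1%:M, c ^+ 2 + s ^+ 2 = 1 &
    U = block_mx 1%:M 0 0 V1 *m rot_mx d c s *m block_mx 1%:M 0 0 V2].
Proof.
move=> U1; pose v := U *m e0.
have v1 : v^T *m v = 1%:M.
  rewrite /v trmx_mul mulmxA -(mulmxA _ U^T) U1 mulmx1.
  by apply/matrixP => i j; rewrite !ord1 dot_e0 /e0 !mxE.
have [V1 [V1o wE]] := @orth_align d (dsubmx (v : 'cV_(1 + (1 + d)))).
set s := Num.sqrt _ in wE; set c := (usubmx (v : 'cV_(1 + (1 + d)))) 0 0.
have vE : v = col_mx c%:M (s *: (V1 *m e0)).
  by rewrite -[LHS](@vsubmxK _ 1 (1 + d)) -wE [usubmx _]mx11_scalar.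
have e1 : (e0 : 'cV[R]_(1 + d))^T *m e0 = 1%:M.
  by apply/matrixP => i j; rewrite !ord1 dot_e0 /e0 !mxE.
have cs : c ^+ 2 + s ^+ 2 = 1.
  move: v1; rewrite vE tr_col_mx mul_row_col tr_scalar_mx -scalar_mxM.
  rewrite [(_ *: _)^T]linearZ/= -scalemxAl -scalemxAr scalerA trmx_mul mulmxA.
  rewrite -(mulmxA _ V1^T) V1o mulmx1 e1 scalemx1 -raddfD/=.
  by move/matrixP/(_ 0 0); rewrite !mxE /= !mulr1n !expr2.
have Re : rot_mx d c s *m e0 = col_mx c%:M (s *: e0).
  rewrite e0_block /rot_mx mul_block_col !mulmx1 !mulmx0 !addr0.
  by rewrite e0_block (@scale_col_mx _ 1 d 1) scaler0 scalemx1.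
pose B1 : 'M[R]_(1 + (1 + d)) := block_mx 1%:M 0 0 V1.
have B1o : B1^T *m B1 = 1%:M by exact: block_orth.
have vE' : v = B1 *m rot_mx d c s *m e0.
  rewrite -mulmxA Re vE /B1 mul_block_col !mul0mx mul1mx addr0 add0r.
  by rewrite scalemxAr.
pose U0 := (B1 *m rot_mx d c s)^T *m U.
have BR : (B1 *m rot_mx d c s)^T *m (B1 *m rot_mx d c s) = 1%:M.
  by apply: orth_mul => //; exact: rot_mx_orth.
have [V2 [V2o U0E]] : exists V : 'M[R]_(1 + d),
    V^T *m V = 1%:M /\ U0 = block_mx 1%:M 0 0 V.
  apply: orth_fix_e0.
    by rewrite /U0; apply: orth_mul => //; rewrite trmxK orth_tr.
  by rewrite /U0 -mulmxA -/v vE' mulmxA BR mul1mx.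
exists V1, V2, c, s; split => //.
by rewrite -U0E /U0 mulmxA -/B1 (orth_tr BR) mul1mx.
Qed.

(** Over the complex numbers the matrix is Hermitian, so its eigenvalues are real; a real eigenvalue
    of the complexified matrix is already an eigenvalue over [R], which provides a real
    eigenvector. *)
Lemma sym_eigenvector d (S : 'M[R]_d.+1) : S^T = S ->
  exists (l : R) (v : 'cV[R]_d.+1), v != 0 /\ S *m v = l *: v.
Proof.
move=> ST; pose C : numClosedFieldType := complex.complex R.
pose f : {rmorphism R -> C} := complex.real_complex R; pose S' : 'M[C]_d.+1 := map_mx f S.
have Sh : S' \is hermsymmx.
  apply: realsym_hermsym.
    by apply/is_hermitianmxP; rewrite /S' expr0 scale1r map_mx_id// map_trmx ST.
  by apply/mxOverP => i j; rewrite mxE; apply/complex_realP; exists (S i j).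
have /mxOverP/(_ 0 0) lr := hermitian_spectral_diag_real Sh.
have /hermitian_normalmx /orthomx_spectralP SE := Sh.
set P := spectralmx S' in SE; set D := spectral_diag S' in SE lr.
have Pu : P \in unitmx by exact: spectral_unit.
have ev : eigenvalue S' (D 0 0).
  apply/eigenvalueP; exists (row 0 P).
    rewrite SE !mulmxA -row_mul mulmxV// row1 -rowE row_diag_mx.
    by rewrite -scalemxAl -rowE.
  apply/eqP => r0; move: Pu; rewrite -row_free_unit => /row_freeP[Q PQ].
  have := congr1 (mulmx (delta_mx (0 : 'I_1) (0 : 'I_d.+1))) PQ.
  rewrite mulmxA -rowE r0 mul0mx mulmx1 => /matrixP/(_ 0 0); rewrite !mxE !eqxx/=.
  by move/eqP; rewrite eq_sym oner_eq0.
have [l lE] : exists l, D 0 0 = f l.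
  by have /complex_realP[l lE] := lr; exists l.
move: ev; rewrite lE /S' eigenvalue_map => /eigenvalueP [v vS v0].
exists l, v^T; split; first by rewrite trmx_eq0.
by rewrite -[in LHS]ST -trmx_mul vS linearZ.
Qed.

(** Deflation: an eigenvector is rotated onto [e0], and by symmetry the rotated matrix splits into a
    1 by 1 block and a smaller symmetric one. *)
Lemma sym_spectral d (S : 'M[R]_d) : S^T = S ->
  exists (O : 'M[R]_d) (l : 'rV[R]_d),
    O^T *m O = 1%:M /\ S = O *m diag_mx l *m O^T.
Proof.
elim: d => [|d IH] in S *.
  by move=> _; exists 1%:M, 0; rewrite trmx1 mul1mx; split => //; apply/matrixP => -[].
move=> ST; have [l [v [v0 Sv]]] := sym_eigenvector ST.
have [U [Uo vE]] := orth_align v.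
set n := Num.sqrt _ in vE.
have n0 : n != 0 by apply: contra_neq v0 => n0; rewrite vE n0 scale0r.
have SU : S *m (U *m e0) = l *: (U *m e0).
  apply: (scalerI n0).
  by rewrite scalemxAr -vE Sv scalerA mulrC -scalerA -vE.
  pose T : 'M[R]_(1 + d) := U^T *m S *m U.
have TT : T^T = T by rewrite /T !trmx_mul ST trmxK mulmxA.
have Te : T *m e0 = l *: e0.
  by rewrite /T -!mulmxA SU -scalemxAr mulmxA Uo mul1mx.
have TE : T = block_mx l%:M 0 0 (drsubmx T).
  rewrite -[LHS]submxK; move: (Te) (Te); rewrite -{2}TT -[in T *m _](submxK T) -[in T^T](submxK T).
  rewrite tr_block_mx e0_block !mul_block_col !mulmx1 !mulmx0 !addr0.
  rewrite (@scale_col_mx _ 1 d 1) scaler0 scalemx1.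
  move=> /eq_col_mx [-> ->] /eq_col_mx [_].
  by move=> /(congr1 trmx); rewrite trmxK trmx0 => ->.
have [|W [l' [Wo SE]]] := IH (drsubmx T).
  by rewrite trmx_drsub TT.
exists (U *m (block_mx 1%:M 0 0 W : 'M[R]_(1 + d))), (row_mx l%:M l' : 'rV_(1 + d)).
split; first by apply: orth_mul => //; exact: block_orth.
have -> : S = U *m T *m U^T.
  by rewrite /T !mulmxA orth_tr// mul1mx -mulmxA orth_tr// mulmx1.
suff -> : T = block_mx 1%:M 0 0 W *m diag_mx (row_mx l%:M l') *m
    (block_mx 1%:M 0 0 W)^T by rewrite trmx_mul !mulmxA.
rewrite TE SE diag_mx_row tr_block_mx !trmx0 trmx1 !mulmx_block.
rewrite !(mulmx0, mul0mx, mulmx1, mul1mx, addr0, add0r).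
by congr block_mx; apply/matrixP => i j; rewrite !ord1 !mxE.
Qed.

(* Both matrices are rotated so that a common nonzero row becomes a multiple of
   the first basis vector; equality of the Gram matrices then makes the first
   columns agree, and one recurses on the remaining columns. *)
Lemma gram_eq_orth p d (A B : 'M[R]_(p, d)) : A *m A^T = B *m B^T ->
  exists W : 'M[R]_d, W^T *m W = 1%:M /\ A = B *m W.
Proof.
elim: d => [|d IH] in A B *.
  by move=> _; exists 1%:M; rewrite trmx1 mul1mx; split => //; apply/matrixP => i [].
move=> AB.
have rowE2 (M : 'M[R]_(p, d.+1)) i j : (M *m M^T) i j = ((row i M)^T^T *m (row j M)^T) 0 0.
  by rewrite trmxK !mxE; apply: eq_bigr => k _; rewrite !mxE.
have [[i Ai]|A0] := pselect (exists i, row i A != 0); last first.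
  have rA i : row i A = 0 by apply/eqP/negPn/negP => ?; apply: A0; exists i.
  have rB i : row i B = 0.
    apply/eqP; rewrite -trmx_eq0 -dotxx_eq0 -rowE2 -AB rowE2 rA.
    by rewrite trmx0 mulmx0 mxE.
  exists 1%:M; rewrite trmx1 mul1mx mulmx1; split => //.
  by apply/row_matrixP => j; rewrite rA rB.
have [U [Uo aE]] := orth_align (row i A)^T.
have [V [Vo bE]] := orth_align (row i B)^T.
set n := Num.sqrt _ in aE; set n' := Num.sqrt _ in bE.
have nn : n' = n by rewrite /n /n' -!rowE2 AB.
have n0 : n != 0.
  by apply: contra_neq Ai => n0; apply: trmx_inj; rewrite aE n0 scale0r trmx0.
pose A1 : 'M[R]_(p, 1 + d) := A *m U; pose B1 : 'M[R]_(p, 1 + d) := B *m V.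
have AB1 : A1 *m A1^T = B1 *m B1^T.
  rewrite /A1 /B1 !trmx_mul !mulmxA -(mulmxA A) -(mulmxA B).
  by rewrite (orth_tr Uo) (orth_tr Vo) !mulmx1.
have col0 (M : 'M[R]_(p, d.+1)) W : W^T *m W = 1%:M -> (row i M)^T = n *: (W *m e0) ->
    n *: (M *m W *m e0) = M *m (row i M)^T.
  by move=> Wo ->; rewrite -scalemxAr mulmxA.
have lA : lsubmx A1 = lsubmx B1.
  have HE (M : 'M[R]_(p, 1 + d)) : lsubmx M = M *m e0.
    by rewrite -[in RHS](hsubmxK M) e0_block mul_row_col mulmx1 mulmx0 addr0.
  rewrite !HE; apply: (scalerI n0); rewrite -nn in aE *; rewrite nn.
  rewrite !col0// -?nn//; apply/colP => j.
  have rE (M : 'M[R]_(p, d.+1)) : (M *m (row i M)^T) j 0 = (M *m M^T) j i.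
    by rewrite !mxE; apply: eq_bigr => k _; rewrite !mxE.
  by rewrite !rE AB.
have rA : rsubmx A1 *m (rsubmx A1)^T = rsubmx B1 *m (rsubmx B1)^T.
  have HS (M : 'M[R]_(p, 1 + d)) :
      M *m M^T = lsubmx M *m (lsubmx M)^T + rsubmx M *m (rsubmx M)^T.
    by rewrite -{1 2}(hsubmxK M) tr_row_mx mul_row_col.
  by move: AB1; rewrite !HS lA => /addrI.
have [W [Wo WE]] := IH _ _ rA.
exists (V *m (block_mx 1%:M 0 0 W : 'M[R]_(1 + d)) *m U^T); split.
  by apply: orth_mul; [apply: orth_mul => //; exact: block_orth|rewrite trmxK orth_tr].
rewrite !mulmxA -/B1.
have -> : B1 *m block_mx 1%:M 0 0 W = A1.
  rewrite -(hsubmxK B1) -(hsubmxK A1) mul_row_block !mulmx0 mulmx1 addr0 add0r.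
  by rewrite -WE lA.
by rewrite /A1 -mulmxA orth_tr// mulmx1.
Qed.

End orthogonal_matrices.

(** * Square roots of covariance matrices *)

Section psd_matrices.
Context {R : realType}.

Lemma mulmx_diag_quad p d (P : 'M[R]_(p, d)) (l : 'rV[R]_d) (x : 'cV[R]_p) :
  (x^T *m (P *m diag_mx l *m P^T) *m x) 0 0 = \sum_i l 0 i * (P^T *m x) i 0 ^+ 2.
Proof.
have -> : x^T *m (P *m diag_mx l *m P^T) *m x = (P^T *m x)^T *m (diag_mx l *m (P^T *m x)).
  by rewrite trmx_mul trmxK !mulmxA.
rewrite mxE; apply: eq_bigr => i _; rewrite !mxE (bigD1 i)//= !mxE eqxx mulr1n.
rewrite [X in _ * (_ + X)]big1 ?addr0; last by move=> j ji; rewrite !mxE eq_sym (negbTE ji) mulr0n mul0r.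
by rewrite mulrCA -expr2.
Qed.

Lemma diag_psd p d (P : 'M[R]_(p, d)) (l : 'rV[R]_d) : (forall i, 0 <= l 0 i) ->
  covariance_matrix (P *m diag_mx l *m P^T).
Proof.
move=> l0; split; first by rewrite !trmx_mul trmxK tr_diag_mx mulmxA.
move=> x; rewrite mulmx_diag_quad sumr_ge0// => i _.
by rewrite mulr_ge0// sqr_ge0.
Qed.

Lemma psd_spectral d (K : 'M[R]_d) : covariance_matrix K ->
  exists (P : 'M[R]_d) (l : 'rV[R]_d),
    [/\ P^T *m P = 1%:M, forall i, 0 <= l 0 i & K = P *m diag_mx l *m P^T].
Proof.
move=> [KT K0]; have [P [l [Po KE]]] := sym_spectral KT.
exists P, l; split => // i.
have := K0 (P *m delta_mx i 0); rewrite KE mulmx_diag_quad mulmxA Po mul1mx.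
rewrite (bigD1 i)//= big1 ?addr0; first by rewrite mxE !eqxx/= expr1n mulr1.
by move=> j ji; rewrite mxE (negbTE ji) expr0n mulr0.
Qed.

Lemma sqrtmx_spec d (K : 'M[R]_d) : covariance_matrix K ->
  [/\ covariance_matrix (sqrtmx K) & sqrtmx K *m sqrtmx K = K].
Proof.
move=> /psd_spectral[P [l [Po l0 KE]]].
have : [set B | exists (O : 'M[R]_d) (l : 'rV[R]_d),
    [/\ O^T *m O = 1%:M, forall i, 0 <= l 0 i,
        K = O *m diag_mx l *m O^T &
        B = O *m diag_mx (map_mx Num.sqrt l) *m O^T]] (sqrtmx K).
  rewrite /sqrtmx; case: xgetP => [B _ //|/(_ (P *m diag_mx (map_mx Num.sqrt l) *m P^T)) []].
  by exists P, l.
move=> [U [k [Uo k0 KE2 ->]]]; split.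
  by apply: diag_psd => i; rewrite mxE sqrtr_ge0.
rewrite -!mulmxA (mulmxA U^T) Uo mul1mx (mulmxA (diag_mx _) (diag_mx _)) mulmx_diag.
rewrite [RHS]KE2 -!mulmxA; congr (_ *m (_ *m _)); congr diag_mx.
by apply/rowP => i; rewrite !mxE -expr2 sqr_sqrtr.
Qed.

Lemma sqrtmx_unit d (K : 'M[R]_d) : covariance_matrix K -> K \in unitmx ->
  sqrtmx K \in unitmx.
Proof.
by move=> /sqrtmx_spec[_ E]; rewrite -{1}E unitmx_mul => /andP[].
Qed.

Lemma congr_psd p d (K : 'M[R]_d) (X : 'M[R]_(d, p)) :
  covariance_matrix K -> covariance_matrix (X^T *m K *m X).
Proof.
move=> [KT K0]; split; first by rewrite !trmx_mul trmxK KT mulmxA.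
by move=> x; have := K0 (X *m x); rewrite trmx_mul !mulmxA.
Qed.

Lemma psd_congr p d (K : 'M[R]_d) (X : 'M[R]_(p, d)) :
  covariance_matrix K -> covariance_matrix (X *m K *m X^T).
Proof. by move=> /(congr_psd X^T); rewrite trmxK. Qed.

Lemma psd_inv d (K : 'M[R]_d) : covariance_matrix K -> K \in unitmx ->
  covariance_matrix (invmx K).
Proof.
move=> Kc Ku; have [KT _] := Kc; have KV : (invmx K)^T = invmx K by rewrite trmx_inv KT.
have := congr_psd (invmx K) Kc; rewrite KV.
by rewrite mulVmx// mul1mx.
Qed.

Lemma psd_tr_ge0 p d (K : 'M[R]_d) (X : 'M[R]_(d, p)) : covariance_matrix K ->
  0 <= \tr (X^T *m K *m X).
Proof.
move=> [_ K0]; rewrite /mxtrace sumr_ge0// => i _.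
have := K0 (col i X); rewrite tr_col -row_mul.
by rewrite !mxE; congr (_ <= _); apply: eq_bigr => k _; rewrite !mxE.
Qed.

(** The squared Frobenius norm, which on column vectors is the squared Euclidean norm. *)
Definition nrm2 p d (X : 'M[R]_(p, d)) : R := \tr (X^T *m X).

Lemma nrm2E p d (X : 'M[R]_(p, d)) : nrm2 X = \sum_j \sum_i X i j ^+ 2.
Proof.
by apply: eq_bigr => j _; rewrite mxE; apply: eq_bigr => i _; rewrite mxE expr2.
Qed.

Lemma nrm2_ge0 p d (X : 'M[R]_(p, d)) : 0 <= nrm2 X.
Proof. by rewrite nrm2E !sumr_ge0// => *; rewrite sumr_ge0// => *; rewrite sqr_ge0. Qed.

Lemma nrm2_tr p d (X : 'M[R]_(p, d)) : nrm2 X^T = nrm2 X.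
Proof. by rewrite /nrm2 trmxK mxtrace_mulC. Qed.

Lemma nrm2_eq0 p d (X : 'M[R]_(p, d)) : nrm2 X <= 0 -> X = 0.
Proof.
rewrite nrm2E => h.
have H j : true -> 0 <= \sum_i X i j ^+ 2 by move=> _; rewrite sumr_ge0// => *; rewrite sqr_ge0.
have : \sum_j \sum_i X i j ^+ 2 == 0 by rewrite eq_le h sumr_ge0.
rewrite psumr_eq0// => /allP h1; apply/matrixP => i j; rewrite mxE; apply/eqP.
rewrite -sqrf_eq0; have := h1 j; rewrite mem_index_enum => /(_ isT).
rewrite psumr_eq0; last by move=> *; rewrite sqr_ge0.
by move=> /allP/(_ i); rewrite mem_index_enum; exact.
Qed.

Lemma scalar_quad p d (c : R) (X : 'M[R]_(d, p)) : \tr (X^T *m c%:M *m X) = c * nrm2 X.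
Proof. by rewrite mul_mx_scalar -scalemxAl mxtraceZ. Qed.

Lemma orth_diagB d (P : 'M[R]_d) (l : 'rV[R]_d) c : P^T *m P = 1%:M ->
  c%:M - P *m diag_mx l *m P^T = P *m diag_mx (const_mx c - l) *m P^T.
Proof.
move=> Po; rewrite linearB/= diag_const_mx mulmxBr mulmxBl; congr (_ - _).
by rewrite mul_mx_scalar -scalemxAl orth_tr// scalemx1.
Qed.

Lemma psd_upper d (K : 'M[R]_d) : covariance_matrix K ->
  exists2 C : R, 0 <= C & forall p (X : 'M[R]_(d, p)), \tr (X^T *m K *m X) <= C * nrm2 X.
Proof.
move=> /psd_spectral[P [l [Po l0 KE]]]; exists (\sum_i l 0 i); first by rewrite sumr_ge0.
move=> p X; rewrite -scalar_quad -subr_ge0 -raddfB/= -mulmxBl -mulmxBr KE orth_diagB//.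
apply: psd_tr_ge0; apply: diag_psd => i; rewrite !mxE subr_ge0.
by rewrite (bigD1 i)//= lerDl sumr_ge0.
Qed.

Lemma pd_spectral_gt0 d (P : 'M[R]_d) (l : 'rV[R]_d) : P^T *m P = 1%:M ->
  (forall i, 0 <= l 0 i) -> P *m diag_mx l *m P^T \in unitmx -> forall i, 0 < l 0 i.
Proof.
move=> Po l0; rewrite !unitmx_mul => /andP[/andP[_ u] _] i; rewrite lt_neqAle l0 andbT.
move: u; rewrite unitmxE det_diag unitfE; apply: contraNneq => li.
by rewrite (bigD1 i)//= -li mul0r.
Qed.

Lemma pd_lower d (K : 'M[R]_d) : covariance_matrix K -> K \in unitmx ->
  exists2 c : R, 0 < c & forall p (X : 'M[R]_(d, p)), c * nrm2 X <= \tr (X^T *m K *m X).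
Proof.
move=> /psd_spectral[P [l [Po l0 KE]]] Ku.
have lp : forall i, 0 < l 0 i by apply: (pd_spectral_gt0 Po) => //; rewrite -KE.
have S0 : 0 < 1 + \sum_i (l 0 i)^-1.
  by rewrite ltr_wpDr// sumr_ge0// => i _; rewrite invr_ge0.
(* Smaller than every eigenvalue; the added 1 keeps it positive when [d] is 0, where the sum is
   empty. *)
exists (1 + \sum_i (l 0 i)^-1)^-1; first by rewrite invr_gt0.
move=> p X; rewrite -scalar_quad -subr_le0 -oppr_ge0 -raddfB/= -mulmxBl -mulmxBr.
rewrite -raddfN/= -mulNmx -mulmxN KE orth_diagB// -mulNmx -mulmxN.
apply: psd_tr_ge0; rewrite -raddfN/=; apply: diag_psd => i; rewrite !mxE opprB subr_ge0.
rewrite -[leRHS]invrK lef_pV2 ?posrE ?invr_gt0//.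
by rewrite (bigD1 i)//= addrCA lerDl addr_ge0// sumr_ge0// => j _; rewrite invr_ge0.
Qed.

(** With [X = D - B] one has [D^2 - B^2 = D X + X B], and pairing this with [X] gives at least
    [c * nrm2 X], where [c] bounds [B] from below. Cauchy-Schwarz, in the form of a nonnegative
    square, concludes. [D] will be the root of a possibly singular matrix. *)
Lemma sqrt_diff_lip d (B : 'M[R]_d) : covariance_matrix B -> B \in unitmx ->
  exists2 C : R, 0 <= C & forall D, covariance_matrix D ->
    nrm2 (D - B) <= C * nrm2 (D *m D - B *m B).
Proof.
move=> Bc Bu; have [c c0 Hc] := pd_lower Bc Bu.
exists (c ^- 2); first by rewrite invr_ge0 sqr_ge0.
move=> D Dc; have [DT _] := Dc; have [BT _] := Bc.
set X := D - B; set E := D *m D - B *m B.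
have XT : X^T = X by rewrite /X linearB/= DT BT.
have EE : E = D *m X + X *m B by rewrite /E /X mulmxBr mulmxBl addrA subrK.
have ET : E^T = E by rewrite /E linearB/= !trmx_mul DT BT.
have XE : c * nrm2 X <= \tr (X *m E).
  have -> : \tr (X *m E) = \tr (X^T *m D *m X) + \tr (X^T *m B *m X).
    rewrite EE mulmxDr raddfD/= XT !mulmxA; congr (_ + _).
    by rewrite mxtrace_mulC mulmxA mxtrace_mulC mulmxA.
  by rewrite (le_trans (Hc _ X))// lerDr psd_tr_ge0.
clearbody X E.
have : 0 <= nrm2 (c *: X - E) by exact: nrm2_ge0.
have -> : nrm2 (c *: X - E) = c ^+ 2 * nrm2 X - 2 * c * \tr (X *m E) + nrm2 E.
  have T : (c *: X - E)^T = c *: X - E by rewrite linearB/= linearZ/= XT ET.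
  rewrite /nrm2 T XT ET mulmxBl !mulmxBr -!scalemxAl -!scalemxAr.
  rewrite !raddfB/= !mxtraceZ (mxtrace_mulC E X); ring.
move=> H; rewrite mulrC ler_pdivlMr ?exprn_gt0//.
have : c * (c * nrm2 X) <= c * \tr (X *m E) by rewrite ler_pM2l.
lra.
Qed.

Lemma sqrt_uniq d (B D : 'M[R]_d) : covariance_matrix B -> B \in unitmx ->
  covariance_matrix D -> D *m D = B *m B -> D = B.
Proof.
move=> Bc Bu Dc DB; have [C C0 /(_ _ Dc)] := sqrt_diff_lip Bc Bu.
by rewrite DB subrr [nrm2 0]/nrm2 mulmx0 raddf0 mulr0 => /nrm2_eq0/eqP; rewrite subr_eq0 => /eqP.
Qed.

(** Expanding [(D - B) B^-1 (D - B)] gives an identity, not an estimate: the first-order term of the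
    trace of the root and its remainder are both explicit, and no differential calculus enters. *)
Lemma tr_sqrt_expand d (B D : 'M[R]_d) : B \in unitmx ->
  \tr D - \tr B = 2^-1 * \tr (invmx B *m (D *m D - B *m B)) -
     2^-1 * \tr ((D - B) *m invmx B *m (D - B)).
Proof.
move=> Bu.
set K := invmx B.
have -> : \tr (K *m (D *m D - B *m B)) = \tr (K *m D *m D) - \tr B.
  by rewrite mulmxBr raddfB/= !mulmxA mulVmx// mul1mx.
have -> : (D - B) *m K *m (D - B) = D *m K *m D - D - D + B.
  rewrite mulmxBl mulmxV// mulmxBr mulmxBl mul1mx mulmxBl mul1mx.
  by rewrite -(mulmxA D K B) /K mulVmx// mulmx1 opprB addrA addrAC.
have -> : \tr (D *m K *m D - D - D + B) = \tr (K *m D *m D) - \tr D - \tr D + \tr B.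
  by rewrite raddfD/= !raddfB/= -(mulmxA D) mxtrace_mulC.
lra.
Qed.

End psd_matrices.

(** * The Bures functional, its expansion and its dual form *)

Section bures.
Context {R : realType} (d : nat).
Implicit Types S Sigma Xi B D K F X Y : 'M[R]_d.

(** The part of the squared Bures distance between [S] and [Xi] that varies with [S]; adding
    [\tr Xi] completes it. *)
Definition bures Xi S : R := \tr S - 2 * \tr (sqrtmx (sqrtmx Xi *m S *m sqrtmx Xi)).

Lemma sandwich_psd Xi S : covariance_matrix Xi -> covariance_matrix S ->
  covariance_matrix (sqrtmx Xi *m S *m sqrtmx Xi).
Proof.
move=> /sqrtmx_spec[[HT _] _] Sc.
by have := psd_congr (sqrtmx Xi) Sc; rewrite HT.
Qed.

Lemma nrm2_sandwich Xi : covariance_matrix Xi -> exists2 C : R, 0 <= C &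
  forall X, nrm2 (sqrtmx Xi *m X *m sqrtmx Xi) <= C * nrm2 X.
Proof.
move=> Xc; have [[HT _] HH] := sqrtmx_spec Xc; have [C C0 HC] := psd_upper Xc.
exists (C * C); first by rewrite mulr_ge0.
have HX X : nrm2 (sqrtmx Xi *m X) <= C * nrm2 X.
  by rewrite /nrm2 trmx_mul mulmxA -(mulmxA _ _ (sqrtmx Xi)) HT HH HC.
move=> X; rewrite -nrm2_tr trmx_mul HT (le_trans (HX _))// nrm2_tr -mulrA.
by rewrite ler_wpM2l// HX.
Qed.

(** For definite matrices, the matrix of the optimal transport map from [N(0, Sigma)] to [N(0, Xi)];
    the identity minus it is the gradient of [bures Xi] at [Sigma]. *)
Definition transport_mx Sigma Xi : 'M[R]_d :=
  sqrtmx Xi *m invmx (sqrtmx (sqrtmx Xi *m Sigma *m sqrtmx Xi)) *m sqrtmx Xi.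

Section pd.
Variables Sigma Xi : 'M[R]_d.
Hypotheses (Sc : covariance_matrix Sigma) (Su : Sigma \in unitmx).
Hypotheses (Xc : covariance_matrix Xi) (Xu : Xi \in unitmx).
Let H := sqrtmx Xi.
Let B := sqrtmx (H *m Sigma *m H).
Let A := 1%:M - transport_mx Sigma Xi.

Let HT : H^T = H. Proof. by have [[]] := sqrtmx_spec Xc. Qed.
Let HH : H *m H = Xi. Proof. by have [] := sqrtmx_spec Xc. Qed.
Let Hu : H \in unitmx. Proof. exact: sqrtmx_unit. Qed.
Let Bc : covariance_matrix B.
Proof. by have [] := sqrtmx_spec (sandwich_psd Xc Sc). Qed.
Let BB : B *m B = H *m Sigma *m H.
Proof. by have [] := sqrtmx_spec (sandwich_psd Xc Sc). Qed.
Let Bu : B \in unitmx.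
Proof. by apply: sqrtmx_unit; [exact: sandwich_psd|rewrite !unitmx_mul Hu Su]. Qed.

Lemma transport_mx_tr : (transport_mx Sigma Xi)^T = transport_mx Sigma Xi.
Proof.
rewrite /transport_mx -/H -/B !trmx_mul trmx_inv HT; have [-> _] := Bc.
by rewrite mulmxA.
Qed.

Lemma transport_mxE : transport_mx Sigma Xi *m Sigma *m transport_mx Sigma Xi = Xi.
Proof.
rewrite /transport_mx -/H -/B.
have -> : H *m invmx B *m H *m Sigma *m (H *m invmx B *m H) =
  H *m invmx B *m (H *m Sigma *m H) *m invmx B *m H by rewrite !mulmxA.
by rewrite -BB mulmxA mulmxKV// mulmxK.
Qed.

(** [tr_sqrt_expand] applied to the roots [B] and [D] of the sandwiched matrices leaves the trace of
    [(D - B) B^-1 (D - B)] as remainder. Each of [C1], [C2], [C3] removes one layer: the inverse,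
    the root, the sandwich. *)
Lemma bures_expand : exists2 C : R, 0 <= C & forall S, covariance_matrix S ->
  `|bures Xi S - bures Xi Sigma - \tr (A *m (S - Sigma))| <= C * nrm2 (S - Sigma).
Proof.
have [C1 C10 H1] := psd_upper (psd_inv Bc Bu).
have [C2 C20 H2] := sqrt_diff_lip Bc Bu.
have [C3 C30 H3] := nrm2_sandwich Xc.
exists (C1 * (C2 * C3)); first by rewrite !mulr_ge0.
move=> S Sp; set D := sqrtmx (H *m S *m H).
have [[DT D0] DD] := sqrtmx_spec (sandwich_psd Xc Sp).
rewrite -/H -/D in DT D0 DD.
have trA : \tr (A *m (S - Sigma)) = \tr (S - Sigma) - \tr (invmx B *m (D *m D - B *m B)).
  rewrite /A mulmxBl mul1mx raddfB/= DD BB; congr (_ - _).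
  rewrite -mulmxBl -mulmxBr /transport_mx -/H -/B.
  by rewrite !mulmxA [RHS]mxtrace_mulC !mulmxA.
have E := tr_sqrt_expand D Bu.
have -> : bures Xi S - bures Xi Sigma - \tr (A *m (S - Sigma)) =
    \tr ((D - B) *m invmx B *m (D - B)).
  rewrite trA /bures -/H -/B -/D raddfB/=.
  move: E; set x := \tr (_ *m _); set y := \tr (_ *m _ *m _); lra.
have DBT : (D - B)^T = D - B by rewrite linearB/= DT; have [-> _] := Bc.
rewrite -{1}DBT ger0_norm ?psd_tr_ge0//; last exact: psd_inv.
rewrite (le_trans (H1 _ _))// -!mulrA ler_wpM2l// (le_trans (H2 D _))//.
by rewrite DD BB -mulmxBl -mulmxBr ler_wpM2l.
Qed.

(** Since [T Sigma T = Xi] for the transport matrix [T], the trace of the square of [(1 - T) Sigma]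
    involves only one term that is not yet explicit, [\tr (T Sigma Sigma)]; the sum over eigenpairs
    is that trace. *)
Lemma bures_variance (kappa : 'I_d -> R) (r : 'I_d -> 'cV[R]_d) :
  orthonormal_eigenpairs (sqrtmx Xi *m Sigma *m sqrtmx Xi) kappa r ->
  2 * \tr (A *m Sigma *m (A *m Sigma)) =
  2 * \tr (Sigma *m Sigma) + 2 * \tr (Sigma *m Xi)
  - 4 * \sum_k Num.sqrt (kappa k) *
      ((r k)^T *m invmx (sqrtmx Xi) *m Sigma *m sqrtmx Xi *m r k) 0 0.
Proof.
rewrite -/H => -[Mr rr]; pose Q : 'M[R]_d := \matrix_(i, k) r k i 0.
have Qcol k : col k Q = r k by apply/colP => i; rewrite !mxE.
have Qo : Q^T *m Q = 1%:M.
  apply/matrixP => j k; rewrite !mxE -rr !mxE; apply: eq_bigr => i _.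
  by rewrite !mxE.
have quadQ Y k : (Q^T *m Y *m Q) k k = ((r k)^T *m Y *m r k) 0 0.
  rewrite -!Qcol tr_col -row_mul !mxE; apply: eq_bigr => i _.
  by rewrite !mxE.
pose l : 'rV[R]_d := \row_k kappa k.
have MQ : H *m Sigma *m H *m Q = Q *m diag_mx l.
  apply/matrixP => i k; rewrite mul_mx_diag.
  have -> : (H *m Sigma *m H *m Q) i k = (H *m Sigma *m H *m r k) i 0.
    by rewrite -Qcol !mxE; apply: eq_bigr => j _; rewrite !mxE.
  by rewrite Mr -Qcol !mxE mulrC.
have ME : H *m Sigma *m H = Q *m diag_mx l *m Q^T.
  by rewrite -MQ -(mulmxA _ Q) orth_tr// mulmx1.
have k0 k : 0 <= kappa k.
  have [_ /(_ (r k))] := sandwich_psd Xc Sc.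
  by rewrite -mulmxA Mr -scalemxAr mxE rr eqxx mulr1.
(* The eigenpairs are given, whereas [B] comes from a decomposition chosen by [sqrtmx]; uniqueness
   of the square root identifies the two. *)
have BE : Q *m diag_mx (map_mx Num.sqrt l) *m Q^T = B.
  apply: sqrt_uniq => //; first by apply: diag_psd => k; rewrite !mxE sqrtr_ge0.
  rewrite BB ME -!mulmxA (mulmxA Q^T) Qo mul1mx (mulmxA (diag_mx _) (diag_mx _)) mulmx_diag.
  congr (_ *m (_ *m _)); congr diag_mx.
  by apply/rowP => k; rewrite !mxE -expr2 sqr_sqrtr.
have -> : \sum_k Num.sqrt (kappa k) *
      ((r k)^T *m invmx H *m Sigma *m H *m r k) 0 0 =
    \tr (B *m (invmx H *m Sigma *m H)).
  rewrite -BE -2!mulmxA mxtrace_mulC -!mulmxA mxtrace_mulC.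
  apply: eq_bigr => k _; rewrite mul_mx_diag [RHS]mxE mulrC; congr (_ * _); last first.
    by rewrite !mxE.
  by have := quadQ (invmx H *m Sigma *m H) k; rewrite !mulmxA => <-.
have -> : \tr (B *m (invmx H *m Sigma *m H)) = \tr (transport_mx Sigma Xi *m Sigma *m Sigma).
  (* Writing [B] as [B^-1 B^2] brings out the inverse that occurs in [transport_mx]. *)
  have {1}-> : B = invmx B *m (H *m Sigma *m H) by rewrite -BB mulKmx.
  rewrite !mulmxA mulmxK// /transport_mx -/H -/B.
  by rewrite mxtrace_mulC !mulmxA.
have -> : A *m Sigma *m (A *m Sigma) = Sigma *m Sigma - transport_mx Sigma Xi *m Sigma *m Sigma
    - Sigma *m transport_mx Sigma Xi *m Sigma + Xi *m Sigma.
  have := transport_mxE; rewrite /A; move: (transport_mx Sigma Xi) => T TE.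
  rewrite mulmxBl mul1mx mulmxBl !mulmxBr !mulmxA TE.
  by rewrite opprB (addrC (Xi *m Sigma)) addrA; congr (_ + _); exact: addrAC.
rewrite raddfD/= !raddfB/= (mxtrace_mulC Sigma Xi).
rewrite -(mulmxA Sigma (transport_mx _ _)) (mxtrace_mulC Sigma (_ *m _)); lra.
Qed.

End pd.

(** The shift by [e] replaces the inverse of [D], which may not exist. In the trace bound,
    [(D + e)^-1 D^2] falls short of [D] by [e (D + e)^-1 D], whose trace is nonnegative. *)
Lemma psd_resolvent D e : covariance_matrix D -> 0 < e ->
  [/\ D + e%:M \in unitmx, covariance_matrix (D + e%:M) &
    \tr (invmx (D + e%:M) *m (D *m D)) <= \tr D].
Proof.
move=> Dp e0; have [DT D0] := Dp.
have Dep : covariance_matrix (D + e%:M).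
  split; first by rewrite linearD/= DT tr_scalar_mx.
  move=> x; rewrite mulmxDr mulmxDl mxE addr_ge0// mul_mx_scalar -scalemxAl mxE.
  by rewrite mulr_ge0 ?(ltW e0)// dotxx_ge0.
have u : D + e%:M \in unitmx.
  have [P [l [Po l0 DE]]] := psd_spectral Dp.
  have -> : D + e%:M = P *m diag_mx (const_mx e + l) *m P^T.
    rewrite linearD/= mulmxDr mulmxDl addrC -DE; congr (_ + _).
    by rewrite diag_const_mx mul_mx_scalar -scalemxAl orth_tr// scalemx1.
  rewrite !unitmx_mul unitmx_tr (mulmx1_unit Po).2 andbT/=.
  rewrite unitmxE det_diag unitfE; apply/prodf_neq0 => i _; rewrite !mxE gt_eqF//.
  by rewrite ltr_wpDr.
split => //; set K := invmx _.
have KDD : K *m (D *m D) = D - e *: (K *m D).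
  rewrite -[X in X - _]mul1mx -(mulVmx u) -/K -!mulmxA scalemxAr -mulmxBr; congr (_ *m _).
  by rewrite mulmxDl mul_scalar_mx addrK.
rewrite KDD raddfB/= mxtraceZ gerBl mulr_ge0 ?(ltW e0)//.
have [[ET _] EE] := sqrtmx_spec Dp.
rewrite -EE mulmxA mxtrace_mulC mulmxA -[X in X *m K]ET.
by apply: psd_tr_ge0; exact: psd_inv.
Qed.

(** Continuity of the trace of the root at singular matrices, out of reach of [sqrt_diff_lip]. With
    [K = (D + e)^-1], positivity of [(F - D - e) K (F - D - e)] bounds [2 \tr F] by
    [\tr (K F^2) + \tr D + e d], and [K F^2] is compared with [K D^2]. *)
Lemma tr_sqrt_cont D F e : covariance_matrix D -> covariance_matrix F -> 0 < e ->
  \tr F <= \tr D + e * d%:R + nrm2 (F *m F - D *m D) / e ^+ 3.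
Proof.
move=> Dp Fp e0; have [u Dep KDD] := psd_resolvent Dp e0.
set K := invmx _ in KDD; have Kp : covariance_matrix K by exact: psd_inv.
have [KT _] := Kp; have [FT _] := Fp; have [DT _] := Dp; have [DeT _] := Dep.
have nK : e ^+ 2 * nrm2 K <= d%:R.
  have -> : d%:R = nrm2 ((D + e%:M) *m K).
    by rewrite mulmxV// /nrm2 trmx1 mulmx1 mxtrace1.
  rewrite mulmxDl mul_scalar_mx /nrm2.
  have -> : (D *m K + e *: K)^T = K *m D + e *: K by rewrite linearD/= linearZ/= trmx_mul KT DT.
  rewrite mulmxDl !mulmxDr !raddfD/= -!scalemxAl -!scalemxAr !mxtraceZ KT mulrA.
  rewrite -expr2 addrA lerDr addr_ge0//.
    rewrite addr_ge0//; first by have := nrm2_ge0 (D *m K); rewrite /nrm2 trmx_mul KT DT.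
    by rewrite mulr_ge0 ?(ltW e0)// -{1}KT psd_tr_ge0.
  by rewrite mulr_ge0 ?(ltW e0)// mulmxA -{1}KT psd_tr_ge0.
have key : 0 <= \tr (K *m (F *m F)) - 2 * \tr F + \tr D + e * d%:R.
  have : 0 <= \tr ((F - (D + e%:M))^T *m K *m (F - (D + e%:M))) by exact: psd_tr_ge0.
  have -> : (F - (D + e%:M))^T = F - (D + e%:M) by rewrite linearB/= FT DeT.
  set De := D + e%:M.
  have -> : (F - De) *m K *m (F - De) = F *m K *m F - F - F + De.
    rewrite mulmxBl mulmxV// mulmxBr mulmxBl mul1mx mulmxBl mul1mx.
    by rewrite -(mulmxA F K De) /K mulVmx// mulmx1 opprB addrA addrAC.
  rewrite /De !raddfD/= !raddfN/= mxtrace_scalar (mxtrace_mulC _ F) mulmxA mxtrace_mulC => h.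
  by rewrite (le_trans h)// -mulr_natr; lra.
have KF : \tr (K *m (F *m F)) <= \tr D + \tr (K *m (F *m F - D *m D)).
  by rewrite mulmxBr raddfB/= addrCA lerDl subr_ge0.
set X := F *m F - D *m D in KF *.
have XT : X^T = X by rewrite /X linearB/= !trmx_mul FT DT.
clearbody X.
have e3 : 0 < e ^+ 3 by rewrite exprn_gt0.
(* Young's inequality with weight [e ^+ 3]: as [e ^+ 2 * nrm2 K <= d], the term in [K] costs only
   [e * d]. *)
have : 0 <= nrm2 (e ^+ 3 *: K - X) by exact: nrm2_ge0.
have -> : nrm2 (e ^+ 3 *: K - X) = e ^+ 3 * (e * (e ^+ 2 * nrm2 K)) - 2 * e ^+ 3 * \tr (K *m X) + nrm2 X.
  have T : (e ^+ 3 *: K - X)^T = e ^+ 3 *: K - X by rewrite linearB/= linearZ/= XT KT.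
  rewrite /nrm2 T XT KT mulmxBl !mulmxBr -!scalemxAl -!scalemxAr.
  rewrite !raddfB/= !mxtraceZ (mxtrace_mulC X K); ring.
have : e * (e ^+ 2 * nrm2 K) <= e * d%:R by rewrite ler_pM2l.
set y := e * (_ * _) => yd h.
have : 2 * \tr (K *m X) <= y + nrm2 X / e ^+ 3.
  have zE : nrm2 X = e ^+ 3 * (nrm2 X / e ^+ 3) by rewrite mulrC divfK// gt_eqF.
  move: h; rewrite {1}zE; set z := _ / _ => h.
  have : 0 <= e ^+ 3 * (y - 2 * \tr (K *m X) + z) by lra.
  by rewrite pmulr_rge0//; lra.
have : 0 <= nrm2 X / e ^+ 3 by rewrite divr_ge0 ?nrm2_ge0// ltW.
have : 0 <= e * d%:R by rewrite mulr_ge0// ltW.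
lra.
Qed.

(** [G = H^-1 D H^-1] is the optimal transport map from [Xi] to [S]. In this direction only [Xi] is
    inverted, so [S] may be singular. *)
Lemma gelbrich_map Xi S : covariance_matrix Xi -> Xi \in unitmx ->
  covariance_matrix S -> let H := sqrtmx Xi in let D := sqrtmx (H *m S *m H) in
  exists G, [/\ G^T = G, G *m Xi *m G = S & \tr (G *m Xi) = \tr D].
Proof.
move=> Xc Xu Sc H D; have [[HT _] HH] := sqrtmx_spec Xc.
have Hu := sqrtmx_unit Xc Xu.
have [[DT _] DD] := sqrtmx_spec (sandwich_psd Xc Sc).
rewrite -/H in HT HH Hu; rewrite -/H -/D in DT DD.
exists (invmx H *m D *m invmx H); split.
- by rewrite !trmx_mul trmx_inv HT DT mulmxA.
- rewrite -HH !mulmxA mulmxKV// mulmxK// -(mulmxA (invmx H) D D) DD.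
  by rewrite !mulmxA mulVmx// mul1mx mulmxK.
- by rewrite -HH mulmxA mulmxKV// -mulmxA mxtrace_mulC -mulmxA mulmxV// mulmx1.
Qed.

(** [A = H (D + e)^-1 H] and [A' = H^-1 (D + e) H^-1] are inverse to each other, so the last clause
    is Fenchel's inequality for a quadratic form. They are dual potentials of the transport problem,
    optimal up to [e * d], the price for inverting a possibly singular [D]. *)
Lemma gelbrich_dual Xi S e : covariance_matrix Xi -> Xi \in unitmx ->
  covariance_matrix S -> 0 < e ->
  let H := sqrtmx Xi in let D := sqrtmx (H *m S *m H) in
  exists A A' : 'M[R]_d, [/\ A^T = A, A'^T = A', \tr (A *m S) <= \tr D, \tr (A' *m Xi) = \tr D + e * d%:R &
    forall x y : 'cV[R]_d, 2 * (x^T *m y) 0 0 <= (x^T *m A *m x) 0 0 + (y^T *m A' *m y) 0 0].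
Proof.
move=> Xc Xu Sc e0 H D; have [[HT _] HH] := sqrtmx_spec Xc.
have Hu := sqrtmx_unit Xc Xu.
have [Dp DD] := sqrtmx_spec (sandwich_psd Xc Sc).
rewrite -/H in HT HH Hu; rewrite -/H -/D in Dp DD.
have [u Dep KDD] := psd_resolvent Dp e0.
set K := invmx _ in KDD; set De := D + e%:M in Dep u K KDD.
have [DeT _] := Dep.
have KT : K^T = K by rewrite /K trmx_inv DeT.
exists (H *m K *m H), (invmx H *m De *m invmx H); split.
- by rewrite !trmx_mul HT KT mulmxA.
- by rewrite !trmx_mul trmx_inv HT DeT mulmxA.
- by rewrite -2!mulmxA mxtrace_mulC -mulmxA -DD.
- rewrite -HH mulmxA mulmxKV// -mulmxA mxtrace_mulC -mulmxA mulmxV// mulmx1.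
  by rewrite raddfD/= mxtrace_scalar mulr_natr.
move=> x y.
pose u1 := H *m x; pose v1 := invmx H *m y.
have xy : x^T *m y = u1^T *m v1.
  by rewrite /u1 /v1 trmx_mul HT -mulmxA mulKVmx.
have -> : x^T *m (H *m K *m H) *m x = u1^T *m K *m u1.
  by rewrite /u1 trmx_mul HT !mulmxA.
have -> : y^T *m (invmx H *m De *m invmx H) *m y = v1^T *m De *m v1.
  by rewrite /v1 trmx_mul trmx_inv HT !mulmxA.
rewrite xy; have [_ /(_ (K *m u1 - v1))] := Dep.
have -> : (K *m u1 - v1)^T *m De *m (K *m u1 - v1) =
    u1^T *m K *m u1 - u1^T *m v1 - (v1^T *m u1 - v1^T *m De *m v1).
  have -> : (K *m u1 - v1)^T = u1^T *m K - v1^T by rewrite linearB/= trmx_mul KT.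
  rewrite mulmxBl -(mulmxA _ K) mulVmx// mulmx1.
  by rewrite mulmxBl !mulmxBr !mulmxA -(mulmxA v1^T De K) mulmxV// mulmx1.
rewrite (dotC v1); move: (u1^T *m K *m u1) (u1^T *m v1) (v1^T *m De *m v1) => a b c.
rewrite !mxE; lra.
Qed.

End bures.

(** * Moments *)

Section moments.
Context {R : realType}.

(* Unlike integrable functions, these are closed under products. *)
Definition all_moments d (T : measurableType d) (P : probability T R) (f : T -> R) :=
  measurable_fun [set: T] f /\
  forall k, P.-integrable [set: T] (fun x => (`|f x| ^+ k)%:E).

Notation Ex P f := (Rintegral P setT f).

Section algebra.
Context d (T : measurableType d) (P : probability T R).
Implicit Types f g h : T -> R.

Lemma dominated_integrable f g : measurable_fun [set: T] f ->
  (forall x, `|f x| <= g x) -> P.-integrable [set: T] (EFin \o g) ->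
  P.-integrable [set: T] (EFin \o f).
Proof.
move=> mf fg; apply: le_integrable => //; first exact/measurable_EFinP.
by move=> x _; rewrite lee_fin (le_trans (fg x))// ler_norm.
Qed.

Lemma all_moments_meas f : all_moments P f -> measurable_fun [set: T] f.
Proof. by case. Qed.

Lemma all_moments_int f : all_moments P f -> P.-integrable [set: T] (EFin \o f).
Proof.
move=> [mf /(_ 1%N) H]; exact: dominated_integrable H.
Qed.

Lemma all_moments_cst c : all_moments P (cst c).
Proof. by split => // k; exact: (finite_measure_integrable_cst P (`|c| ^+ k) measurableT). Qed.

Lemma all_moments_dom f g : measurable_fun [set: T] f ->
  (forall x, `|f x| <= `|g x|) -> all_moments P g -> all_moments P f.
Proof.
move=> mf fg [mg Hg]; split => // k; apply: (@dominated_integrable _ (fun x => `|g x| ^+ k)).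
  by apply: measurable_funX; exact: measurableT_comp.
by move=> x; rewrite normrX normr_id lerXn2r// nnegrE.
exact: Hg.
Qed.

Lemma all_momentsD f g : all_moments P f -> all_moments P g ->
  all_moments P (fun x => f x + g x).
Proof.
move=> [mf Hf] [mg Hg]; have mfg : measurable_fun setT (fun x => f x + g x) by exact: measurable_funD.
split => // k.
apply: (@dominated_integrable _ (fun x => 2 ^+ k * (`|f x| ^+ k + `|g x| ^+ k))).
- by apply: measurable_funX; exact: measurableT_comp.
- move=> x; rewrite normrX normr_id.
  have le2 (a b : R) : 0 <= a -> a <= b -> (a + b) ^+ k <= 2 ^+ k * (a ^+ k + b ^+ k).
    move=> a0 ab; have b0 := le_trans a0 ab.
    apply: (@le_trans _ _ ((2 * b) ^+ k)).
      by rewrite lerXn2r ?nnegrE ?addr_ge0 ?mulr_ge0//; lra.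
    by rewrite exprMn ler_wpM2l ?exprn_ge0// lerDr exprn_ge0.
  apply: (@le_trans _ _ ((`|f x| + `|g x|) ^+ k)).
    by rewrite lerXn2r ?nnegrE ?addr_ge0 ?ler_normD.
  have [fg|/ltW gf] := leP `|f x| `|g x|; first exact: le2.
  by rewrite addrC [X in _ * X]addrC; exact: le2.
- have := integrableZl measurableT (2 ^+ k) (integrableD measurableT (Hf k) (Hg k)).
  by apply: eq_integrable => // x _; rewrite /= EFinM EFinD.
Qed.

Lemma all_momentsM f g : all_moments P f -> all_moments P g ->
  all_moments P (fun x => f x * g x).
Proof.
move=> [mf Hf] [mg Hg]; have mfg : measurable_fun setT (fun x => f x * g x) by exact: measurable_funM.
split => // k.
apply: (@dominated_integrable _ (fun x => `|f x| ^+ (k * 2) + `|g x| ^+ (k * 2))).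
- by apply: measurable_funX; exact: measurableT_comp.
- move=> x; rewrite normrX normr_id normrM exprMn !exprM.
  set a := _ ^+ k; set b := _ ^+ k.
  have a0 : 0 <= a by exact: exprn_ge0.
  have b0 : 0 <= b by exact: exprn_ge0.
  have [ab|/ltW ba] := leP a b.
    by rewrite (@le_trans _ _ (b ^+ 2)) ?lerDr ?sqr_ge0// expr2 ler_wpM2r.
  by rewrite (@le_trans _ _ (a ^+ 2)) ?lerDl ?sqr_ge0// expr2 ler_wpM2l.
- have := integrableD measurableT (Hf (k * 2)%N) (Hg (k * 2)%N).
  by apply: eq_integrable => // x _; rewrite /= EFinD.
Qed.

Lemma all_momentsZ c f : all_moments P f -> all_moments P (fun x => c * f x).
Proof. by move=> Hf; apply: all_momentsM => //; exact: all_moments_cst. Qed.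

Lemma all_momentsN f : all_moments P f -> all_moments P (fun x => - f x).
Proof. by move=> /(all_momentsZ (-1)); under eq_fun do rewrite mulN1r. Qed.

Lemma all_momentsB f g : all_moments P f -> all_moments P g ->
  all_moments P (fun x => f x - g x).
Proof. by move=> Hf Hg; apply: all_momentsD => //; exact: all_momentsN. Qed.

Lemma all_momentsX k f : all_moments P f -> all_moments P (fun x => f x ^+ k).
Proof.
move=> Hf; elim: k => [|k IH]; first by under eq_fun do rewrite expr0; exact: all_moments_cst.
by under eq_fun do rewrite exprS; exact: all_momentsM.
Qed.

Lemma all_moments_sum I (s : seq I) (p : pred I) (F : I -> T -> R) :
  (forall i, p i -> all_moments P (F i)) -> all_moments P (fun x => \sum_(i <- s | p i) F i x).
Proof.
move=> HF; elim: s => [|i s IH].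
  by under eq_fun do rewrite big_nil; exact: all_moments_cst.
under eq_fun do rewrite big_cons.
by have [pi|//] := boolP (p i); apply: all_momentsD => //; exact: HF.
Qed.

Lemma all_moments_norm f : all_moments P f -> all_moments P (fun x => `|f x|).
Proof.
move=> Hf; apply: (all_moments_dom _ _ Hf); last by move=> x; rewrite normr_id.
by apply: measurableT_comp => //; case: Hf.
Qed.

Lemma ExD f g : all_moments P f -> all_moments P g ->
  Ex P (fun x => f x + g x) = Ex P f + Ex P g.
Proof. by move=> /all_moments_int Hf /all_moments_int Hg; rewrite RintegralD. Qed.

Lemma ExZ c f : all_moments P f -> Ex P (fun x => c * f x) = c * Ex P f.
Proof. by move=> /all_moments_int Hf; rewrite RintegralZl. Qed.

Lemma ExB f g : all_moments P f -> all_moments P g ->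
  Ex P (fun x => f x - g x) = Ex P f - Ex P g.
Proof. by move=> /all_moments_int Hf /all_moments_int Hg; rewrite RintegralB. Qed.

Lemma Ex_cst c : Ex P (fun=> c) = c.
Proof. by rewrite Rintegral_cst//= probability_setT mulr1. Qed.

Lemma Ex_sum I (s : seq I) (p : pred I) (F : I -> T -> R) :
  (forall i, p i -> all_moments P (F i)) ->
  Ex P (fun x => \sum_(i <- s | p i) F i x) = \sum_(i <- s | p i) Ex P (F i).
Proof.
move=> HF; elim: s => [|i s IH].
  by rewrite big_nil; under eq_Rintegral do rewrite big_nil; rewrite Ex_cst.
rewrite big_cons; under eq_Rintegral do rewrite big_cons.
have [pi|//] := boolP (p i); rewrite ExD ?IH//; first exact: HF.
exact: all_moments_sum.
Qed.

Lemma le_Ex f g : all_moments P f -> all_moments P g ->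
  (forall x, f x <= g x) -> Ex P f <= Ex P g.
Proof. by move=> /all_moments_int Hf /all_moments_int Hg fg; rewrite le_Rintegral. Qed.

Lemma Ex_ge0 f : (forall x, 0 <= f x) -> 0 <= Ex P f.
Proof. by move=> f0; apply: Rintegral_ge0. Qed.

Lemma ExE f : all_moments P f -> (\int[P]_x (f x)%:E)%E = (Ex P f)%:E.
Proof. by move=> /all_moments_int Hf; rewrite /Rintegral fineK// integrable_fin_num. Qed.

End algebra.

Section transfer.
Context d1 d2 (T1 : measurableType d1) (T2 : measurableType d2).
Variables (P : probability T1 R) (Q : probability T2 R) (phi : T1 -> T2).
Hypothesis mphi : measurable_fun setT phi.
Hypothesis QP : forall A, measurable A -> Q A = P (phi @^-1` A).

Let Phi : {mfun T1 >-> T2} := HB.pack phi (isMeasurableFun.Build _ _ _ _ _ mphi).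

Let intQ f : (\int[Q]_x f x = \int[distribution P Phi]_x f x)%E.
Proof. by apply: eq_measure_integral => A mA _; exact: QP. Qed.

Lemma transfer_ge0 (f : T2 -> \bar R) : measurable_fun setT f ->
  (forall y, 0 <= f y)%E -> (\int[Q]_y f y = \int[P]_x f (phi x))%E.
Proof. by move=> mf f0; rewrite intQ ge0_integral_distribution. Qed.

Lemma transfer_integrable f : measurable_fun setT f ->
  Q.-integrable setT f <-> P.-integrable setT (f \o phi).
Proof.
move=> mf; have mfp : measurable_fun setT (f \o phi) by exact: measurableT_comp.
have E : (\int[Q]_y `|f y| = \int[P]_x `|f (phi x)|)%E.
  by apply: (@transfer_ge0 (fun y => `|f y|%E)) => //; exact: measurableT_comp.
by split => /integrableP[_ h]; apply/integrableP; split => //; rewrite -?E// E.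
Qed.

Lemma transfer_moments f : measurable_fun setT f ->
  all_moments Q f <-> all_moments P (f \o phi).
Proof.
move=> mf; have mk k : measurable_fun setT (fun x => (`|f x| ^+ k)%:E).
  by apply/measurable_EFinP; apply: measurable_funX; exact: measurableT_comp.
split => -[_ H]; split => //; try exact: measurableT_comp.
  by move=> k; have [/(_ (H k))] := transfer_integrable (mk k).
by move=> k; apply/transfer_integrable => //; exact: H.
Qed.

Lemma transfer_Rintegral f : measurable_fun setT f ->
  P.-integrable setT (EFin \o (f \o phi)) -> Ex Q f = Ex P (f \o phi).
Proof.
move=> mf If; rewrite /Rintegral intQ integral_distribution//.
exact/measurable_EFinP.
Qed.

Lemma transfer_Ex f : measurable_fun setT f -> all_moments P (f \o phi) ->
  Ex Q f = Ex P (f \o phi).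
Proof. by move=> mf If; apply: transfer_Rintegral => //; exact: all_moments_int. Qed.

End transfer.

Section product.
Context d1 d2 (T1 : measurableType d1) (T2 : measurableType d2).
Variables (P : probability T1 R) (Q : probability T2 R).

Lemma prod_moments_fst f : all_moments P f -> all_moments (P \x Q)%E (fun z => f z.1).
Proof.
move=> Hf; apply/(transfer_moments (Q := P) (phi := fst)) => //.
  move=> A mA; rewrite (_ : fst @^-1` A = A `*` setT) ; last first.
    by apply/seteqP; split => -[x y] //= [].
  have E : (P \x Q)%E (A `*` setT) = (P A * Q setT)%E := product_measure1E P Q mA measurableT.
  by apply/esym/(etrans E); rewrite probability_setT mule1.
by case: Hf.
Qed.

Lemma prod_moments_snd f : all_moments Q f -> all_moments (P \x Q)%E (fun z => f z.2).
Proof.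
move=> Hf; apply/(transfer_moments (Q := Q) (phi := snd)) => //.
  move=> A mA; rewrite (_ : snd @^-1` A = setT `*` A) ; last first.
    by apply/seteqP; split => -[x y] //= [].
  have E : (P \x Q)%E (setT `*` A) = (P setT * Q A)%E := product_measure1E P Q measurableT mA.
  by apply/esym/(etrans E); rewrite probability_setT mul1e.
by case: Hf.
Qed.

Lemma prod_Ex f g : all_moments P f -> all_moments Q g ->
  Ex (P \x Q)%E (fun z => f z.1 * g z.2) = Ex P f * Ex Q g.
Proof.
move=> Hf Hg; rewrite /Rintegral -integral12_prod_meas1; last first.
  by apply: all_moments_int; apply: all_momentsM; [exact: prod_moments_fst|exact: prod_moments_snd].
rewrite /fubini_F /=.
under eq_integral.
  move=> x _; under eq_integral do rewrite EFinM.
  rewrite integralZl//; last exact: all_moments_int.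
  rewrite (ExE Hg) -EFinM mulrC.
  over.
rewrite /= -/(Rintegral P setT (fun x => Ex Q g * f x)) ExZ//.
by rewrite mulrC.
Qed.

End product.

End moments.
Notation Ex P f := (Rintegral P setT f).

(** * The standard normal law *)

Section density.
Import HBNNSimple.
Context {R : realType}.
Local Open Scope ereal_scope.

Lemma ge0_integral_density d (T : measurableType d) (mu P : {measure set T -> \bar R})
    (p : T -> R) : measurable_fun setT p -> (forall x, (0 <= p x)%R) ->
  (forall A, measurable A -> P A = \int[mu]_(x in A) (p x)%:E) ->
  forall f : T -> \bar R, measurable_fun setT f -> (forall x, 0 <= f x) ->
  \int[P]_x f x = \int[mu]_x (f x * (p x)%:E).
Proof.
move=> mp p0 PE f mf f0; pose h := nnsfun_approx measurableT mf.
have hf x : (EFin \o h ^~ x) @ \oo --> f x by exact: cvg_nnsfun_approx.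
have -> : \int[P]_x f x = limn (fun n => \int[P]_x (h n x)%:E).
  rewrite -monotone_convergence//.
  - by apply: eq_integral => x _; apply/esym/cvg_lim => //; exact: hf.
  - by move=> n; exact/measurable_EFinP.
  - by move=> n x _; rewrite lee_fin.
  - by move=> x _ m n mn; rewrite lee_fin; exact/lefP/nd_nnsfun_approx.
have mhp n : measurable_fun setT (fun x => (h n x)%:E * (p x)%:E).
  by apply: emeasurable_funM; exact/measurable_EFinP.
have -> : \int[mu]_x (f x * (p x)%:E) = limn (fun n => \int[mu]_x ((h n x)%:E * (p x)%:E)).
  rewrite -monotone_convergence//.
  - apply: eq_integral => x _; apply/esym/cvg_lim => //.
    by apply: cvgeZr => //; exact: hf.
  - by move=> n x _; rewrite -EFinM lee_fin mulr_ge0.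
  - move=> x _ m n mn; rewrite -!EFinM lee_fin ler_wpM2r//.
    exact/lefP/nd_nnsfun_approx.
apply/congr_lim/funext => n /=; rewrite integralT_nnsfun sintegralE.
transitivity (\int[mu]_x (\sum_(k \in range (h n)) (k * \1_(h n @^-1` [set k]) x)%:E * (p x)%:E)).
  rewrite ge0_integral_fsum//; last 2 first.
  - move=> k; apply: emeasurable_funM; last exact/measurable_EFinP.
    by apply/measurable_EFinP/measurable_funM.
  - by move=> k x _; rewrite EFinM mule_ge0// ?nnfun_muleindic_ge0// lee_fin.
  apply: eq_fsbigr => k; rewrite inE => -[y _ hk].
  have k0 : (0 <= k)%R by rewrite -hk.
  rewrite PE// integral_mkcond.
  rewrite -ge0_integralZl//; last 2 first.
  - apply/(measurable_restrictT _ _).1 => //; exact/measurable_funTS/measurable_EFinP.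
  - by move=> x _; rewrite patchE; case: ifPn => // _; rewrite lee_fin.
  apply: eq_integral => x _; rewrite patchE EFinM indicE.
  by case: ifPn => _; rewrite ?mule1 ?mule0 ?mul0e.
apply: eq_integral => x _; rewrite -ge0_mule_fsuml; last first.
  by move=> k; rewrite nnfun_muleindic_ge0.
by rewrite fsumEFin// -fimfunE.
Qed.

End density.

Section lebesgue_invariance.
Context {R : realType}.
Local Notation leb := (@lebesgue_measure R).
Local Open Scope ereal_scope.

Lemma lebesgue_measure_shift (a : R) (A : set R) : measurable A ->
  pushforward leb (fun x : R => (x + a)%R : measurableTypeR R) A = leb A.
Proof.
move=> mA; apply/esym.
have mshift : measurable_fun setT (fun x : R => (x + a)%R : measurableTypeR R).
  by apply: measurable_funD.
apply: (@lebesgue_measure_unique _ (pushforward leb (fun x : R => (x + a)%R : measurableTypeR R))) => //= _ [[u v]] _ <-.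
rewrite /pushforward.
have -> : (fun x : R => (x + a)%R : measurableTypeR R) @^-1` [set` `]u, v]] = [set` `](u - a)%R, (v - a)%R]].
  by apply/seteqP; split => x /=; rewrite !in_itv/= ltrBlDr lerBrDr.
rewrite !lebesgue_measure_itv/= !lte_fin ltrD2r.
by case: ifPn => // _; rewrite -EFinB -[RHS]EFinB; congr EFin; ring.
Qed.

Lemma integral_shift (a : R) (f : R -> \bar R) : measurable_fun setT f ->
  (forall x, 0 <= f x) -> \int[leb]_x f (x + a)%R = \int[leb]_x f x.
Proof.
move=> mf f0.
have mshift : measurable_fun setT (fun x : R => (x + a)%R : measurableTypeR R).
  by apply: measurable_funD.
rewrite [RHS](@eq_measure_integral _ _ _ _ (pushforward leb (fun x : R => (x + a)%R : measurableTypeR R))).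
  by rewrite ge0_integral_pushforward.
by move=> A mA _; apply/esym/lebesgue_measure_shift.
Qed.

Lemma integral_opp (f : R -> \bar R) : measurable_fun setT f ->
  (forall x, 0 <= f x) -> \int[leb]_x f (- x)%R = \int[leb]_x f x.
Proof.
move=> mf f0.
have mopp : measurable_fun setT (fun x : R => (- x)%R : measurableTypeR R).
  by apply: measurable_funN.
rewrite [RHS](@eq_measure_integral _ _ _ _ (pushforward leb (fun x : R => (- x)%R : measurableTypeR R))).
  by rewrite ge0_integral_pushforward.
by move=> A mA _; apply/esym/lebesgue_measureN.
Qed.

(** Iterated rather than taken against a product measure: a shear then acts as a translation of the
    inner variable. *)
Definition leb2 (F : R * R -> \bar R) := \int[leb]_x \int[leb]_y F (x, y).

Lemma leb2C (F : R * R -> \bar R) : measurable_fun setT F -> (forall z, 0 <= F z) ->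
  leb2 F = leb2 (fun z => F (z.2, z.1)).
Proof. by move=> mF F0; rewrite /leb2 (@fubini_tonelli _ _ _ _ _ leb leb F). Qed.

Lemma leb2_shear2 (a : R) (F : R * R -> \bar R) : measurable_fun setT F -> (forall z, 0 <= F z) ->
  leb2 (fun z => F (z.1, z.2 + a * z.1)%R) = leb2 F.
Proof.
move=> mF F0; apply: eq_integral => x _ /=.
rewrite (integral_shift (a * x)%R (f := fun y => F (x, y)))//.
exact: measurableT_comp.
Qed.

Lemma leb2_shear1 (a : R) (F : R * R -> \bar R) : measurable_fun setT F -> (forall z, 0 <= F z) ->
  leb2 (fun z => F (z.1 + a * z.2, z.2)%R) = leb2 F.
Proof.
move=> mF F0.
have mS : measurable_fun setT (fun z : R * R => F (z.2, z.1)).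
  by apply: (measurableT_comp mF); exact: measurable_fun_pair.
have mG : measurable_fun setT (fun z : R * R => F (z.1 + a * z.2, z.2)%R).
  apply: (measurableT_comp mF); apply: measurable_fun_pair => //.
  by apply: measurable_funD => //; exact: measurable_funM.
exact: etrans (leb2C mG (fun=> F0 _)) (etrans (leb2_shear2 a mS (fun=> F0 _)) (esym (leb2C mF F0))).
Qed.

Lemma leb2_opp (F : R * R -> \bar R) : measurable_fun setT F -> (forall z, 0 <= F z) ->
  leb2 (fun z => F (- z.1, - z.2)%R) = leb2 F.
Proof.
move=> mF F0; rewrite /leb2.
rewrite -[RHS]integral_opp; last 2 first.
- exact: measurable_fun_fubini_tonelli_F.
- by move=> x; apply: integral_ge0.
apply: eq_integral => x _ /=; rewrite (integral_opp (f := fun y => F ((- x)%R, y)))//.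
exact: measurableT_comp.
Qed.

Definition rot (c s : R) (z : R * R) : R * R := (c * z.1 - s * z.2, s * z.1 + c * z.2)%R.

Lemma measurable_rot c s : measurable_fun setT (rot c s).
Proof.
apply: measurable_fun_pair.
  by apply: measurable_funB; apply: measurable_funM.
by apply: measurable_funD; apply: measurable_funM.
Qed.

(* A rotation by an angle that is not a multiple of pi is a product of three shears. *)
Lemma leb2_rot (c s : R) (F : R * R -> \bar R) : (c ^+ 2 + s ^+ 2 = 1)%R ->
  measurable_fun setT F -> (forall z, 0 <= F z) ->
  leb2 (F \o rot c s) = leb2 F.
Proof.
move=> cs mF F0.
have [s0|s0] := eqVneq s 0%R.
  have : (c ^+ 2 == 1)%R by rewrite -cs s0 expr0n addr0.
  rewrite sqrf_eq1 => /orP[]/eqP ->; rewrite s0.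
    by apply: eq_integral => x _; apply: eq_integral => y _; rewrite /rot/= !(mul1r, mul0r) subr0 add0r.
  apply: etrans (leb2_opp mF F0).
  by apply: eq_integral => x _; apply: eq_integral => y _; rewrite /rot/= !(mulN1r, mul0r) subr0 add0r.
(* The tangent of half the angle; the three shears have coefficients [- t], [s], [- t]. *)
pose t := ((1 - c) / s)%R.
have m1 a (G : R * R -> \bar R) : measurable_fun setT G -> measurable_fun setT (fun z : R * R => G (z.1 + a * z.2, z.2)%R).
  move=> mG; apply: (measurableT_comp mG); apply: measurable_fun_pair => //.
  by apply: measurable_funD => //; exact: measurable_funM.
have m2 a (G : R * R -> \bar R) : measurable_fun setT G -> measurable_fun setT (fun z : R * R => G (z.1, z.2 + a * z.1)%R).
  move=> mG; apply: (measurableT_comp mG); apply: measurable_fun_pair => //.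
  by apply: measurable_funD => //; exact: measurable_funM.
have mF1 := m1 (- t)%R F mF; have mF2 := m2 s _ mF1.
apply: etrans (etrans (leb2_shear1 (- t)%R mF2 (fun=> F0 _))
  (etrans (leb2_shear2 s mF1 (fun=> F0 _)) (leb2_shear1 (- t)%R mF F0))).
apply: eq_integral => x _; apply: eq_integral => y _; rewrite /rot/=; congr F.
have c2 : (c ^+ 2 = 1 - s ^+ 2)%R by rewrite -cs addrK.
rewrite /t; congr pair; field: c2; done.
Qed.

End lebesgue_invariance.

Section standard_normal.
Context {R : realType}.
Local Notation leb := (@lebesgue_measure R).

Definition gauss01 : probability R R := normal_law 0 1.
Definition pdf01 (x : R) : R := normal_peak 1 * expR (- (x ^+ 2 / 2)).

Lemma pdf01_ge0 x : 0 <= pdf01 x.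
Proof. by rewrite mulr_ge0 ?normal_peak_ge0 ?expR_ge0. Qed.

Lemma normal_pdfs (s x : R) : 0 < s -> normal_pdf 0 s x = normal_peak s * expR (- (x ^+ 2 / (2 * s ^+ 2))).
Proof.
move=> s0; rewrite normal_pdfE ?gt_eqF// /normal_fun subr0 mulNr.
by rewrite -[s ^+ 2 *+ 2]mulr_natl.
Qed.

Lemma pdf01E x : pdf01 x = normal_pdf 0 1 x.
Proof. by rewrite normal_pdfs// expr1n mulr1. Qed.

Lemma pdf01_rot (c s x y : R) : c ^+ 2 + s ^+ 2 = 1 ->
  pdf01 (c * x - s * y) * pdf01 (s * x + c * y) = pdf01 x * pdf01 y.
Proof.
move=> cs; have c2 : c ^+ 2 = 1 - s ^+ 2 by rewrite -cs addrK.
rewrite /pdf01 (mulrACA (normal_peak 1)) -expRD [RHS](mulrACA (normal_peak 1)) -expRD.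
by congr (_ * expR _); field: c2.
Qed.

Lemma measurable_pdf01 : measurable_fun setT pdf01.
Proof.
by rewrite (_ : pdf01 = normal_pdf 0 1); [exact: measurable_normal_pdf|apply/funext => x; exact: pdf01E].
Qed.

Lemma measurable_EFin_pdf01 : measurable_fun setT (fun x : R => (pdf01 x)%:E).
Proof. by apply: measurableT_comp => //; exact: measurable_pdf01. Qed.

Lemma gauss01E (A : set R) : measurable A ->
  gauss01 A = (\int[leb]_(x in A) (pdf01 x)%:E)%E.
Proof.
move=> mA; rewrite /gauss01 /normal_law oner_eq0 sqrtr1.
by apply: eq_integral => x _; rewrite pdf01E.
Qed.

Lemma gauss01_integral (f : R -> \bar R) : measurable_fun setT f -> (forall x, 0 <= f x)%E ->
  (\int[gauss01]_x f x = \int[leb]_x (f x * (pdf01 x)%:E))%E.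
Proof.
move=> mf f0.
rewrite {1}/gauss01 /normal_law oner_eq0 sqrtr1 ge0_integral_distribution//.
apply: (@ge0_integral_density _ _ _ leb (normal_prob 0 1) pdf01 measurable_pdf01 pdf01_ge0) => //.
by move=> A mA; apply: eq_integral => x _; rewrite pdf01E.
Qed.

(** The density [pdf01 x * pdf01 y] depends only on [x ^+ 2 + y ^+ 2], so the invariance of Lebesgue
    measure in the plane carries over. *)
Lemma gauss2_rot (c s : R) (A : set (R * R)) : c ^+ 2 + s ^+ 2 = 1 -> measurable A ->
  (gauss01 \x gauss01)%E A = (gauss01 \x gauss01)%E (rot c s @^-1` A).
Proof.
move=> cs mA; have mR := measurable_rot c s.
have HA (B : set (R * R)) : measurable B -> (gauss01 \x gauss01)%E B =
    leb2 (fun z => (pdf01 z.1 * (pdf01 z.2 * \1_B z))%:E).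
  move=> mB; have mi : measurable_fun setT (fun z => (\1_B z : R)%:E).
    by apply/measurable_EFinP.
  have -> : (gauss01 \x gauss01)%E B = (\int[(gauss01 \x gauss01)%E]_z (\1_B z)%:E)%E.
    by rewrite integral_indic ?setIT.
  rewrite fubini_tonelli1//.
  rewrite gauss01_integral; last 2 first.
  - by apply: measurable_fun_fubini_tonelli_F => // z; rewrite lee_fin.
  - by move=> x; apply: integral_ge0 => y _; rewrite lee_fin.
  apply: eq_integral => x _; rewrite /fubini_F gauss01_integral; last 2 first.
  - by apply: (measurableT_comp mi); exact: measurable_fun_pair.
  - by move=> y; rewrite lee_fin.
  rewrite muleC -ge0_integralZl//; last 3 first.
  - apply: emeasurable_funM; last exact: measurable_EFin_pdf01.
    by apply: (measurableT_comp mi); exact: measurable_fun_pair.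
  - by move=> y _; rewrite mule_ge0// lee_fin// pdf01_ge0.
  - exact: pdf01_ge0.
  by apply: eq_integral => y _; rewrite -!EFinM [\1_B _ * _]mulrC.
rewrite HA// HA; last by rewrite -[_ @^-1` _]setTI; exact: mR.
pose F (z : R * R) := (pdf01 z.1 * (pdf01 z.2 * \1_A z))%:E.
have mF : measurable_fun setT F.
  apply: (@measurableT_comp _ _ _ _ _ _ EFin) => //.
  apply: measurable_funM; first exact: (measurableT_comp measurable_pdf01).
  by apply: measurable_funM; [exact: (measurableT_comp measurable_pdf01)|].
have F0 z : (0 <= F z)%E.
  by rewrite /F lee_fin (mulr_ge0 (pdf01_ge0 _))// (mulr_ge0 (pdf01_ge0 _)).
transitivity (leb2 (F \o rot c s)); first by apply/esym/leb2_rot.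
apply: eq_integral => x _; apply: eq_integral => y _ /=; congr EFin.
rewrite [in RHS](_ : \1_(rot c s @^-1` A) (x, y) = \1_A (rot c s (x, y)))//.
by move: (\1_A _) => i; rewrite mulrA [X in X * i](pdf01_rot _ _ cs) -mulrA.
Qed.

Lemma expR_ge_pow (u : R) j : 0 <= u -> u ^+ j <= j%:R ^+ j * expR u.
Proof.
move=> u0; have [->|j0] := eqVneq j 0%N.
  by rewrite !expr0 mul1r -expR0 ler_expR.
have jp : 0 < j%:R :> R by rewrite ltr0n lt0n.
have -> : u = j%:R * (u / j%:R) by rewrite mulrC divfK// gt_eqF.
have v0 : 0 <= u / j%:R by rewrite divr_ge0// ltW.
rewrite exprMn ler_wpM2l ?exprn_ge0// ?(ltW jp)// expRM_natl lerXn2r ?nnegrE ?expR_ge0//.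
by rewrite (le_trans _ (expR_ge1Dx _))// lerDr.
Qed.

Lemma gauss01_moments : all_moments gauss01 id.
Proof.
split => // k.
have mk j : measurable_fun setT (fun x : R => `|x| ^+ j).
  by apply: measurable_funX; exact: normr_measurable.
have mkE j : measurable_fun setT (fun x : R => (`|x| ^+ j)%:E) by exact/measurable_EFinP.
have p1 : 0 < normal_peak 1 :> R by rewrite normal_peak_gt0// oner_eq0.
have p2 : 0 < normal_peak 2 :> R by rewrite normal_peak_gt0.
have even j : gauss01.-integrable setT (EFin \o (fun x => `|x| ^+ (2 * j))).
  apply/integrableP; split; first exact/measurable_EFinP.
  under eq_integral do rewrite gee0_abs ?lee_fin ?exprn_ge0//.
  rewrite gauss01_integral//; last 2 first.
  - exact/measurable_EFinP.
  - by move=> x; rewrite lee_fin exprn_ge0.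
  pose C : R := 4 ^+ j * j%:R ^+ j * normal_peak 1 / normal_peak 2.
  have C0 : 0 <= C by rewrite /C !mulr_ge0 ?exprn_ge0 ?invr_ge0// ltW.
  (* With [u = x ^+ 2 / 4], [pdf01] is a multiple of [exp (- 2 u)]. [expR_ge_pow] absorbs the power
     at the cost of [exp u], and what is left lies below a multiple of [exp (- u / 2)], the density
     with standard deviation 2. *)
  have E (x : R) : (`|x| ^+ (2 * j)) * pdf01 x <= C * normal_pdf 0 2 x.
    rewrite normal_pdfs// exprM real_normK ?num_real//.
    pose u := x ^+ 2 / 4; have u0 : 0 <= u by rewrite /u divr_ge0 ?sqr_ge0.
    have xu : x ^+ 2 = 4 * u by rewrite /u; field.
    rewrite /pdf01 xu exprMn {xu}; clearbody u.
    have -> : C * (normal_peak 2 * expR (- (4 * u / (2 * 2 ^+ 2)))) =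
      (4 ^+ j * normal_peak 1) * (j%:R ^+ j * expR (- (u / 2))).
      rewrite /C; have -> : 4 * u / (2 * 2 ^+ 2) = u / 2 by field.
      by field; rewrite gt_eqF.
    have -> : 4 ^+ j * u ^+ j * (normal_peak 1 * expR (- (4 * u / 2))) =
      (4 ^+ j * normal_peak 1) * (u ^+ j * expR (- (4 * u / 2))) by ring.
    rewrite ler_wpM2l ?mulr_ge0 ?exprn_ge0 ?(ltW p1)//.
    apply: (@le_trans _ _ (j%:R ^+ j * expR u * expR (- (4 * u / 2)))).
      by rewrite ler_wpM2r ?expR_ge0 ?expR_ge_pow.
    rewrite -mulrA -expRD ler_wpM2l ?exprn_ge0// ler_expR; lra.
  apply: (@le_lt_trans _ _ (\int[leb]_x (C%:E * (normal_pdf 0 2 x)%:E))%E).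
    apply: ge0_le_integral => //.
    - by move=> x _; rewrite -EFinM lee_fin mulr_ge0 ?exprn_ge0 ?pdf01_ge0.
    - by apply: emeasurable_funM; [exact: mkE|exact: measurable_EFin_pdf01].
    - by apply: emeasurable_funM => //; apply/measurable_EFinP; exact: measurable_normal_pdf.
    - by move=> x _; rewrite -!EFinM lee_fin.
  rewrite ge0_integralZl//.
  - by rewrite integral_normal_pdf mule1 ltry.
  - by apply/measurable_EFinP; exact: measurable_normal_pdf.
  - by move=> x _; rewrite lee_fin normal_pdf_ge0.
apply: (@dominated_integrable _ _ _ gauss01 _ (fun x => 1 + `|x| ^+ (2 * k))) => //.
  move=> x; rewrite normrX normr_id mulnC exprM.
  set a := _ ^+ k; have a0 : 0 <= a by exact: exprn_ge0.
  by have := sqr_ge0 (a - 1); rewrite sqrrB1; nra.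
have := integrableD measurableT (finite_measure_integrable_cst gauss01 1 measurableT) (even k).
by apply: eq_integrable => // x _; rewrite /= EFinD.
Qed.

Lemma gauss01_pow k : all_moments gauss01 (fun x => x ^+ k).
Proof. exact: all_momentsX gauss01_moments. Qed.

(** First coordinate of the rotated pair in [gauss2_rot]. The fourth moment and the semigroup law
    [heatS] rest on it. *)
Lemma gauss01_stable (c s : R) (A : set R) : c ^+ 2 + s ^+ 2 = 1 -> measurable A ->
  gauss01 A = (gauss01 \x gauss01)%E ((fun z => c * z.1 - s * z.2) @^-1` A).
Proof.
move=> cs mA.
have -> : (fun z : R * R => c * z.1 - s * z.2) @^-1` A = rot c s @^-1` (A `*` setT).
  by apply/seteqP; split => z //= [].
have mA1 : measurable (A `*` [set: R]) by exact: measurableX.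
apply: etrans (gauss2_rot cs mA1).
have E : (gauss01 \x gauss01)%E (A `*` setT) = (gauss01 A * gauss01 setT)%E :=
  product_measure1E gauss01 gauss01 mA measurableT.
by apply/esym/(etrans E); rewrite probability_setT mule1.
Qed.

Lemma gauss01_opp (A : set R) : measurable A -> gauss01 A = gauss01 (-%R @^-1` A).
Proof.
move=> mA; have mAN : measurable (-%R @^-1` A).
  by rewrite -[_ @^-1` _]setTI; exact: oppr_measurable.
rewrite (@gauss01_stable (-1) 0) ?expr0n ?sqrrN ?expr1n ?addr0//.
have -> : (fun z : R * R => -1 * z.1 - 0 * z.2) @^-1` A = (-%R @^-1` A) `*` setT.
  apply/seteqP; split => z; rewrite /= mulN1r mul0r subr0 //.
  by case.
have E : (gauss01 \x gauss01)%E ((-%R @^-1` A) `*` setT) = (gauss01 (-%R @^-1` A) * gauss01 setT)%E :=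
  product_measure1E gauss01 gauss01 mAN measurableT.
by apply/(etrans E); rewrite probability_setT mule1.
Qed.

Lemma gauss01_odd k : odd k -> Ex gauss01 (fun x => x ^+ k) = 0.
Proof.
move=> ok.
have H : Ex gauss01 (fun x => x ^+ k) = Ex gauss01 ((fun x => x ^+ k) \o -%R).
  apply: (transfer_Ex (P := gauss01) (phi := -%R)).
  - exact: oppr_measurable.
  - by move=> A mA; exact: gauss01_opp.
  - exact: measurable_funX.
  - apply: all_momentsX; exact: all_momentsN gauss01_moments.
move: H; rewrite (_ : _ \o _ = fun x => -1 * x ^+ k); last first.
  by apply/funext => x /=; rewrite exprNn -signr_odd ok expr1.
rewrite ExZ ?mulN1r; last exact: gauss01_pow.
lra.
Qed.

Lemma normal_peakE (w : R) : 0 < w -> normal_peak 1 = w^-1 * normal_peak w^-1.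
Proof.
move=> w0; rewrite /normal_peak expr1n mul1r exprVn -mulrnAr sqrtrM ?invr_ge0 ?sqr_ge0//.
rewrite sqrtrV ?sqr_ge0// sqrtr_sqr gtr0_norm// invfM invrK mulrA mulVf ?mul1r// gt_eqF//.
Qed.

(** The integrand times [pdf01] is [w^-1] times the normal density with standard deviation
    [w^-1]. *)
Lemma gauss01_mgf_sq (w : R) : 0 < w ->
  (\int[gauss01]_x (expR (- (w ^+ 2 - 1) * x ^+ 2 / 2))%:E = (w^-1)%:E)%E.
Proof.
move=> w0; rewrite gauss01_integral; last 2 first.
- apply/measurable_EFinP; apply: measurableT_comp => //.
  apply: measurable_funM => //; apply: measurable_funM => //; exact: measurable_funX.
- by move=> x; rewrite lee_fin expR_ge0.
have wV : 0 < w^-1 by rewrite invr_gt0.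
transitivity (\int[leb]_x ((w^-1)%:E * (normal_pdf 0 w^-1 x)%:E))%E.
  apply: eq_integral => x _; rewrite -!EFinM /pdf01 normal_pdfs// (normal_peakE w0).
  congr EFin.
  have -> : - (x ^+ 2 / (2 * w^-1 ^+ 2)) = - (w ^+ 2 - 1) * x ^+ 2 / 2 + - (x ^+ 2 / 2).
    by field; rewrite gt_eqF.
  by rewrite expRD; ring.
rewrite ge0_integralZl//.
- by rewrite integral_normal_pdf mule1.
- by apply/measurable_EFinP; exact: measurable_normal_pdf.
- by move=> x _; rewrite lee_fin normal_pdf_ge0.
- by rewrite lee_fin ltW.
Qed.

(* E e^(-tZ^2/2) = (1 + t)^(-1/2) dominates 1 - t E Z^2 / 2, with equality at
   t = 0, so the derivatives at 0 agree. *)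
Lemma gauss01_m2 : Ex gauss01 (fun x => x ^+ 2) = 1.
Proof.
set m := Ex _ _.
have key (w : R) : 0 < w -> 1 - (w ^+ 2 - 1) * m / 2 <= w^-1.
  move=> w0.
  have I2 : all_moments gauss01 (fun x => - (w ^+ 2 - 1) / 2 * x ^+ 2).
    by apply: all_momentsZ; exact: gauss01_pow.
  have I3 : all_moments gauss01 (fun x => 1 + - (w ^+ 2 - 1) / 2 * x ^+ 2).
    by apply: all_momentsD => //; exact: all_moments_cst.
  rewrite -lee_fin -gauss01_mgf_sq//.
  have -> : (1 - (w ^+ 2 - 1) * m / 2)%:E =
      (\int[gauss01]_x (1 + - (w ^+ 2 - 1) / 2 * x ^+ 2)%:E)%E.
    rewrite (ExE I3) ExD//; last exact: all_moments_cst.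
    rewrite Ex_cst ExZ -/m; last exact: gauss01_pow.
    by congr EFin; lra.
  apply: le_integral => //; first exact: all_moments_int.
    apply/integrableP; split.
      apply/measurable_EFinP; apply: measurableT_comp => //.
      apply: measurable_funM => //; apply: measurable_funM => //; exact: measurable_funX.
    under eq_integral do rewrite gee0_abs ?lee_fin ?expR_ge0//.
    by rewrite gauss01_mgf_sq// ltry.
  move=> x _; rewrite lee_fin (le_trans _ (expR_ge1Dx _))// lerD2l.
  by rewrite mulrAC.
have m0 : 0 <= m by apply: Ex_ge0 => x; exact: sqr_ge0.
(* Multiplied by [w], the inequality factors: the second factor cannot have the sign opposite to
   [w - 1], which leaves only [m = 1] as [w] approaches 1 from both sides. Instead of a limit, an
   explicit [w] refutes each of [1 < m] and [m < 1]. *)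
have key2 (w : R) : 0 < w -> 0 <= (w - 1) * (w * (w + 1) * m - 2).
  move=> w0; have := key _ w0; rewrite -(ler_pM2r w0) mulVf ?gt_eqF//.
  by nra.
apply/eqP; rewrite eq_le; apply/andP; split; rewrite leNgt; apply/negP => mlt.
  have mp : 0 < m by rewrite (lt_trans _ mlt).
  pose d := (1 - m^-1) / 3.
  have mV : m^-1 < 1 by rewrite invf_lt1.
  have mV0 : 0 < m^-1 by rewrite invr_gt0.
  have mm : m * m^-1 = 1 by rewrite mulfV// gt_eqF.
  have d0 : 0 < d by rewrite /d; lra.
  have d1 : d < 1 by rewrite /d; lra.
  have /key2 : 0 < 1 - d by lra.
  have -> : (1 - d - 1) * ((1 - d) * (1 - d + 1) * m - 2) = d * (2 - (1 - d) * (2 - d) * m) by ring.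
  rewrite pmulr_rge0// => h.
  have : (2 - 3 * d) * m <= (1 - d) * (2 - d) * m by rewrite ler_wpM2r//; nra.
  have -> : (2 - 3 * d) * m = m + 1 by rewrite /d -{2}mm; field; rewrite gt_eqF.
  lra.
pose d := (1 - m) / 4.
have d0 : 0 < d by rewrite /d; lra.
have /key2 : 0 < 1 + d by lra.
have -> : (1 + d - 1) * ((1 + d) * (1 + d + 1) * m - 2) = d * ((1 + d) * (2 + d) * m - 2) by ring.
rewrite pmulr_rge0// => h.
have : (1 + d) * (2 + d) * m <= (2 + 4 * d) * m.
  by rewrite ler_wpM2r//; rewrite /d; nra.
have -> : (2 + 4 * d) * m = (3 - m) * m by rewrite /d; field.
nra.
Qed.

(** [Z] has the law of [(Z1 - Z2) / sqrt 2]; expanding the fourth power, with odd moments zero and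
    second moment 1, gives [m = (2 m + 6) / 4]. *)
Lemma gauss01_m4 : Ex gauss01 (fun x => x ^+ 4) = 3.
Proof.
set m := Ex _ _; pose c : R := (Num.sqrt 2)^-1.
have c2 : c ^+ 2 = 2^-1 by rewrite /c exprVn sqr_sqrtr.
have cc : c ^+ 2 + c ^+ 2 = 1 by rewrite c2; field.
pose G2 := (gauss01 \x gauss01)%E.
have m1 k : all_moments G2 (fun z => z.1 ^+ k) by exact: prod_moments_fst (gauss01_pow k).
have m2 k : all_moments G2 (fun z => z.2 ^+ k) by exact: prod_moments_snd (gauss01_pow k).
have m12 j k : all_moments G2 (fun z => z.1 ^+ j * z.2 ^+ k) by apply: all_momentsM.
have E : m = Ex G2 (fun z => (c * z.1 - c * z.2) ^+ 4).
  apply: (@transfer_Ex R _ _ _ _ G2 gauss01 (fun z => c * z.1 - c * z.2) _ _ (fun x => x ^+ 4)).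
  - by apply: measurable_funB; apply: measurable_funM.
  - by move=> A mA; exact: gauss01_stable.
  - exact: measurable_funX.
  - apply: all_momentsX; apply: all_momentsB; apply: all_momentsZ.
    + exact: (m1 1%N).
    + exact: (m2 1%N).
have : m = 4^-1 * (m + 6 + m); last by lra.
have E2 (z : R * R) : (c * z.1 - c * z.2) ^+ 4 = 4^-1 * (z.1 ^+ 4 * 1 + -4 * (z.1 ^+ 3 * z.2 ^+ 1)
    + 6 * (z.1 ^+ 2 * z.2 ^+ 2) + -4 * (z.1 ^+ 1 * z.2 ^+ 3) + 1 * z.2 ^+ 4).
  have -> : (c * z.1 - c * z.2) ^+ 4 = (c ^+ 2) ^+ 2 * (z.1 - z.2) ^+ 4 by ring.
  by rewrite c2; field.
rewrite {1}E; under eq_Rintegral do rewrite E2.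
have c1 := all_moments_cst gauss01 1.
have M40 : all_moments G2 (fun z => z.1 ^+ 4 * 1) by apply: all_momentsM => //; exact: all_moments_cst.
have M04 : all_moments G2 (fun z => 1 * z.2 ^+ 4) by apply: all_momentsM => //; exact: all_moments_cst.
have Z k j a : all_moments G2 (fun z => a * (z.1 ^+ j * z.2 ^+ k)) by exact: all_momentsZ.
rewrite ExZ; last by do !apply: all_momentsD.
do 4 (rewrite ExD; [|by do ?apply: all_momentsD|by []]).
rewrite (ExZ (-4) (m12 3%N 1%N)) (ExZ 6 (m12 2%N 2%N)) (ExZ (-4) (m12 1%N 3%N)).
have P12 j k : Ex G2 (fun z => z.1 ^+ j * z.2 ^+ k) = Ex gauss01 (fun x => x ^+ j) * Ex gauss01 (fun x => x ^+ k).
  by apply: prod_Ex; exact: gauss01_pow.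
have -> : Ex G2 (fun z => z.1 ^+ 4 * 1) = m.
  by rewrite (prod_Ex (gauss01_pow 4) c1) Ex_cst mulr1.
have -> : Ex G2 (fun z => 1 * z.2 ^+ 4) = m.
  by rewrite (prod_Ex c1 (gauss01_pow 4)) Ex_cst mul1r.
rewrite !P12 gauss01_m2 !gauss01_odd//.
congr (_ * _); ring.
Qed.

End standard_normal.

(** * Gaussian vectors *)

Section gaussian_invariance.
Context {R : realType}.
Local Notation G := (@std_gaussian R).

Lemma measurable_mulmx p d (U : 'M[R]_(p, d)) :
  measurable_fun [set: 'cV[R]_d] (fun z : 'cV[R]_d => U *m z).
Proof.
apply: measurable_fun_mx => i j; under eq_fun do rewrite mxE.
apply: measurable_sum => k; apply: measurable_funM => //.
exact: measurable_entry.
Qed.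

Lemma prod_invariant d1 d2 (T1 : measurableType d1) (T2 : measurableType d2)
    (P : probability T1 R) (Q : probability T2 R) (phi : T1 -> T1) (psi : T2 -> T2) :
  measurable_fun setT phi -> measurable_fun setT psi ->
  (forall A, measurable A -> P A = P (phi @^-1` A)) ->
  (forall A, measurable A -> Q A = Q (psi @^-1` A)) ->
  forall B, measurable B ->
    (P \x Q)%E B = (P \x Q)%E ((fun z => (phi z.1, psi z.2)) @^-1` B).
Proof.
move=> mphi mpsi HP HQ B mB.
have mF : measurable_fun setT (fun z : T1 * T2 => (phi z.1, psi z.2)).
  by apply: measurable_fun_pair; exact: measurableT_comp.
pose F : {mfun (T1 * T2)%type >-> (T1 * T2)%type} := HB.pack (fun z : T1 * T2 => (phi z.1, psi z.2))
  (isMeasurableFun.Build _ _ _ _ _ mF).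
apply: (@product_measure_unique _ _ _ _ _ P Q (distribution (P \x Q)%E F)) => // A C mA mC.
rewrite /distribution /pushforward.
apply: (@etrans _ _ ((P \x Q)%E ((phi @^-1` A) `*` (psi @^-1` C)))) => //.
apply: etrans (product_measure1E P Q _ _) _.
- by rewrite -[_ @^-1` _]setTI; exact: mphi.
- by rewrite -[_ @^-1` _]setTI; exact: mpsi.
- by apply: congr2; apply/esym; [exact: HP|exact: HQ].
Qed.

Lemma std_gaussianS d (B : set 'cV[R]_d.+1) :
  G d.+1 B = (gauss01 \x G d)%E (@cons_cV R d @^-1` B).
Proof. by []. Qed.

Lemma measurable_preimage d1 d2 (T1 : measurableType d1) (T2 : measurableType d2)
    (f : T1 -> T2) (A : set T2) : measurable_fun setT f -> measurable A -> measurable (f @^-1` A).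
Proof. by move=> mf mA; rewrite -[_ @^-1` _]setTI; exact: mf. Qed.

Lemma std_gaussian_block d (V : 'M[R]_d) (B : set 'cV[R]_(1 + d)) :
  (forall A : set 'cV[R]_d, measurable A -> G d A = G d ((fun z => V *m z) @^-1` A)) ->
  measurable B ->
  G (1 + d) B = G (1 + d) ((fun z => block_mx 1%:M 0 0 V *m z) @^-1` B).
Proof.
move=> HV mB; rewrite !std_gaussianS.
have mC := measurable_preimage (@measurable_cons_cV R d) mB.
apply: etrans (prod_invariant (phi := id) (psi := fun z => V *m z) _ _ _ HV mC) _ => //.
  exact: measurable_mulmx.
congr ((_ \x _)%E _); apply/seteqP; split => -[x w] /=;
  by rewrite /cons_cV/= mul_block_col !mul0mx mul1mx addr0 add0r.
Qed.

(** Singles out the plane of the first two coordinates, where [rot_mx] acts; unrelated to the metric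
    of the theorem. *)
Let rho d (z : (R * R) * 'cV[R]_d) : 'cV[R]_d.+2 := cons_cV (z.1.1, cons_cV (z.1.2, z.2)).

Let measurable_rho d : measurable_fun setT (@rho d).
Proof.
apply: measurableT_comp; first exact: measurable_cons_cV.
apply: measurable_fun_pair; first exact: measurableT_comp.
apply: measurableT_comp; first exact: measurable_cons_cV.
by apply: measurable_fun_pair => //; exact: measurableT_comp.
Qed.

Let std_gaussianSS d (B : set 'cV[R]_d.+2) : measurable B ->
  G d.+2 B = (\int[gauss01 \x gauss01]_z (G d (xsection (@rho d @^-1` B) z)))%E.
Proof.
move=> mB; have mE := measurable_preimage (@measurable_rho d) mB.
pose f z := G d (xsection (@rho d @^-1` B) z).
have mf : measurable_fun setT f by exact: measurable_fun_xsection.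
apply: etrans (esym (@fubini_tonelli1 _ _ _ _ _ gauss01 gauss01 f mf (fun z => measure_ge0 _ _))).
apply: eq_integral => x _; apply: eq_integral => y _; congr (G d _).
by apply/seteqP; split => w; rewrite /xsection/= !inE/= !inE.
Qed.

Let rot_mx_cons d (c s : R) z (w : 'cV[R]_d) :
  rot_mx d c s *m rho (z, w) = rho (rot c s z, w).
Proof.
rewrite /rot_mx /rho /cons_cV /=.
rewrite mul_block_col mul_row_col mul_col_mx mul_block_col !mul0mx addr0 mul1mx add0r addr0.
by rewrite -!scalar_mxM add_col_mx add0r mulNr -!raddfD/=.
Qed.

(** The measure of a set is a Gaussian integral over the plane of the measures of its slices; a
    rotation only moves the slices around, and [gauss2_rot] applies to the plane integral. *)
Lemma std_gaussian_rot d (c s : R) (B : set 'cV[R]_(1 + (1 + d))) :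
  c ^+ 2 + s ^+ 2 = 1 -> measurable B ->
  G (1 + (1 + d)) B = G (1 + (1 + d)) ((fun z => rot_mx d c s *m z) @^-1` B).
Proof.
move=> cs mB.
have mB' : measurable ((fun z => rot_mx d c s *m z) @^-1` B).
  by apply: measurable_preimage => //; exact: measurable_mulmx.
have mE := measurable_preimage (@measurable_rho d) mB.
apply: etrans (std_gaussianSS mB) (etrans _ (esym (std_gaussianSS mB'))).
rewrite (transfer_ge0 (measurable_rot c s) (fun A mA => gauss2_rot cs mA)).
- apply: eq_integral => z _; congr (G d _); apply/seteqP; split => w; rewrite /xsection/= !inE/=.
    by rewrite rot_mx_cons.
  by rewrite rot_mx_cons.
- exact: measurable_fun_xsection.
- by [].
Qed.

(** In dimension 1 the matrix is a sign; from dimension 2 on, [orth_decomp] leaves a plane rotation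
    between two matrices that act in one dimension less. *)
Lemma std_gaussian_orth d (U : 'M[R]_d) (B : set 'cV[R]_d) :
  U^T *m U = 1%:M -> measurable B ->
  G d B = G d ((fun z => U *m z) @^-1` B).
Proof.
elim: d => [|[|d] IH] in U B *.
- move=> _ _; congr (G 0 _); apply/seteqP; split => z /=;
  by rewrite (_ : U *m z = z)//; apply/matrixP => -[].
- move=> Uo mB; set u := U 0 0.
  have UE : U = u%:M by exact: mx11_scalar.
  have : u ^+ 2 = 1.
    by move: Uo; rewrite UE tr_scalar_mx -scalar_mxM => /matrixP/(_ 0 0); rewrite !mxE -expr2.
  move=> /eqP; rewrite sqrf_eq1 => /orP[]/eqP u1; rewrite UE u1.
    by congr (G 1 _); apply/seteqP; split => z /=; rewrite mul1mx.
  rewrite !std_gaussianS.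
  have mC := measurable_preimage (@measurable_cons_cV R 0) mB.
  have H := @prod_invariant _ _ R 'cV[R]_0 gauss01 (G 0) -%R id
    (@oppr_measurable R setT) (@measurable_id _ _ setT) (@gauss01_opp R) (fun A _ => erefl) _ mC.
  apply: etrans H _.
  congr ((_ \x _)%E _); apply/seteqP; split => -[x w] /=;
  rewrite /cons_cV/= mul_scalar_mx (@scale_col_mx _ 1 0 1) scaleN1r -raddfN/=;
  by rewrite (_ : -1 *: w = w)//; apply/matrixP => -[].
- move=> /orth_decomp[V1 [V2 [c [s [V1o V2o cs ->]]]]] mB.
  pose m1 := (fun z : 'cV[R]_(1 + (1 + d)) => block_mx 1%:M 0 0 V1 *m z) @^-1` B.
  have mm1 : measurable m1 by apply: measurable_preimage => //; exact: measurable_mulmx.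
  pose m2 := (fun z : 'cV[R]_(1 + (1 + d)) => rot_mx d c s *m z) @^-1` m1.
  have mm2 : measurable m2 by apply: measurable_preimage => //; exact: measurable_mulmx.
  apply: etrans (std_gaussian_block (fun A mA => IH V1 A V1o mA) mB) _.
  apply: etrans (std_gaussian_rot cs mm1) _.
  apply: etrans (std_gaussian_block (fun A mA => IH V2 A V2o mA) mm2) _.
  by congr (G _ _); apply/seteqP; split => z; rewrite /m2 /m1/= !mulmxA.
Qed.

(** By [gram_eq_orth], [A] is [B] times an orthogonal matrix, which the standard law absorbs. This
    frees Gaussian laws from the particular root in their definition. *)
Lemma std_gaussian_gram p d (A B : 'M[R]_(p, d)) (E : set 'cV[R]_p) :
  A *m A^T = B *m B^T -> measurable E ->
  G d ((fun z => A *m z) @^-1` E) = G d ((fun z => B *m z) @^-1` E).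
Proof.
move=> /gram_eq_orth[W [Wo ->]] mE.
have mB : measurable ((fun z => B *m z) @^-1` E).
  by apply: measurable_preimage => //; exact: measurable_mulmx.
rewrite [RHS](std_gaussian_orth Wo mB); congr (G d _).
by apply/seteqP; split => z /=; rewrite mulmxA.
Qed.

End gaussian_invariance.

Section gaussian_moments.
Context {R : realType}.
Local Notation G := (@std_gaussian R).

Lemma cons_cV0 d (x : R) (w : 'cV[R]_d) : cons_cV (x, w) ord0 0 = x.
Proof.
rewrite /cons_cV/= (_ : ord0 = lshift d (0 : 'I_1)); last exact: val_inj.
by rewrite (@col_mxEu _ 1 d 1) mxE.
Qed.

Lemma cons_cVS d (x : R) (w : 'cV[R]_d) k : cons_cV (x, w) (lift ord0 k) 0 = w k 0.
Proof.
rewrite /cons_cV/= (_ : lift ord0 k = rshift 1 k); last exact: val_inj.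
by rewrite (@col_mxEd _ 1 d 1).
Qed.

Lemma std_gaussian_coord d (i : 'I_d) : all_moments (G d) (fun z : 'cV[R]_d => z i 0).
Proof.
elim: d => [|d IH] in i *; first by case: i.
apply/(transfer_moments (P := (gauss01 \x G d)%E) (@measurable_cons_cV R d)) => //.
  exact: measurable_entry.
case: (unliftP ord0 i) => [k ->|->].
  rewrite (_ : _ \o _ = fun z : R * 'cV[R]_d => z.2 k 0); first exact: prod_moments_snd (IH k).
  by apply/funext => -[x w]/=; rewrite cons_cVS.
rewrite (_ : _ \o _ = fun z : R * 'cV[R]_d => z.1); first exact: prod_moments_fst gauss01_moments.
by apply/funext => -[x w]/=; rewrite cons_cV0.
Qed.

(** The shape of a quadratic function of a Gaussian vector once its quadratic part is diagonal;
    subtracting 1 centers the squares. *)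
Definition diag_quad d (b c : 'I_d -> R) (z : 'cV[R]_d) : R :=
  \sum_i (b i * z i 0 + c i * (z i 0 ^+ 2 - 1)).

Lemma diag_quad_moments d (b c : 'I_d -> R) : all_moments (G d) (diag_quad b c).
Proof.
apply: all_moments_sum => i _; apply: all_momentsD; apply: all_momentsZ.
  exact: std_gaussian_coord.
apply: all_momentsB; last exact: all_moments_cst.
by apply: all_momentsX; exact: std_gaussian_coord.
Qed.

(** Induction on the dimension: the new coordinate is independent of the others and both parts are
    centered, so no cross term survives. The factor 2 is the variance [3 - 1] of a squared standard
    normal variable. *)
Lemma diag_quad_Ex d (b c : 'I_d -> R) : Ex (G d) (diag_quad b c) = 0 /\
  Ex (G d) (fun z => diag_quad b c z ^+ 2) = \sum_i (b i ^+ 2 + 2 * c i ^+ 2).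
Proof.
elim: d => [|d IH] in b c *.
  have -> : diag_quad b c = fun=> 0 by apply/funext => z; rewrite /diag_quad big_ord0.
  by rewrite expr0n/= !Ex_cst big_ord0.
pose b' k := b (lift ord0 k); pose c' k := c (lift ord0 k).
have [IH1 IH2] := IH b' c'.
pose f (x : R) := b ord0 * x + c ord0 * (x ^+ 2 - 1).
have E x w : diag_quad b c (cons_cV (x, w)) = f x + diag_quad b' c' w.
  rewrite /diag_quad big_ord_recl cons_cV0; congr (_ + _).
  by apply: eq_bigr => k _; rewrite cons_cVS.
have g1 : all_moments (@gauss01 R) (fun x => x) by exact: gauss01_moments.
have m1 := all_moments_cst (@gauss01 R) 1.
have g2 := @gauss01_pow R.
have fm : all_moments gauss01 f.
  apply: all_momentsD; apply: all_momentsZ => //.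
  by apply: all_momentsB => //; exact: g2.
have f1 : Ex gauss01 f = 0.
  rewrite ExD ?ExZ ?ExB//; do ?[apply: all_momentsZ|apply: all_momentsB|exact: g2] => //.
  have e1 : Ex gauss01 (fun x : R => x) = 0 := @gauss01_odd R 1 isT.
  by rewrite Ex_cst gauss01_m2 e1 subrr !mulr0 addr0.
have f2 : Ex gauss01 (fun x => f x ^+ 2) = b ord0 ^+ 2 + 2 * c ord0 ^+ 2.
  have F x : f x ^+ 2 = c ord0 ^+ 2 * x ^+ 4 + 2 * b ord0 * c ord0 * x ^+ 3 +
      (b ord0 ^+ 2 - 2 * c ord0 ^+ 2) * x ^+ 2 - 2 * b ord0 * c ord0 * x ^+ 1 + c ord0 ^+ 2 * 1.
    by rewrite /f; ring.
  have Z a k : all_moments (@gauss01 R) (fun x => a * x ^+ k) by exact: all_momentsZ.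
  have Z1 a : all_moments (@gauss01 R) (fun=> a * 1) by exact: all_moments_cst.
  under eq_Rintegral do rewrite F.
  rewrite ExD//; last by do ?[apply: all_momentsB|apply: all_momentsD].
  rewrite ExB//; last by do ?[apply: all_momentsB|apply: all_momentsD].
  rewrite !ExD//; last by do ?[apply: all_momentsB|apply: all_momentsD].
  rewrite !ExZ// gauss01_m4 gauss01_m2 !gauss01_odd// !Ex_cst; ring.
have fP := prod_moments_fst (G d) fm.
have qm := diag_quad_moments b' c'.
have qP := prod_moments_snd gauss01 qm.
have mq : measurable_fun setT (diag_quad b c) by have [] := diag_quad_moments b c.
split.
  rewrite (transfer_Rintegral (P := (gauss01 \x G d)%E) (@measurable_cons_cV R d))//; last first.
    apply: all_moments_int.
    rewrite (_ : _ \o _ = fun z => f z.1 + diag_quad b' c' z.2); first exact: all_momentsD.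
    by apply/funext => -[x w] /=; exact: E.
  rewrite (_ : _ \o _ = fun z => f z.1 + diag_quad b' c' z.2); last first.
    by apply/funext => -[x w] /=; exact: E.
  rewrite ExD//.
  have c1 := all_moments_cst (G d) 1.
  have -> : Ex (gauss01 \x G d)%E (fun z => f z.1) = 0.
    under eq_Rintegral do rewrite -[f _]mulr1.
    by rewrite (prod_Ex fm c1) f1 mul0r.
  have -> : Ex (gauss01 \x G d)%E (fun z => diag_quad b' c' z.2) = 0.
    under eq_Rintegral do rewrite -[diag_quad _ _ _]mul1r.
    by rewrite (prod_Ex m1 qm) IH1 mulr0.
  by rewrite addr0.
have E2 : (fun z => diag_quad b c z ^+ 2) \o @cons_cV R d =
    fun z => f z.1 ^+ 2 * 1 + 2 * (f z.1 * diag_quad b' c' z.2) + 1 * diag_quad b' c' z.2 ^+ 2.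
  by apply/funext => -[x w]; rewrite /= E; ring.
have c1 := all_moments_cst (G d) 1.
have M1 : all_moments (gauss01 \x G d)%E (fun z => f z.1 ^+ 2 * 1).
  by apply: all_momentsM; [exact: all_momentsX|exact: all_moments_cst].
have M2 : all_moments (gauss01 \x G d)%E (fun z => f z.1 * diag_quad b' c' z.2).
  exact: all_momentsM.
have M3 : all_moments (gauss01 \x G d)%E (fun z => 1 * diag_quad b' c' z.2 ^+ 2).
  by apply: all_momentsM; [exact: all_moments_cst|exact: all_momentsX].
have M2' := all_momentsZ 2 M2.
rewrite (transfer_Rintegral (P := (gauss01 \x G d)%E) (@measurable_cons_cV R d))//; last 2 first.
- exact: measurable_funX.
- by rewrite E2; apply: all_moments_int; do !apply: all_momentsD.
rewrite E2 ExD ?ExD//; last by apply: all_momentsD.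
rewrite (ExZ 2 M2) (prod_Ex fm qm) f1 mul0r mulr0 addr0.
rewrite (prod_Ex (all_momentsX 2 fm) c1) (prod_Ex m1 (all_momentsX 2 qm)) !Ex_cst mulr1 mul1r.
by rewrite f2 IH2 big_ord_recl.
Qed.

(** Polarization of the second moments of linear forms, the case [c = 0] of [diag_quad_Ex]. *)
Lemma std_gaussian_cross d (i j : 'I_d) :
  Ex (G d) (fun z => z i 0 * z j 0) = (i == j)%:R.
Proof.
have lin (b : 'I_d -> R) : Ex (G d) (fun z => (\sum_i b i * z i 0) ^+ 2) = \sum_i b i ^+ 2.
  have [_] := diag_quad_Ex b (fun=> 0).
  under [X in _ = X]eq_bigr do rewrite expr0n mulr0 addr0.
  move=> <-; apply: eq_Rintegral => z _; congr (_ ^+ 2).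
  by apply: eq_bigr => k _; rewrite mul0r addr0.
have d1 (k : 'I_d) (z : 'cV[R]_d) : z k 0 = \sum_i (i == k)%:R * z i 0.
  by rewrite (bigD1 k)//= eqxx mul1r big1 ?addr0// => l /negbTE ->; rewrite mul0r.
have sq k : Ex (G d) (fun z => z k 0 ^+ 2) = 1.
  under eq_Rintegral do rewrite (d1 k).
  rewrite lin (bigD1 k)//= eqxx expr1n big1 ?addr0// => l /negbTE ->.
  by rewrite expr0n.
have [->|ij] := eqVneq i j; first by under eq_Rintegral do rewrite -expr2; exact: sq.
have zi := std_gaussian_coord i; have zj := std_gaussian_coord j.
have zij := all_momentsM zi zj.
have H : Ex (G d) (fun z => (z i 0 + z j 0) ^+ 2) = 2.
  rewrite (_ : (fun z : 'cV[R]_d => (z i 0 + z j 0) ^+ 2) = fun z => (\sum_k ((k == i)%:R + (k == j)%:R) * z k 0) ^+ 2).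
    rewrite lin (bigD1 i)//= (bigD1 j)//= ?(eq_sym j) ?ij//.
    rewrite !eqxx (negbTE ij) big1 => [|k /andP[/negbTE -> /negbTE ->]].
      by rewrite addr0 add0r addr0 expr1n; ring.
    by rewrite addr0 expr0n.
  apply/funext => z; congr (_ ^+ 2); rewrite (d1 i) (d1 j) -big_split/=.
  by apply: eq_bigr => k _; rewrite mulrDl.
move: H; under eq_Rintegral do rewrite sqrrD -mulr_natl.
rewrite ExD ?ExD//; do ?[apply: all_momentsD|apply: all_momentsX|apply: all_momentsZ] => //.
rewrite ExZ// !sq => h; change (Ex (G d) (fun z => z i 0 * z j 0) = 0); lra.
Qed.

Section general.
Context (d : nat) (m : 'cV[R]_d) (S : 'M[R]_d).
Hypothesis Sc : covariance_matrix S.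
Let B := sqrtmx S.
Let BT : B^T = B. Proof. by have [[]] := sqrtmx_spec Sc. Qed.
Let BB : B *m B = S. Proof. by have [] := sqrtmx_spec Sc. Qed.
Let P := gaussian m S.

Let aff_meas := measurable_affine_cV m B.

Let affE (z : 'cV[R]_d) i : affine_cV m B z i 0 = m i 0 + \sum_k B i k * z k 0.
Proof. by rewrite /affine_cV !mxE. Qed.

Lemma gaussian_coord i : all_moments P (fun x : 'cV[R]_d => x i 0).
Proof.
apply/(transfer_moments (P := G d) aff_meas) => //; first exact: measurable_entry.
rewrite (_ : _ \o _ = fun z : 'cV[R]_d => m i 0 + \sum_k B i k * z k 0); last first.
  by apply/funext => z; exact: affE.
apply: all_momentsD; first exact: all_moments_cst.
by apply: all_moments_sum => k _; apply: all_momentsZ; exact: std_gaussian_coord.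
Qed.

Lemma gaussian_mean i : Ex P (fun x : 'cV[R]_d => x i 0) = m i 0.
Proof.
have zm (k : 'I_d) : Ex (G d) (fun z => z k 0) = 0.
  have [+ _] := diag_quad_Ex (fun i => (i == k)%:R) (fun=> 0).
  move=> <-; apply: eq_Rintegral => z _; rewrite /diag_quad (bigD1 k)//= eqxx mul1r mul0r addr0.
  by rewrite big1 ?addr0// => l /negbTE ->; rewrite !mul0r addr0.
have mm : all_moments (G d) (fun z => \sum_k B i k * z k 0).
  by apply: all_moments_sum => k _; apply: all_momentsZ; exact: std_gaussian_coord.
have E : (fun x : 'cV[R]_d => x i 0) \o affine_cV m B = fun z => m i 0 + \sum_k B i k * z k 0.
  by apply/funext => z; exact: affE.
rewrite (transfer_Ex (P := G d) aff_meas)//; last 2 first.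
- exact: measurable_entry.
- by rewrite E; apply: all_momentsD => //; exact: all_moments_cst.
rewrite E ExD//; last exact: all_moments_cst.
rewrite Ex_cst Ex_sum ?big1 ?addr0// => k _; last by apply: all_momentsZ; exact: std_gaussian_coord.
by rewrite ExZ ?zm ?mulr0//; exact: std_gaussian_coord.
Qed.

Lemma gaussian_cov i j :
  Ex P (fun x : 'cV[R]_d => (x i 0 - m i 0) * (x j 0 - m j 0)) = S i j.
Proof.
have E : (fun x : 'cV[R]_d => (x i 0 - m i 0) * (x j 0 - m j 0)) \o affine_cV m B =
    fun z => \sum_k \sum_l (B i k * B j l) * (z k 0 * z l 0).
  apply/funext => z /=; rewrite !affE !(addrC (m _ _)) !addrK mulr_suml.
  apply: eq_bigr => k _; rewrite mulr_sumr; apply: eq_bigr => l _; ring.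
have zz k l : all_moments (G d) (fun z => (B i k * B j l) * (z k 0 * z l 0)).
  by apply: all_momentsZ; apply: all_momentsM; exact: std_gaussian_coord.
rewrite (transfer_Ex (P := G d) aff_meas)//; last 2 first.
- by apply: measurable_funM; apply: measurable_funB => //; exact: measurable_entry.
- by rewrite E; do 2 (apply: all_moments_sum => ? _).
rewrite E Ex_sum; last by move=> k _; apply: all_moments_sum.
rewrite -BB mxE; apply: eq_bigr => k _; rewrite Ex_sum//.
rewrite (bigD1 k)//= ExZ; last by apply: all_momentsM; exact: std_gaussian_coord.
rewrite std_gaussian_cross eqxx mulr1 big1 ?addr0 => [|l lk].
  by have /matrixP/(_ j k) := BT; rewrite mxE => ->.
rewrite ExZ ?std_gaussian_cross; last by apply: all_momentsM; exact: std_gaussian_coord.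
by rewrite eq_sym (negbTE lk) mulr0.
Qed.

(** The subtracted trace is the mean of the quadratic term under [gaussian m S]. *)
Definition quad_fun (b : 'cV[R]_d) (A : 'M[R]_d) (x : 'cV[R]_d) : R :=
  (b^T *m (x - m)) 0 0 + ((x - m)^T *m A *m (x - m)) 0 0 - \tr (A *m S).

Lemma quad_form_sum (A : 'M[R]_d) (x : 'cV[R]_d) :
  (x^T *m A *m x) 0 0 = \sum_i \sum_j A i j * (x i 0 * x j 0).
Proof.
rewrite mxE exchange_big/=; apply: eq_bigr => j _; rewrite mxE mulr_suml.
by apply: eq_bigr => i _; rewrite mxE; ring.
Qed.

Lemma quad_fun_moments b A : all_moments P (quad_fun b A).
Proof.
have E : quad_fun b A = fun x => \sum_i b i 0 * (x i 0 - m i 0) +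
    \sum_i \sum_j A i j * ((x i 0 - m i 0) * (x j 0 - m j 0)) - \tr (A *m S).
  apply/funext => x; rewrite /quad_fun quad_form_sum mxE; congr (_ + _ - _).
    by apply: eq_bigr => i _; rewrite !mxE.
  by apply: eq_bigr => i _; apply: eq_bigr => j _; rewrite !mxE.
have c i : all_moments P (fun x => x i 0 - m i 0).
  by apply: all_momentsB; [exact: gaussian_coord|exact: all_moments_cst].
rewrite E; apply: all_momentsB; last exact: all_moments_cst.
apply: all_momentsD; apply: all_moments_sum => i _; first exact: all_momentsZ.
by apply: all_moments_sum => j _; apply: all_momentsZ; exact: all_momentsM.
Qed.

(* Rotating the standard Gaussian vector diagonalises the quadratic form, so
   that its value is a sum of independent centered terms. *)
Lemma quad_fun_Ex b A : A^T = A -> Ex P (quad_fun b A) = 0 /\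
  Ex P (fun x => quad_fun b A x ^+ 2) = (b^T *m S *m b) 0 0 + 2 * \tr (A *m S *m (A *m S)).
Proof.
move=> AT; have CT : (B *m A *m B)^T = B *m A *m B by rewrite !trmx_mul AT BT mulmxA.
have [U [c [Uo CE]]] := sym_spectral CT.
pose b' := U^T *m (B *m b).
pose psi (z : 'cV[R]_d) := affine_cV m B (U *m z).
have mpsi : measurable_fun setT psi.
  by apply: (measurableT_comp aff_meas); exact: measurable_mulmx.
have Ppsi (E : set 'cV[R]_d) : measurable E -> P E = G d (psi @^-1` E).
  move=> mE; apply: (std_gaussian_orth (B := affine_cV m B @^-1` E) Uo).
  exact: measurable_preimage.
have trC : \tr (A *m S) = \sum_i c 0 i.
  rewrite -BB mulmxA mxtrace_mulC mulmxA CE mxtrace_mulC mulmxA Uo mul1mx.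
  by apply: eq_bigr => i _; rewrite mxE eqxx.
have E : quad_fun b A \o psi = diag_quad (fun i => b' i 0) (fun i => c 0 i).
  apply/funext => z; rewrite /= /quad_fun /psi /affine_cV.
  have -> : m + B *m (U *m z) - m = B *m (U *m z) by rewrite addrC addKr.
  have -> : (B *m (U *m z))^T *m A *m (B *m (U *m z)) = (U *m z)^T *m (B *m A *m B) *m (U *m z).
    by rewrite trmx_mul BT !mulmxA.
  rewrite CE mulmx_diag_quad (mulmxA U^T U z) Uo mul1mx trC /diag_quad.
  have -> : b^T *m (B *m (U *m z)) = b'^T *m z by rewrite /b' !trmx_mul trmxK BT !mulmxA.
  rewrite mxE -big_split/= -sumrB; apply: eq_bigr => i _.
  by rewrite mxE; ring.
have qm := diag_quad_moments (fun i => b' i 0) (fun i => c 0 i).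
have [q1 q2] := diag_quad_Ex (fun i => b' i 0) (fun i => c 0 i).
have mqf : measurable_fun setT (quad_fun b A) by have [] := quad_fun_moments b A.
split.
  by rewrite (transfer_Ex mpsi Ppsi)// E.
have E2 : (fun x => quad_fun b A x ^+ 2) \o psi = fun z => diag_quad (fun i => b' i 0) (fun i => c 0 i) z ^+ 2.
  by rewrite -E.
rewrite (transfer_Ex mpsi Ppsi)//; last 2 first.
- exact: measurable_funX.
- by rewrite E2; exact: all_momentsX.
rewrite E2 q2 big_split/= -dotxxE; congr (_ + _).
  rewrite /b' !trmx_mul trmxK BT; congr (fun_of_matrix _ 0 0).
  by rewrite -!mulmxA (mulmxA U) orth_tr// mul1mx (mulmxA B) BB.
rewrite -mulr_sumr; congr (_ * _).
have -> : \tr (A *m S *m (A *m S)) = \tr (B *m A *m B *m (B *m A *m B)).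
  by rewrite -BB !mulmxA [LHS]mxtrace_mulC !mulmxA.
rewrite CE -!mulmxA (mulmxA U^T) Uo mul1mx mxtrace_mulC -!mulmxA Uo mulmx1 mulmx_diag.
by apply: eq_bigr => i _; rewrite !mxE eqxx mulr1n expr2.
Qed.

End general.
End gaussian_moments.

(** * The Wasserstein distance between Gaussian laws *)

Section gelbrich.
Context {R : realType} (d : nat).
Variables (m nu : 'cV[R]_d) (S Xi : 'M[R]_d).
Hypotheses (Sc : covariance_matrix S) (Xc : covariance_matrix Xi) (Xu : Xi \in unitmx).
Variable Q : probability 'cV[R]_d R.
Hypothesis Qg : measure_eq Q (gaussian nu Xi).
Let H := sqrtmx Xi.
Let HT : H^T = H. Proof. by have [[]] := sqrtmx_spec Xc. Qed.
Let HH : H *m H = Xi. Proof. by have [] := sqrtmx_spec Xc. Qed.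
Let D := sqrtmx (H *m S *m H).
Let w2 : R := sqnorm (m - nu) + bures Xi S + \tr Xi.

Let dotE (x y : 'cV[R]_d) : (x^T *m y) 0 0 = \sum_i x i 0 * y i 0.
Proof. by rewrite mxE; apply: eq_bigr => i _; rewrite mxE. Qed.

Let sqnorm_expand (v x y : 'cV[R]_d) : sqnorm (v + (x - y)) = sqnorm v + 2 * (v^T *m x) 0 0
  - 2 * (v^T *m y) 0 0 + (x^T *m x) 0 0 + (y^T *m y) 0 0 - 2 * (x^T *m y) 0 0.
Proof.
rewrite /sqnorm !dotE !mulr_sumr -!sumrN -!big_split/=; apply: eq_bigr => i _.
by rewrite !mxE; ring.
Qed.

(** [gaussian] uses the spectral root, while the coupling below produces its first marginal through
    [G *m H], which need not be symmetric; [std_gaussian_gram] bridges the two. *)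
Lemma affine_law (v : 'cV[R]_d) (A K : 'M[R]_d) : covariance_matrix K -> A *m A^T = K ->
  forall E : set 'cV[R]_d, measurable E ->
  gaussian v K E = std_gaussian d (affine_cV v A @^-1` E).
Proof.
move=> Kc AK E mE; have [[KT _] KK] := sqrtmx_spec Kc.
pose F := (fun y : 'cV[R]_d => v + 1%:M *m y) @^-1` E.
have mF : measurable F.
  by apply: measurable_preimage mE; exact: (measurable_affine_cV v 1%:M).
have e : sqrtmx K *m (sqrtmx K)^T = A *m A^T by rewrite KT KK AK.
have := std_gaussian_gram e mF; rewrite /F.
have Z (M : 'M[R]_d) : (fun z : 'cV[R]_d => M *m z) @^-1` ((fun y : 'cV[R]_d => v + 1%:M *m y) @^-1` E) =
   affine_cV v M @^-1` E.
  by apply/seteqP; split => z; rewrite /affine_cV/= mul1mx.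
by rewrite !Z.
Qed.

(** The coupling feeds one standard vector [z] to both sides: the pair is [(m + G H z, nu + H z)]
    with [G] from [gelbrich_map]. *)
Lemma W2sq_gaussian_le : (W2sq (gaussian m S) Q <= w2%:E)%E.
Proof.
have [G [GT GXG GX]] := gelbrich_map Xc Xu Sc.
pose T := fun z : 'cV[R]_d => (affine_cV m (G *m H) z, affine_cV nu H z).
have mT : measurable_fun setT T.
  by apply: measurable_fun_pair; exact: measurable_affine_cV.
pose Tm : {mfun 'cV[R]_d >-> ('cV[R]_d * 'cV[R]_d)%type} := HB.pack T (isMeasurableFun.Build _ _ _ _ _ mT).
apply: ereal_inf_lbound; exists (distribution (std_gaussian d) Tm) => /=.
  move=> A mA; split; rewrite /distribution /pushforward.
    rewrite (affine_law m (A := G *m H) Sc)//.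
      by congr (std_gaussian d _); apply/seteqP; split => z //= [].
    by rewrite trmx_mul HT GT mulmxA -(mulmxA G H H) HH.
  rewrite Qg//; congr (std_gaussian d _).
  by apply/seteqP; split => z //= [].
pose K := G - 1%:M; pose v := m - nu.
have KT : K^T = K by rewrite /K linearB/= GT trmx1.
(* The cost as a function of the second point [y] alone: the squared norm of [v + K (y - nu)],
   arranged so that everything but constants is a centered [quad_fun]. *)
pose f y := sqnorm v + quad_fun nu Xi (2 *: (K *m v)) (K *m K) y + \tr (K *m K *m Xi).
have f_m : all_moments (gaussian nu Xi) f.
  apply: all_momentsD; last exact: all_moments_cst.
  by apply: all_momentsD; [exact: all_moments_cst|exact: quad_fun_moments].
have f_E : Ex (gaussian nu Xi) f = w2.
  rewrite ExD//; last 2 first.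
  - by apply: all_momentsD; [exact: all_moments_cst|exact: quad_fun_moments].
  - exact: all_moments_cst.
  rewrite ExD//; last 2 first; [exact: all_moments_cst|exact: quad_fun_moments|].
  rewrite !Ex_cst (quad_fun_Ex nu Xc _ (A := K *m K) _).1; last by rewrite trmx_mul KT.
  rewrite addr0 /w2 -/v -addrA; congr (_ + _).
  have -> : K *m K *m Xi = G *m (G *m Xi) - G *m Xi - G *m Xi + Xi.
    have KX Y : K *m Y = G *m Y - Y by rewrite /K mulmxBl mul1mx.
    by rewrite -mulmxA !KX mulmxBr opprB (addrC Xi) addrA.
  rewrite !raddfD/= !raddfN/= mxtrace_mulC GXG GX /bures; lra.
have fT z : sqnorm ((T z).1 - (T z).2) = f (affine_cV nu H z).
  rewrite /T/= /f /quad_fun /affine_cV.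
  have -> : m + G *m H *m z - (nu + H *m z) = v + (K *m (H *m z) - 0).
    by rewrite /v /K mulmxBl mul1mx mulmxA subr0 opprD addrACA.
  have -> : nu + H *m z - nu = H *m z by rewrite addrC addKr.
  rewrite sqnorm_expand mulmx0 trmx0 mul0mx mulmx0.
  set w := H *m z; have -> : (K *m w)^T *m (K *m w) = w^T *m (K *m K) *m w.
    by rewrite trmx_mul KT !mulmxA.
  have -> : (2 *: (K *m v))^T *m w = 2 *: (v^T *m (K *m w)).
    by rewrite linearZ/= trmx_mul KT -scalemxAl mulmxA.
  have Z0 : (0 : 'M[R]_1) 0 0 = 0 by rewrite mxE.
  have Z2 (M : 'M[R]_1) : (2 *: M) 0 0 = 2 * M 0 0 by rewrite mxE.
  by rewrite !Z0 Z2; ring.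
have mf : measurable_fun setT (fun y => (f y)%:E) by apply/measurable_EFinP; case: f_m.
have Hg A : measurable A -> gaussian nu Xi A = std_gaussian d (affine_cV nu H @^-1` A) by [].
have H2 : all_moments (std_gaussian d) (f \o affine_cV nu H).
  have [_ f_meas] : True /\ measurable_fun setT f by split => //; case: f_m.
  by have [/(_ f_m)] := transfer_moments (measurable_affine_cV nu H) Hg f_meas.
have msq : measurable_fun setT (fun z : 'cV[R]_d * 'cV[R]_d => (sqnorm (z.1 - z.2))%:E).
  apply/measurable_EFinP; apply: measurable_sum => i; apply: measurable_funX.
  rewrite (_ : (fun z : 'cV[R]_d * 'cV[R]_d => (z.1 - z.2) i 0) = fun z => z.1 i 0 - z.2 i 0).
    apply: measurable_funB.
      by apply: (measurableT_comp (measurable_entry i 0)); exact: measurable_fst.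
    by apply: (measurableT_comp (measurable_entry i 0)); exact: measurable_snd.
  by apply/funext => z; rewrite !mxE.
rewrite ge0_integral_distribution//; last first.
  by move=> z; rewrite lee_fin sumr_ge0// => i _; rewrite sqr_ge0.
rewrite -f_E (transfer_Ex (measurable_affine_cV nu H) Hg)//; last by case: f_m.
rewrite -(ExE H2); apply: eq_integral => z _ /=; congr EFin; exact: fT.
Qed.

(** Weak duality: the cost dominates a function of [x] plus a function of [y], whose expectations
    under a coupling depend only on the marginals. *)
Lemma W2sq_gaussian_ge : (w2%:E <= W2sq (gaussian m S) Q)%E.
Proof.
apply: le_ereal_inf_tmp => _ /= [pi cpl <-].
have f1 A : measurable A -> gaussian m S A = pi (fst @^-1` A).
  move=> mA; have [<- _] := cpl _ mA; congr (pi _).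
  by apply/seteqP; split => -[x y] //= [].
have f2 A : measurable A -> gaussian nu Xi A = pi (snd @^-1` A).
  move=> mA; have [_ E] := cpl _ mA.
  have E2 : Q A = gaussian nu Xi A by exact: Qg.
  rewrite -E2 -E; congr (pi _).
  by apply/seteqP; split => -[x y] //= [].
have c1 i : all_moments pi (fun z => z.1 i 0).
  by have [/(_ (gaussian_coord m S i))] := transfer_moments measurable_fst f1 (measurable_entry i 0).
have c2 i : all_moments pi (fun z => z.2 i 0).
  by have [/(_ (gaussian_coord nu Xi i))] := transfer_moments measurable_snd f2 (measurable_entry i 0).
have sqm : all_moments pi (fun z => sqnorm (z.1 - z.2)).
  apply: all_moments_sum => i _; apply: all_momentsX.
  rewrite (_ : (fun z : 'cV[R]_d * 'cV[R]_d => (z.1 - z.2) i 0) = fun z => z.1 i 0 - z.2 i 0).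
    exact: all_momentsB.
  by apply/funext => z; rewrite !mxE.
rewrite (ExE sqm) lee_fin; apply/ler_addgt0Pr => e e0.
(* The dual pair loses its parameter times [d]; dividing by [d.+1] keeps the loss within [e], also
   when [d] is 0. *)
have e'0 : 0 < e / d.+1%:R by rewrite divr_gt0.
have [A [A' [AT A'T AS A'X dual]]] := gelbrich_dual Xc Xu Sc e'0.
pose v := m - nu.
(* Expanding the squared norm of [v + (x - m) - (y - nu)] leaves one term that mixes both points,
   twice the inner product of [x - m] and [y - nu]; [dual] splits it between [A] and [A']. *)
pose q1 := quad_fun m S (2 *: v) (1%:M - A).
pose q2 := quad_fun nu Xi (- 2 *: v) (1%:M - A').
have q1m : all_moments pi (fun z => q1 z.1).
  have qm := quad_fun_moments m S (2 *: v) (1%:M - A).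
  by have [/(_ qm)] := transfer_moments measurable_fst f1 qm.1.
have q2m : all_moments pi (fun z => q2 z.2).
  have qm := quad_fun_moments nu Xi (- 2 *: v) (1%:M - A').
  by have [/(_ qm)] := transfer_moments measurable_snd f2 qm.1.
have q1E : Ex pi (fun z => q1 z.1) = 0.
  have <- := transfer_Ex measurable_fst f1 (quad_fun_moments m S (2 *: v) (1%:M - A)).1 q1m.
  by apply: (quad_fun_Ex m Sc (2 *: v) (A := 1%:M - A) _).1; rewrite linearB/= trmx1 AT.
have q2E : Ex pi (fun z => q2 z.2) = 0.
  have <- := transfer_Ex measurable_snd f2 (quad_fun_moments nu Xi (- 2 *: v) (1%:M - A')).1 q2m.
  by apply: (quad_fun_Ex nu Xc (- 2 *: v) (A := 1%:M - A') _).1; rewrite linearB/= trmx1 A'T.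
pose c := sqnorm v + \tr ((1%:M - A) *m S) + \tr ((1%:M - A') *m Xi).
have cm := all_moments_cst pi c.
have : c <= Ex pi (fun z => sqnorm (z.1 - z.2)).
  have -> : c = Ex pi (fun z => c + (q1 z.1 + q2 z.2)).
    by rewrite (ExD cm (all_momentsD q1m q2m)) (ExD q1m q2m) q1E q2E Ex_cst !addr0.
  apply: le_Ex => //; first by apply: all_momentsD => //; exact: all_momentsD.
  move=> -[x y] /=; rewrite /c /q1 /q2 /quad_fun.
  have xy : x - y = v + ((x - m) - (y - nu)).
    by rewrite /v; apply/colP => i; rewrite !mxE; ring.
  rewrite xy; set x' := x - m; set y' := y - nu.
  have := dual x' y'; rewrite sqnorm_expand.
  have lE k (u : 'cV[R]_d) : ((k *: v)^T *m u) 0 0 = k * (v^T *m u) 0 0.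
    by rewrite linearZ/= -scalemxAl mxE.
  have aE (M : 'M[R]_d) (u : 'cV[R]_d) : (u^T *m (1%:M - M) *m u) 0 0 =
      (u^T *m u) 0 0 - (u^T *m M *m u) 0 0.
    by rewrite mulmxBr mulmx1 mulmxBl !mxE.
  rewrite !lE !aE; lra.
move=> h; apply: (le_trans (y := c + e)); last by rewrite lerD2r.
rewrite /c /w2 -/v !mulmxBl !mul1mx !raddfB/= A'X /bures -/H -/D.
have ed : e / d.+1%:R * d%:R <= e.
  by rewrite mulrAC ler_pdivrMr// ler_pM2l// ler_nat.
move: AS ed; rewrite -/H -/D.
move: (\tr D) (\tr (A *m S)) (e / d.+1%:R * d%:R) => t a b; lra.
Qed.

Lemma W2sq_gaussian : W2sq (gaussian m S) Q = (sqnorm (m - nu) + bures Xi S + \tr Xi)%:E.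
Proof. by apply/eqP; rewrite eq_le W2sq_gaussian_le W2sq_gaussian_ge. Qed.

End gelbrich.

Section sample_statistics.
Context {R : realType} (d n : nat).
Implicit Type x : 'I_n -> 'cV[R]_d.

Lemma sample_cov_psd x : covariance_matrix (sample_cov x).
Proof.
have V (v : 'cV[R]_d) : covariance_matrix (v *m v^T).
  split; first by rewrite trmx_mul trmxK.
  move=> y; rewrite mulmxA -mulmxA (_ : y^T *m v = (v^T *m y)^T); last by rewrite trmx_mul trmxK.
  by rewrite -{1}[v^T *m y]trmxK dotxx_ge0 || exact: dotxx_ge0.
have : covariance_matrix (\sum_i (x i - sample_mean x) *m (x i - sample_mean x)^T).
  elim/big_ind: _ => //.
    by split; [rewrite trmx0|move=> y; rewrite mulmx0 mul0mx mxE].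
  move=> A B [AT A0] [BT B0]; split; first by rewrite linearD/= AT BT.
  by move=> y; rewrite mulmxDr mulmxDl mxE addr_ge0.
move=> [ST S0]; split; first by rewrite linearZ/= ST.
by move=> y; rewrite -scalemxAr -scalemxAl mxE mulr_ge0// invr_ge0.
Qed.

Lemma GWE (nu : 'cV[R]_d) (Xi : 'M[R]_d) (Q : probability 'cV[R]_d R) x :
  covariance_matrix Xi -> Xi \in unitmx -> measure_eq Q (gaussian nu Xi) ->
  GW Q x = sqnorm (sample_mean x - nu) + bures Xi (sample_cov x) + \tr Xi.
Proof.
by move=> Xc Xu Qg; rewrite /GW (W2sq_gaussian _ (sample_cov_psd x) Xc Xu Qg).
Qed.

End sample_statistics.

(** * Test functions and weak convergence *)

Section spline.
Context {R : realType}.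
Implicit Types x y : R.

Definition pospart x : R := Num.max x 0.

Variant pospart_spec x : R -> Type :=
| PosPartPos of 0 <= x : pospart_spec x x
| PosPartNeg of x <= 0 : pospart_spec x 0.

Lemma pospartP x : pospart_spec x (pospart x).
Proof. by rewrite /pospart; case: (leP x 0) => h; constructor => //; exact: ltW. Qed.

(* Third difference of the truncated cube: a C^2 step from 0 (at x <= 0) to 1
   (at 3 <= x) with Lipschitz second derivative. *)
Definition step x : R := (pospart x ^+ 3 - 3 * pospart (x - 1) ^+ 3
  + 3 * pospart (x - 2) ^+ 3 - pospart (x - 3) ^+ 3) / 6.

(** The coefficients are written down and the four sign cases compared. When [x] and [x + y] have
    opposite signs, both are at most [|y|] in absolute value. *)
Lemma pospart_taylor x y :
  `|pospart (x + y) ^+ 3 - (pospart x ^+ 3 + 3 * pospart x ^+ 2 * y + 3 * pospart x * y ^+ 2)| <= `|y| ^+ 3.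
Proof.
have y3 : - `|y| ^+ 3 <= y ^+ 3 <= `|y| ^+ 3 by rewrite -ler_norml normrX.
case: pospartP => h; case: pospartP => h'.
- rewrite (_ : _ - _ = y ^+ 3) ?normrX//; ring.
- rewrite (_ : _ - _ = (x + y) ^+ 3); last by ring.
  rewrite normrX lerXn2r ?nnegrE//; rewrite ger0_norm// ger0_norm; lra.
- rewrite (_ : _ - _ = y ^+ 3 - (x + y) ^+ 3); last by ring.
  have y0 : y <= 0 by lra.
  rewrite ler0_norm; last first.
    rewrite subr_le0; have -> : y ^+ 3 = - (- y) ^+ 3 by ring.
    have -> : (x + y) ^+ 3 = - (- (x + y)) ^+ 3 by ring.
    by rewrite lerN2 lerXn2r ?nnegrE; lra.
  have -> : `|y| ^+ 3 = - y ^+ 3 by rewrite ler0_norm//; ring.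
  have : (x + y) ^+ 3 <= 0.
    have -> : (x + y) ^+ 3 = - (- (x + y)) ^+ 3 by ring.
    by rewrite oppr_le0 exprn_ge0; lra.
  lra.
- rewrite (_ : _ - _ = 0) ?normr0 ?exprn_ge0//; ring.
Qed.

Lemma pospart_ge x : 0 <= x -> pospart x = x.
Proof. by move=> x0; rewrite /pospart; apply/max_idPl. Qed.

Lemma pospart_le x : x <= 0 -> pospart x = 0.
Proof. by move=> x0; rewrite /pospart; apply/max_idPr. Qed.

Lemma step_le0 x : x <= 0 -> step x = 0.
Proof. by move=> x0; rewrite /step !pospart_le; [ring | lra..]. Qed.

Lemma step_ge3 x : 3 <= x -> step x = 1.
Proof. by move=> x3; rewrite /step !pospart_ge; [field | lra..]. Qed.

(** Up to a factor, the difference is the fourth difference of the truncated cube, a cubic B-spline,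
    nonnegative on each piece. Monotonicity along unit shifts yields the bounds 0 and 1 by
    induction, and the sign of differences of consecutive test functions. *)
Lemma step_mono x : step (x - 1) <= step x.
Proof.
rewrite /step ler_pM2r ?invr_gt0//.
have -> : x - 1 - 1 = x - 2 by ring.
have -> : x - 1 - 2 = x - 3 by ring.
have -> : x - 1 - 3 = x - 4 by ring.
(* Six times a middle piece of the B-spline; it serves on [[1, 2]] with [t = x - 1] and, by
   reflection, on [[2, 3]] with [t = 3 - x]. *)
have cub (t : R) : 0 <= t -> t <= 1 -> 0 <= 1 + 3 * t + 3 * t ^+ 2 - 3 * t ^+ 3.
  move=> t0 t1; have t2 : 0 <= t ^+ 2 by exact: sqr_ge0.
  have t3 : t ^+ 3 <= t ^+ 2 by rewrite exprSr ler_piMr.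
  lra.
rewrite -subr_ge0.
have [x0|/ltW x0] := leP x 0; first by rewrite !pospart_le; lra.
have [x1|/ltW x1] := leP x 1.
  rewrite (pospart_ge x0) !pospart_le; [|lra..].
  by rewrite !expr0n/= !(mulr0, subr0, addr0) exprn_ge0.
have [x2|/ltW x2] := leP x 2.
  rewrite (pospart_ge x0) (@pospart_ge (x - 1)) ?(@pospart_le (x - 2))  ?(@pospart_le (x - 3)) ?(@pospart_le (x - 4)); [|lra..].
  by have := cub (x - 1); move=> /(_ ltac:(lra) ltac:(lra)); lra.
have [x3|/ltW x3] := leP x 3.
  rewrite (pospart_ge x0) (@pospart_ge (x - 1)) ?(@pospart_ge (x - 2))  ?(@pospart_le (x - 3)) ?(@pospart_le (x - 4)); [|lra..].
  by have := cub (3 - x); move=> /(_ ltac:(lra) ltac:(lra)); lra.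
have [x4|/ltW x4] := leP x 4.
  rewrite (pospart_ge x0) (@pospart_ge (x - 1)) ?(@pospart_ge (x - 2))  ?(@pospart_ge (x - 3)) ?(@pospart_le (x - 4)); [|lra..].
  have : 0 <= (4 - x) ^+ 3 by rewrite exprn_ge0// subr_ge0.
  lra.
rewrite !pospart_ge; lra.
Qed.

Lemma step_ge0 x : 0 <= step x.
Proof.
have [n] : exists n, x <= n%:R by exists (Num.truncn x).+1; exact: ltW (truncnS_gt _).
elim: n x => [|n IH] x; first by move=> x0; rewrite step_le0.
rewrite -addn1 natrD -lerBlDr => /IH/le_trans; apply; exact: step_mono.
Qed.

Lemma step_le1 x : step x <= 1.
Proof.
have [n] : exists n, 3 - x <= n%:R by exists (Num.truncn (3 - x)).+1; exact: ltW (truncnS_gt _).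
elim: n x => [|n IH] x; first by move=> x0; rewrite step_ge3//; lra.
move=> h; have := step_mono (x + 1); rewrite addrK => /le_trans; apply; apply: IH.
by move: h; rewrite -addn1 natrD; lra.
Qed.

(** [a] and [b] stand for the first derivative and half the second. Asking for the Taylor bound
    itself, with one constant throughout, avoids derivatives and is what the Lindeberg replacement
    consumes. *)
Definition smooth3 (L : R) (f : R -> R) := (forall x, `|f x| <= L) /\
  forall x, exists a b, [/\ `|a| <= L, `|b| <= L &
    forall y, `|f (x + y) - (f x + a * y + b * y ^+ 2)| <= L * `|y| ^+ 3].

Lemma smooth3_step : smooth3 4 step.
Proof.
split; first by move=> x; rewrite ger0_norm ?step_ge0// (le_trans (step_le1 x))//; lra.
move=> x.
pose q k (u : R) : R := (pospart u ^+ k - 3 * pospart (u - 1) ^+ k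
  + 3 * pospart (u - 2) ^+ k - pospart (u - 3) ^+ k) / 2.
exists (q 2%N x), (q 1%N x); split.
- rewrite ler_norml /q; apply/andP; split;
  case: (pospartP x) => h0; case: (pospartP (x - 1)) => h1; case: (pospartP (x - 2)) => h2;
  case: (pospartP (x - 3)) => h3; nra.
- rewrite ler_norml /q !expr1; apply/andP; split;
  case: (pospartP x) => h0; case: (pospartP (x - 1)) => h1; case: (pospartP (x - 2)) => h2;
  case: (pospartP (x - 3)) => h3; lra.
- move=> y; rewrite /step /q !expr1.
  have T u := pospart_taylor u y.
  have := T x; have := T (x - 1); have := T (x - 2); have := T (x - 3).
  have c3 u : x - u + y = x + y - u by ring.
  rewrite !c3 => /ler_normlP[a1 a2] /ler_normlP[b1 b2] /ler_normlP[c1 c2] /ler_normlP[d1 d2].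
  by apply/ler_normlP; split; lra.
Qed.

(** The value, the two coefficients and the remainder scale like 1, [m], [m ^+ 2] and [m ^+ 3]; the
    cube of [1 + m] dominates all four. *)
Lemma smooth3_affine L f m c : 0 <= m -> smooth3 L f ->
  smooth3 (L * (1 + m) ^+ 3) (fun x => f (m * x + c)).
Proof.
move=> m0 [fL fT]; have L0 : 0 <= L by rewrite (le_trans _ (fL 0)).
have m1 : 1 <= (1 + m) ^+ 3 by rewrite exprn_ege1//; lra.
have le1 k : (k <= 3)%N -> m ^+ k <= (1 + m) ^+ 3.
  move=> k3; apply: (@le_trans _ _ ((1 + m) ^+ k)).
    by rewrite lerXn2r ?nnegrE; lra.
  by rewrite ler_weXn2l//; lra.
split; first by move=> x; rewrite (le_trans (fL _))// ler_peMr.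
move=> x; have [a [b [aL bL ab]]] := fT (m * x + c).
exists (a * m), (b * m ^+ 2); split.
- rewrite normrM (ger0_norm m0) ler_pM//; exact: (le1 1%N).
- by rewrite normrM (ger0_norm (exprn_ge0 _ m0)) ler_pM// ?exprn_ge0// le1.
- move=> y; have := ab (m * y).
  have -> : m * x + c + m * y = m * (x + y) + c by ring.
  have -> : b * (m * y) ^+ 2 = b * m ^+ 2 * y ^+ 2 by ring.
  rewrite [a * (m * y)]mulrA => /le_trans; apply.
  by rewrite normrM exprMn (ger0_norm m0) mulrA ler_wpM2r ?exprn_ge0// ler_wpM2l// le1.
Qed.

(** Boundedness and the Lipschitz property in one inequality. The minimum with 1 makes it enough to
    control the remainder of [GW_expand] for small deviations. *)
Lemma smooth3_lip L f : smooth3 L f -> forall x y, `|f (x + y) - f x| <= 3 * L * Num.min 1 `|y|.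
Proof.
move=> [fL fT] x y; have L0 : 0 <= L by rewrite (le_trans _ (fL 0)).
have [y1|y1] := leP 1 `|y|.
  rewrite mulr1 (le_trans (ler_normB _ _))//; have := fL (x + y); have := fL x; lra.
have [a [b [aL bL /(_ y)]]] := fT x.
have y0 : 0 <= `|y| by [].
have y2 : `|y| ^+ 2 <= `|y| by rewrite expr2 ler_piMr// ltW.
have y3 : `|y| ^+ 3 <= `|y| by rewrite exprS ler_piMr// exprn_ile1// ltW.
have ay : `|a * y| <= L * `|y| by rewrite normrM ler_wpM2r.
have by2 : `|b * y ^+ 2| <= L * `|y|.
  by rewrite normrM normrX ler_pM// exprn_ge0.
have Ly3 : L * `|y| ^+ 3 <= L * `|y| by rewrite ler_wpM2l.
move: ay by2 => /ler_normlP[? ?] /ler_normlP[? ?] /ler_normlP[? ?].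
apply/ler_normlP; split; lra.
Qed.

Lemma smooth3_lipschitz L f : smooth3 L f -> forall x y, `|f (x + y) - f x| <= 3 * L * `|y|.
Proof.
move=> sf x y; have L0 : 0 <= L by rewrite (le_trans _ (sf.1 0)).
by rewrite (le_trans (smooth3_lip sf x y))// ler_wpM2l ?mulr_ge0// ge_min lexx orbT.
Qed.

Lemma lipschitz_continuous K (f : R -> R) :
  (forall x y, `|f (x + y) - f x| <= K * `|y|) -> continuous f.
Proof.
move=> lf x; have K0 : 0 <= K by have := lf 0 1; rewrite normr1 mulr1; exact: le_trans.
apply/cvgrPdist_le => /= e e0; near=> z.
have := lf x (z - x); rewrite subrKC distrC => /le_trans; apply.
apply: (@le_trans _ _ ((K + 1) * `|x - z|)); first by rewrite distrC ler_wpM2r// lerDl.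
rewrite -ler_pdivlMl; last by rewrite ltr_wpDl.
near: z; apply: cvgr_dist_le; first exact: cvg_id.
by rewrite mulr_gt0// invr_gt0 ltr_wpDl.
Unshelve. all: by end_near. Qed.

Lemma smooth3_continuous L f : smooth3 L f -> continuous f.
Proof. by move=> /smooth3_lipschitz/lipschitz_continuous. Qed.

(** For positive [m], a step that starts at [(i - J) / m] and rises over a length [3 / m].
    Differences of consecutive ones form a partition of unity of mesh [1 / m] on a window around 0
    whose width is governed by [J]. The family is countable and independent of the function to be
    tested. *)
Definition test_fun (m J i : nat) (x : R) : R := step (m%:R * x + (J%:R - i%:R)).

Lemma smooth3_test_fun m J i : smooth3 (4 * (1 + m%:R) ^+ 3) (test_fun m J i).
Proof. by apply: smooth3_affine => //; exact: smooth3_step. Qed.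

End spline.

Section weak_convergence.
Context {R : realType}.

Lemma bounded_all_moments d (T : measurableType d) (P : probability T R) (f : T -> R) M :
  measurable_fun setT f -> (forall x, `|f x| <= M) -> all_moments P f.
Proof.
move=> mf fM; apply: (all_moments_dom (g := cst M)) => //; last exact: all_moments_cst.
by move=> x; rewrite (le_trans (fM x))// ler_norm.
Qed.

Lemma test_fun_moments (P : probability R R) m J i : all_moments P (test_fun m J i).
Proof.
have sf := @smooth3_test_fun R m J i.
apply: (@bounded_all_moments _ _ _ _ (4 * (1 + m%:R) ^+ 3)); last by case: sf.
by apply: continuous_measurable_fun; exact: smooth3_continuous sf.
Qed.

(** [y] may leave the segment. The radius [4 / n] is the width of the support of the difference of
    two consecutive test functions at scale [n]. *)
Lemma uniform_continuity (f : R -> R) (K e : R) : continuous f -> 0 < e ->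
  exists2 n : nat, (0 < n)%N & forall x, `|x| <= K -> forall y, `|y - x| <= 4 / n%:R -> `|f y - f x| <= e.
Proof.
move=> cf e0.
have /compact_near_coveringP := @segment_compact R (- K) K.
pose P (n : nat) (x : R) := forall y, `|y - x| <= 4 / n%:R -> `|f y - f x| <= e.
move=> /(_ nat \oo P _) H.
have : \forall n \near \oo, `[- K, K] `<=` P n.
  apply: H => x _.
  have /cvgrPdist_le/(_ (e / 2)) := cf x; rewrite divr_gt0// => /(_ isT).
  move=> /nbhs_ballP[d /= d0 Hd].
  exists (ball x (d / 2), [set n | 4 / n%:R < d / 2]) => /=.
    split; first by apply: nbhsx_ballx; rewrite divr_gt0.
    have d8 : 0 <= 8 / d by rewrite divr_ge0// ltW.
    have := @nbhs_infty_gtr R (8 / d); apply: filterS => n /= dn.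
    have n0 : 0 < n%:R :> R by rewrite (le_lt_trans _ dn).
    by move: dn; rewrite ltr_pdivrMr// => dn; rewrite ltr_pdivrMr//; lra.
  move=> [z n] [/= zx nd] y yz.
  have zx' : `|x - z| < d / 2 by move: zx; rewrite /ball/=.
  have yx : `|x - y| < d.
    rewrite (_ : x - y = (x - z) - (y - z)); last by ring.
    by rewrite (le_lt_trans (ler_normB _ _))//; move: yz nd zx'; lra.
  have /Hd hy : ball x d y by rewrite /ball/=.
  have /Hd hz : ball x d z by rewrite /ball/=; move: zx' (d0); lra.
  rewrite (_ : f y - f z = (f x - f z) - (f x - f y)); last by ring.
  by rewrite (le_trans (ler_normB _ _))//; move: hy hz; lra.
move=> [N _ HN]; exists N.+1 => // x xK y yx.
apply: (HN N.+1 _ x) => //=.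
by rewrite in_itv/= -ler_norml.
Qed.

(** [f] is approximated by [phi], its interpolation through differences of test functions, with
    error at most [eta + M1 * tau], where [tau] is the mass missing from the partition of unity.
    Under [N] the mean of [tau] is small by Chebyshev; under [P] it is small because [tau] is itself
    made of two test functions. Tightness of [P] thus comes for free. *)
Lemma test_fun_determining (N : probability R R) (f : R -> R) (M e : R) :
  all_moments N id -> continuous f -> (forall x, `|f x| <= M) -> 0 < e ->
  exists (m J : nat) (d : R), 0 < d /\ forall P : probability R R,
    (forall i, `|Ex P (test_fun m J i) - Ex N (test_fun m J i)| <= d) ->
    `|Ex P f - Ex N f| <= e.
Proof.
move=> N2 cf fM e0.
have M0 : 0 <= M by rewrite (le_trans _ (fM 0)).
pose M1 := M + 1; have M10 : 0 < M1 by rewrite /M1; lra.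
pose V := Ex N (fun x => x ^+ 2).
have V0 : 0 <= V by apply: Ex_ge0 => x; exact: sqr_ge0.
pose eta := e / 8; have eta0 : 0 < eta by rewrite divr_gt0.
(* [L] brings the Chebyshev bound for [M1 * tau] under [N] down to [eta]; the window uses [L + 4] so
   that its first step has finished rising wherever [|x| <= L + 1]. *)
have [L LV] : exists L : nat, V * M1 <= eta * (L%:R + 1) ^+ 2.
  exists (Num.truncn (V * M1 / eta)).+1.
  have := truncnS_gt (V * M1 / eta); set n := Num.truncn _ => h.
  rewrite [eta * _]mulrC -ler_pdivrMr// (le_trans (ltW h))//.
  rewrite (@le_trans _ _ (n.+1%:R + 1))//; first by rewrite lerDl.
  by rewrite expr2 ler_peMr ?addr_ge0// lerDr.
pose L4 := (L + 4)%N.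
have [m m0 Hm] := @uniform_continuity f (L4%:R) eta cf eta0.
pose J := (m * L4)%N.
have mR : 0 < m%:R :> R by rewrite ltr0n.
pose s i x := @test_fun R m J i x.
pose c i : R := i%:R / m%:R - L4%:R.
pose phi x := \sum_(i < J.*2) f (c i) * (s i x - s i.+1 x).
pose tau x := 1 - (s 0%N x - s J.*2 x).
(* Small enough that passing from [N] to [P] in all [J.*2] terms of [phi] and in [tau] costs at most
   [eta]. *)
pose d := eta / ((J.*2)%:R * M1 * 2 + 2 * M1 + 1).
have D0 : 0 < (J.*2)%:R * M1 * 2 + 2 * M1 + 1.
  have := mulr_ge0 (ler0n R J.*2) (ltW M10); lra.
exists m, J, d; split; first by rewrite divr_gt0.
move=> P HP.
have sP (Q : probability R R) i : all_moments Q (s i) by exact: test_fun_moments.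
have fP (Q : probability R R) : all_moments Q f.
  by apply: (@bounded_all_moments _ _ _ _ M) => //; exact: continuous_measurable_fun.
have phiP (Q : probability R R) : all_moments Q phi.
  by apply: all_moments_sum => i _; apply: all_momentsZ; exact: all_momentsB.
have tauP (Q : probability R R) : all_moments Q tau.
  by apply: all_momentsB; [exact: all_moments_cst|exact: all_momentsB].
have smono i x : s i.+1 x <= s i x.
  rewrite /s /test_fun (_ : _ + (J%:R - i.+1%:R) = m%:R * x + (J%:R - i%:R) - 1); last first.
    by rewrite -addn1 natrD; ring.
  exact: step_mono.
have tel x k : \sum_(i < k) (s i x - s i.+1 x) = s 0%N x - s k x.
  elim: k => [|k IH]; first by rewrite big_ord0 subrr.
  by rewrite big_ord_recr/= IH; ring.
have tau0 x : 0 <= tau x.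
  by rewrite /tau; have := @step_le1 R (m%:R * x + (J%:R - 0%:R)); have := @step_ge0 R (m%:R * x + (J%:R - (J.*2)%:R)); rewrite /s /test_fun; lra.
have near x : `|f x - phi x| <= eta + M1 * tau x.
  have -> : f x - phi x = \sum_(i < J.*2) (f x - f (c i)) * (s i x - s i.+1 x) + f x * tau x.
    rewrite /tau -tel /phi mulrBr mulr1 mulr_sumr [_ + (f x - _)]addrCA -sumrB.
    by congr (_ + _); rewrite -sumrN; apply: eq_bigr => i _; ring.
  rewrite (le_trans (ler_normD _ _))// lerD//; last first.
    rewrite normrM (ger0_norm (tau0 x)) ler_wpM2r// (le_trans (fM x))// /M1; lra.
  rewrite (le_trans (ler_norm_sum _ _ _))//.
  apply: (@le_trans _ _ (\sum_(i < J.*2) eta * (s i x - s i.+1 x))); last first.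
    rewrite -mulr_sumr tel ger_pMr//; have := tau0 x; rewrite /tau; lra.
  apply: ler_sum => i _.
  rewrite normrM (@ger0_norm _ (s i x - _)) ?subr_ge0//.
  have [s0|s0] := eqVneq (s i x) 0.
    have s1 : s i.+1 x = 0.
      by apply/eqP; rewrite eq_le -{1}s0 smono step_ge0.
    by rewrite s0 s1 subrr !mulr0.
  have [s3|s3] := eqVneq (s i.+1 x) 1.
    have -> : s i x = 1 by apply/eqP; rewrite eq_le step_le1 -s3 smono.
    by rewrite s3 subrr !mulr0.
  rewrite ler_wpM2r ?subr_ge0//.
  have h1 : 0 < m%:R * x + (J%:R - i%:R).
    by rewrite ltNge; apply: contra s0 => h; apply/eqP; exact: step_le0.
  have h2 : m%:R * x + (J%:R - i.+1%:R) < 3.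
    by rewrite ltNge; apply: contra s3 => h; apply/eqP; exact: step_ge3.
  have JE : J%:R = m%:R * L4%:R :> R by rewrite /J natrM.
  have xc : x - c i = (m%:R * x + (J%:R - i%:R)) / m%:R.
    by rewrite /c JE; field; rewrite gt_eqF.
  apply: Hm.
    rewrite /c ler_norml; have i0 : 0 <= i%:R / m%:R :> R by rewrite divr_ge0.
    have : i%:R / m%:R <= 2 * L4%:R :> R.
      rewrite ler_pdivrMr// mulrAC -mulrA -JE (_ : 2 * J%:R = (J.*2)%:R); last by rewrite -mul2n natrM.
      by rewrite ler_nat ltnW.
    by move: i0; lra.
  rewrite xc normrM normfV !gtr0_norm// ler_pM2r ?invr_gt0//.
  by move: h2; rewrite -addn1 natrD; lra.
have gap (Q : probability R R) : `|Ex Q f - Ex Q phi| <= eta + M1 * Ex Q tau.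
  rewrite -ExB//; have fpQ : all_moments Q (fun x => f x - phi x) by exact: all_momentsB.
  rewrite (le_trans (le_normr_Rintegral _ _))//; first exact: all_moments_int.
  have cQ := all_moments_cst Q eta; have tQ := all_momentsZ M1 (tauP Q).
  have -> : eta + M1 * Ex Q tau = Ex Q (fun x => eta + M1 * tau x).
    by rewrite (ExD cQ tQ) ExZ// Ex_cst.
  apply: le_Ex => //; first exact: all_moments_norm.
  exact: all_momentsD.
have tauN : M1 * Ex N tau <= eta.
  have x2 : all_moments N (fun x => (L%:R + 1) ^- 2 * x ^+ 2).
    by apply: all_momentsZ; exact: all_momentsX.
  have L1 : 0 < (L%:R + 1) ^+ 2 :> R by rewrite exprn_gt0// ltr_wpDl.
  have : Ex N tau <= (L%:R + 1) ^- 2 * V.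
    rewrite /V -ExZ; last exact: all_momentsX.
    apply: le_Ex => // x.
    rewrite mulrC ler_pdivlMr//.
    have [xL|xL] := leP `|x| (L%:R + 1).
      have JE : J%:R = m%:R * L4%:R :> R by rewrite /J natrM.
      move: xL; rewrite ler_norml => /andP[x1 x2'].
      have m1 : 1 <= m%:R :> R by rewrite ler1n.
      have L4E : L4%:R = L%:R + 4 :> R by rewrite /L4 natrD.
      have -> : tau x = 0.
        rewrite /tau /s /test_fun step_ge3 ?step_le0.
        - by rewrite subr0 subrr.
        - by rewrite -mul2n natrM JE L4E; nra.
        - by rewrite JE L4E; nra.
      by rewrite mul0r sqr_ge0.
    apply: (@le_trans _ _ ((L%:R + 1) ^+ 2)).
      rewrite ger_pMl// /tau /s /test_fun.
      have := @smono; have := @step_ge0 R; rewrite /s /test_fun => g0 _.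
      have := tel x J.*2; have : 0 <= \sum_(i < J.*2) (s i x - s i.+1 x).
        by rewrite sumr_ge0// => i _; rewrite subr_ge0.
      by rewrite tel /s /test_fun; lra.
    have L10 : 0 <= L%:R + 1 :> R by rewrite addr_ge0.
    by rewrite -(real_normK (num_real x)) lerXn2r ?nnegrE// ltW.
  move=> h; rewrite (le_trans (ler_wpM2l (ltW M10) h))// mulrCA mulrC ler_pdivrMr// mulrC.
  by rewrite mulrC (mulrC M1).
have diff i : `|Ex P (s i) - Ex N (s i)| <= d by exact: HP.
have dE : d * ((J.*2)%:R * M1 * 2 + 2 * M1 + 1) = eta by rewrite /d divfK// gt_eqF.
have tauPb : M1 * Ex P tau <= M1 * Ex N tau + M1 * 2 * d.
  rewrite -mulrA -mulrDr ler_wpM2l ?(ltW M10)// /tau.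
  have c1 (Q : probability R R) := all_moments_cst Q (1 : R).
  have ss (Q : probability R R) := all_momentsB (sP Q 0%N) (sP Q J.*2).
  rewrite !(ExB (c1 _) (ss _)) !(ExB (sP _ _) (sP _ _)) !Ex_cst.
  by have := diff 0%N; have := diff J.*2; move=> /ler_normlP[? ?] /ler_normlP[? ?]; lra.
have phib : `|Ex P phi - Ex N phi| <= (J.*2)%:R * M1 * 2 * d.
  have E (Q : probability R R) : Ex Q phi = \sum_(i < J.*2) f (c i) * (Ex Q (s i) - Ex Q (s i.+1)).
    rewrite Ex_sum => [|i _]; last by apply: all_momentsZ; exact: all_momentsB.
    by apply: eq_bigr => i _; rewrite ExZ ?ExB//; exact: all_momentsB.
  rewrite !E -sumrB (le_trans (ler_norm_sum _ _ _))//.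
  rewrite (_ : _ * d = \sum_(i < J.*2) M1 * 2 * d); last first.
    by rewrite sumr_const card_ord -[RHS]mulr_natl; ring.
  apply: ler_sum => i _.
  rewrite -mulrBr normrM -mulrA ler_pM//; first by rewrite (le_trans (fM _))// /M1; lra.
  by have := diff i; have := diff i.+1; move=> /ler_normlP[? ?] /ler_normlP[? ?]; apply/ler_normlP; split; lra.
have gP := gap P; have gN := gap N.
have d0 : 0 <= d by rewrite ltW// divr_gt0.
have fin : (J.*2)%:R * M1 * 2 * d + M1 * 2 * d <= eta by rewrite -dE; lra.
have e8 : e = 8 * eta by rewrite /eta mulrC divfK.
rewrite (_ : Ex P f - Ex N f = (Ex P f - Ex P phi) + (Ex P phi - Ex N phi) - (Ex N f - Ex N phi)); last by ring.
rewrite (le_trans (ler_normB _ _))// (le_trans (lerD (ler_normD _ _) (lexx _)))//.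
move: gP gN phib tauN tauPb fin e8; move: (M1 * 2 * d) (_ * M1 * 2 * d) => u v; lra.
Qed.

End weak_convergence.

(* Otherwise a sequence of laws [P] with [b] tending to 0 would converge weakly to
   [N] and stay at distance [eps] from it. *)
Lemma rho_control {R : realType} (rho : probability R R -> probability R R -> R)
    (N : probability R R) (C : nat -> R) (eps : R) :
  metrizes_weak_convergence rho -> all_moments N id -> 0 < eps ->
  exists2 d : R, 0 < d & forall (P : probability R R) b, 0 <= b ->
    (forall m J i, `|Ex P (test_fun m J i) - Ex N (test_fun m J i)| <= C m * b) ->
    b < d -> rho P N < eps.
Proof.
move=> [_ _ _ _ rho_wc] mN eps0; apply: contrapT => nod.
have bad (k : nat) : exists Pb : probability R R * R, [/\ 0 <= Pb.2, Pb.2 < k.+1%:R^-1,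
    forall m J i, `|Ex Pb.1 (test_fun m J i) - Ex N (test_fun m J i)| <= C m * Pb.2 &
    eps <= rho Pb.1 N].
  apply: contrapT => nok; apply: nod => //; exists (k.+1%:R^-1); first by rewrite invr_gt0.
  move=> P b b0 HP bd; rewrite ltNge; apply/negP => rP; apply: nok.
  by exists (P, b).
have [Pb HPb] := choice bad.
have : weakly_converges (fun k => (Pb k).1) N.
  move=> f cf [M fM].
  have fQ (Q : probability R R) : all_moments Q f.
    by apply: (@bounded_all_moments _ _ _ _ _ M) => //; exact: continuous_measurable_fun.
  rewrite (ExE (fQ N)); under eq_fun do rewrite (ExE (fQ _)).
  apply: cvg_EFin; first by near=> k.
  apply/cvgrPdist_le => /= e e0.
  have [m [J [d [d0 Hd]]]] := test_fun_determining mN cf fM e0.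
  near=> k; rewrite distrC; apply: Hd => i.
  have [b0 bk Hb _] := HPb k.
  rewrite (le_trans (Hb m J i))//.
  apply: (@le_trans _ _ ((`|C m| + 1) * k.+1%:R^-1)).
    rewrite (@le_trans _ _ ((`|C m| + 1) * (Pb k).2))// ?ler_wpM2r// ?ler_wpM2l ?ltW ?addr_ge0//.
    by rewrite (le_lt_trans (ler_norm _))// ltrDl.
  rewrite ler_pdivrMr// -ler_pdivrMl//.
  rewrite (@le_trans _ _ k%:R)//; last by rewrite ler_nat.
  by near: k; exact: nbhs_infty_ger.
move/rho_wc => /cvgrPdist_lt/(_ eps eps0)[n _ /(_ n (leqnn n))] /=.
have [_ _ _ epsn] := HPb n.
by rewrite sub0r normrN => /(le_lt_trans (ler_norm _)); rewrite ltNge epsn.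
Unshelve. all: by end_near. Qed.

(** * Expectations under the bootstrap law *)

Section bootstrap_expectation.
Context {R : realType} (V : Type) (n : nat).
Variables (T : ('I_n -> V) -> R) (x : 'I_n -> V).

Lemma ge0_integral_bootstrap_law (f : R -> R) : measurable_fun setT f -> (forall t, 0 <= f t) ->
  (\int[bootstrap_law T x]_t (f t)%:E =
   (#|{ffun 'I_n -> 'I_n}|%:R^-1 * \sum_(J : {ffun 'I_n -> 'I_n}) f (bootstrap_error T x J))%:E)%E.
Proof.
move=> mf f0.
have mEf : measurable_fun setT (EFin \o f) by exact/measurable_EFinP.
pose J0 : {ffun 'I_n -> 'I_n} := [ffun i => i].
pose m (k : nat) : {measure set R -> \bar R} :=
  dirac (bootstrap_error T x (nth J0 (enum {: {ffun 'I_n -> 'I_n}}) k)).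
have c_ge0 : 0 <= #|{ffun 'I_n -> 'I_n}|%:R^-1 :> R by rewrite invr_ge0.
pose c := NngNum c_ge0.
rewrite (@eq_measure_integral _ _ _ setT (mscale c (msum m #|{ffun 'I_n -> 'I_n}|))); last first.
  move=> A _ _; apply: etrans; first reflexivity.
  rewrite /bootstrap_law /mscale /=; congr (_ * _)%E.
  rewrite /msum (big_enum_val (A := predT)) /=.
  by apply: eq_bigr => i _; rewrite /m/= (enum_val_nth J0).
rewrite ge0_integral_mscale//; last by move=> t _; rewrite lee_fin.
rewrite ge0_integral_measure_sum//; last by move=> t _; rewrite lee_fin.
rewrite EFinM; congr (_ * _)%E; rewrite -sumEFin [RHS](big_enum_val (A := predT)) /=.
apply: eq_bigr => i _; rewrite integral_dirac// diracT mul1e.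
by rewrite (enum_val_nth J0).
Qed.

Lemma bootstrap_law_Ex (f : R -> R) (M : R) : measurable_fun setT f -> (forall t, `|f t| <= M) ->
  Ex (bootstrap_law T x) f =
   #|{ffun 'I_n -> 'I_n}|%:R^-1 * \sum_(J : {ffun 'I_n -> 'I_n}) f (bootstrap_error T x J).
Proof.
move=> mf fM.
have mfM : all_moments (bootstrap_law T x) f by exact: bounded_all_moments fM.
have cM := all_moments_cst (bootstrap_law T x) M.
(* Adding the bound [M] makes the integrand nonnegative, as the preceding formula requires. *)
have E : Ex (bootstrap_law T x) (fun t => f t + M) =
   #|{ffun 'I_n -> 'I_n}|%:R^-1 * \sum_(J : {ffun 'I_n -> 'I_n}) (f (bootstrap_error T x J) + M).
  rewrite /Rintegral ge0_integral_bootstrap_law//; first by exact: measurable_funD.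
  by move=> t; have /ler_normlP[] := fM t; lra.
move: E; rewrite (ExD mfM cM) Ex_cst big_split/= sumr_const mulrDr.
rewrite -[M *+ _]mulr_natl mulrA mulVf ?mul1r; first exact: addIr.
rewrite pnatr_eq0 -lt0n; apply/card_gt0P; by exists [ffun i => i].
Qed.

End bootstrap_expectation.

(** * Lindeberg's method for resampled means *)

Section lindeberg.
Context {R : realType}.
Local Notation G := (@gauss01 R).

Lemma draws_recl n k (F : {ffun 'I_k.+1 -> 'I_n} -> R) :
  \sum_J F J = \sum_(i < n) \sum_(J : {ffun 'I_k -> 'I_n})
    F [ffun j => if unlift ord0 j is Some j' then J j' else i].
Proof.
rewrite pair_bigA/=.
pose h (p : 'I_n * {ffun 'I_k -> 'I_n}) : {ffun 'I_k.+1 -> 'I_n} :=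
  [ffun j => if unlift ord0 j is Some j' then p.2 j' else p.1].
pose g (J : {ffun 'I_k.+1 -> 'I_n}) : 'I_n * {ffun 'I_k -> 'I_n} :=
  (J ord0, [ffun j => J (lift ord0 j)]).
rewrite (reindex h)//; exists g => [[i J]|J] _; rewrite /g /h.
  congr (_, _); first by rewrite ffunE unlift_none.
  by apply/ffunP => j; rewrite !ffunE liftK.
apply/ffunP => j; rewrite !ffunE; case: unliftP => [j' ->|->] //=.
by rewrite ffunE.
Qed.

Variables (n : nat) (psi : 'I_n -> R).

(** Expectation of [f] at [x] shifted by the sum of [k] independent uniform draws from the values of
    [psi]. *)
Definition draw_mean k (f : R -> R) (x : R) : R :=
  (n%:R ^+ k)^-1 * \sum_(J : {ffun 'I_k -> 'I_n}) f (x + \sum_j psi (J j)).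

Lemma draw_mean0 f x : draw_mean 0 f x = f x.
Proof.
rewrite /draw_mean expr0 invr1 mul1r (eq_bigr (fun=> f x)) => [|J _]; last first.
  by rewrite big_ord0 addr0.
by rewrite sumr_const card_ffun !card_ord expn0.
Qed.

Lemma draw_meanS k f x :
  draw_mean k.+1 f x = n%:R^-1 * \sum_(i < n) draw_mean k f (x + psi i).
Proof.
rewrite /draw_mean draws_recl exprS invfM -mulrA; congr (_ * _).
rewrite mulr_sumr; apply: eq_bigr => i _; congr (_ * _); apply: eq_bigr => J _.
rewrite big_ord_recl ffunE unlift_none addrA; congr (f (_ + _)).
by apply: eq_bigr => j _; rewrite ffunE liftK.
Qed.

Variable s : R.

(** The heat semigroup after [k] steps of variance [s ^+ 2], the [k] Gaussian increments being
    merged into one. *)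
Definition heat k (f : R -> R) (x : R) : R := Ex G (fun z => f (x + Num.sqrt k%:R * s * z)).

Definition tame (M : R) (f : R -> R) := continuous f /\ forall x, `|f x| <= M.

Lemma tame_moments M f (a b : R) : tame M f -> all_moments G (fun z => f (a + b * z)).
Proof.
move=> [cf fM]; apply: (@bounded_all_moments _ _ _ _ _ M) => //.
apply: (measurableT_comp (continuous_measurable_fun cf)).
apply: measurable_funD; first exact: measurable_cst.
by apply: measurable_funM; [exact: measurable_cst|exact: measurable_id].
Qed.

Lemma heat0 f x : heat 0 f x = f x.
Proof.
rewrite /heat sqrtr0 mul0r; under eq_Rintegral do rewrite mul0r addr0.
exact: Ex_cst.
Qed.

(** The semigroup law. By [gauss01_stable], a standard normal variable scaled by [sqrt (k + 1)] has
    the law of one scaled by [sqrt k] plus an independent one; Fubini integrates out the latter. *)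
Lemma heatS M k f x : tame M f -> tame M (heat 1 f) -> heat k.+1 f x = heat k (heat 1 f) x.
Proof.
move=> tf tPf; have [cf fM] := tf.
pose q : R := Num.sqrt k.+1%:R.
have q0 : 0 < q by rewrite sqrtr_gt0 ltr0n.
(* [t] is negative because [gauss01_stable] is stated for a difference. *)
pose c := Num.sqrt k%:R / q; pose t := - (1 / q).
have ct : c ^+ 2 + t ^+ 2 = 1.
  rewrite /c /t sqrrN !expr_div_n expr1n !sqr_sqrtr ?ler0n// -mulrDl.
  by rewrite -addn1 natrD divff// -natr1 natr1 pnatr_eq0.
pose F (z : R) := f (x + q * s * z).
have mF : measurable_fun setT F by apply: all_moments_meas (tame_moments _ _ tf).
pose phi (z : R * R) := c * z.1 - t * z.2.
have mphi : measurable_fun setT phi.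
  apply: measurable_funB; apply: measurable_funM; try exact: measurable_cst.
    exact: measurable_fst.
  exact: measurable_snd.
pose H (z : R * R) := f (x + Num.sqrt k%:R * s * z.1 + s * z.2).
have FH z : F (phi z) = H z.
  rewrite /F /phi /H /c /t; congr f; field; exact: lt0r_neq0.
have E1 : heat k.+1 f x = Ex (G \x G)%E H.
  have -> : H = F \o phi by apply/funext => z; rewrite -FH.
  apply: (transfer_Ex (P := (G \x G)%E) (Q := G) (phi := phi)) => //.
    by move=> A mA; exact: gauss01_stable.
  apply: (@bounded_all_moments _ _ _ _ _ M); first exact: measurableT_comp.
  by move=> z; exact: fM.
have mH : all_moments (G \x G)%E H.
  have -> : H = F \o phi by apply/funext => z; rewrite -FH.
  apply: (@bounded_all_moments _ _ _ _ _ M) => //; first exact: measurableT_comp.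
  by move=> z; exact: fM.
rewrite E1 /Rintegral -integral12_prod_meas1; last exact: all_moments_int.
congr fine; apply: eq_integral => z _; rewrite /fubini_F /H /=.
rewrite (ExE (tame_moments (x + Num.sqrt k%:R * s * z) s tf)); congr (_%:E).
rewrite /heat; apply: eq_Rintegral => u _; by rewrite sqrtr1 mul1r.
Qed.

Lemma heat_draw M k f x : tame M f ->
  n%:R^-1 * \sum_(i < n) heat k f (x + psi i) =
  heat k (fun y => n%:R^-1 * \sum_(i < n) f (y + psi i)) x.
Proof.
move=> tf; rewrite /heat ExZ; last first.
  apply: all_moments_sum => i _.
  under eq_fun do rewrite addrAC; exact: tame_moments tf.
rewrite Ex_sum => [|i _]; last by under eq_fun do rewrite addrAC; exact: tame_moments tf.
congr (_ * _); apply: eq_bigr => i _; apply: eq_Rintegral => z _.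
by rewrite addrAC.
Qed.

Lemma lipschitz_tame M K (f : R -> R) : (forall x y, `|f (x + y) - f x| <= K * `|y|) ->
  (forall x, `|f x| <= M) -> tame M f.
Proof. by move=> /lipschitz_continuous. Qed.

Lemma heat_lipschitz M K f k : (forall x y, `|f (x + y) - f x| <= K * `|y|) ->
  (forall x, `|f x| <= M) ->
  (forall x y, `|heat k f (x + y) - heat k f x| <= K * `|y|) /\ (forall x, `|heat k f x| <= M).
Proof.
move=> lf fM; have tf := lipschitz_tame lf fM; split=> [x y|x].
  have mf u := tame_moments u (Num.sqrt k%:R * s) tf.
  rewrite /heat -(ExB (mf _) (mf _)).
  rewrite (le_trans (le_normr_Rintegral _ _))//; first exact: all_moments_int (all_momentsB (mf _) (mf _)).
  rewrite -[leRHS](Ex_cst G); apply: le_Ex; first exact: all_moments_norm (all_momentsB (mf _) (mf _)).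
    exact: all_moments_cst.
  by move=> z; rewrite addrAC.
have mf := tame_moments x (Num.sqrt k%:R * s) tf.
rewrite (le_trans (le_normr_Rintegral _ _))//; first exact: all_moments_int.
rewrite -[leRHS](Ex_cst G); apply: le_Ex => //; first exact: all_moments_norm.
exact: all_moments_cst.
Qed.

Definition gauss01_abs3 : R := Ex G (fun z => `|z| ^+ 3).

Hypothesis n_gt0 : (0 < n)%N.
Hypothesis psi0 : \sum_i psi i = 0.
Hypothesis s0 : 0 <= s.

(** The cost of replacing one draw by a Gaussian increment: the mismatch of variances and the third
    absolute moments of both. *)
Definition lindeberg_error : R :=
  `|n%:R^-1 * (\sum_i psi i ^+ 2) - s ^+ 2| + n%:R^-1 * (\sum_i `|psi i| ^+ 3) + s ^+ 3 * gauss01_abs3.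

(** Both means are expanded to second order at [x]. The linear terms vanish since draws and
    increments are centered, the quadratic ones leave the mismatch of variances, and the cubes bound
    the remainders. *)
Lemma one_step L f x : smooth3 L f ->
  `|n%:R^-1 * \sum_(i < n) f (x + psi i) - heat 1 f x| <= L * lindeberg_error.
Proof.
move=> sf; have [fL /(_ x) [a [b [aL bL ab]]]] := sf.
have L0 : 0 <= L by rewrite (le_trans _ (fL 0)).
have nR : 0 < n%:R :> R by rewrite ltr0n.
have tf := lipschitz_tame (smooth3_lipschitz sf) fL.
have A : `|n%:R^-1 * \sum_(i < n) f (x + psi i) - (f x + b * (n%:R^-1 * \sum_i psi i ^+ 2))|
    <= L * (n%:R^-1 * \sum_i `|psi i| ^+ 3).
  have -> : f x + b * (n%:R^-1 * \sum_i psi i ^+ 2) =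
      n%:R^-1 * \sum_i (f x + a * psi i + b * psi i ^+ 2).
    rewrite !big_split/= sumr_const card_ord -!mulr_sumr psi0 mulr0 addr0 mulrDr.
    by rewrite -[f x *+ n]mulr_natl mulKf ?gt_eqF//; ring.
  rewrite -mulrBr -sumrB normrM ger0_norm ?invr_ge0// mulrCA ler_wpM2l ?invr_ge0//.
  by rewrite mulr_sumr (le_trans (ler_norm_sum _ _ _))// ler_sum.
have B : `|heat 1 f x - (f x + b * s ^+ 2)| <= L * (s ^+ 3 * gauss01_abs3).
  have mz : all_moments G (fun z => z) by exact: gauss01_moments.
  have mz2 : all_moments G (fun z => z ^+ 2) by exact: all_momentsX.
  have mz3 : all_moments G (fun z => `|z| ^+ 3) by apply: all_momentsX; exact: all_moments_norm.
  have cx := all_moments_cst G (f x).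
  have m1 := all_momentsZ (a * s) mz. have m2 := all_momentsZ (b * s ^+ 2) mz2.
  have -> : f x + b * s ^+ 2 = Ex G (fun z => f x + a * s * z + b * s ^+ 2 * z ^+ 2).
    rewrite (ExD (all_momentsD cx m1) m2) (ExD cx m1) !ExZ// gauss01_m2 Ex_cst.
    by have := @gauss01_odd R 1 isT; rewrite /= => ->; ring.
  have mf := tame_moments x (Num.sqrt 1%:R * s) tf.
  rewrite /heat -(ExB mf (all_momentsD (all_momentsD cx m1) m2)).
  rewrite (le_trans (le_normr_Rintegral _ _))//; first exact: all_moments_int (all_momentsB mf (all_momentsD (all_momentsD cx m1) m2)).
  rewrite /gauss01_abs3 mulrA -ExZ//; apply: le_Ex.
  - exact: all_moments_norm (all_momentsB mf (all_momentsD (all_momentsD cx m1) m2)).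
  - exact: all_momentsZ.
  move=> z; have := ab (s * z); rewrite sqrtr1 mul1r normrM (ger0_norm s0).
  by rewrite !exprMn !mulrA.
rewrite /lindeberg_error.
set u := n%:R^-1 * \sum_i f _; set v := n%:R^-1 * \sum_i psi i ^+ 2 in A *.
have C : `|b * (v - s ^+ 2)| <= L * `|v - s ^+ 2| by rewrite normrM ler_wpM2r.
have -> : u - heat 1 f x = (u - (f x + b * v)) - (heat 1 f x - (f x + b * s ^+ 2)) + b * (v - s ^+ 2) by ring.
rewrite (le_trans (ler_normD _ _))// (le_trans (lerD (ler_normB _ _) (lexx _)))//.
move: A B C; lra.
Qed.

(* Averaging and [heat] commute, so the [k] one-step errors just add up. *)
Lemma lindeberg L f k x : smooth3 L f ->
  `|draw_mean k f x - heat k f x| <= k%:R * (L * lindeberg_error).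
Proof.
move=> sf; have [fL _] := sf.
have nR : 0 < n%:R :> R by rewrite ltr0n.
have lf := smooth3_lipschitz sf; have tf := lipschitz_tame lf fL.
have [lPf fPL] := heat_lipschitz 1 lf fL; have tPf := lipschitz_tame lPf fPL.
elim: k x => [|k IH] x; first by rewrite draw_mean0 heat0 subrr normr0 mul0r.
pose Tf y := n%:R^-1 * \sum_(i < n) f (y + psi i).
have avg_le (g : 'I_n -> R) e : (forall i, `|g i| <= e) -> `|n%:R^-1 * \sum_i g i| <= e.
  move=> ge; rewrite normrM ger0_norm ?invr_ge0// ler_pdivrMl// (le_trans (ler_norm_sum _ _ _))//.
  rewrite (le_trans (ler_sum _ (fun i _ => ge i)))// sumr_const card_ord mulr_natl//.
have A : `|draw_mean k.+1 f x - n%:R^-1 * \sum_(i < n) heat k f (x + psi i)| <= k%:R * (L * lindeberg_error).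
  by rewrite draw_meanS -mulrBr -sumrB; apply: avg_le.
have tTf : tame L Tf.
  apply: (@lipschitz_tame L (3 * L)) => [u v|u]; last exact: avg_le.
  rewrite /Tf -mulrBr -sumrB; apply: avg_le => i; rewrite addrAC; exact: lf.
have B : `|heat k Tf x - heat k (heat 1 f) x| <= L * lindeberg_error.
  have mT := tame_moments x (Num.sqrt k%:R * s) tTf.
  have mP := tame_moments x (Num.sqrt k%:R * s) tPf.
  rewrite /heat -(ExB mT mP).
  rewrite (le_trans (le_normr_Rintegral _ _))//; first exact: all_moments_int (all_momentsB mT mP).
  rewrite -[leRHS](Ex_cst G); apply: le_Ex; first exact: all_moments_norm (all_momentsB mT mP).
    exact: all_moments_cst.
  by move=> z; exact: one_step.
move: A; rewrite (heat_draw _ _ tf) (heatS _ _ tf tPf) => A.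
have -> : draw_mean k.+1 f x - heat k (heat 1 f) x =
  (draw_mean k.+1 f x - heat k Tf x) + (heat k Tf x - heat k (heat 1 f) x) by ring.
rewrite (le_trans (ler_normD _ _))// [k.+1%:R]mulrS mulrDl mul1r addrC lerD//.
Qed.

End lindeberg.

(** * Centered normal laws on the line *)

Section centered_normal.
Context {R : realType}.
Local Notation leb := (@lebesgue_measure R).

Lemma integral_scale (c : R) (f : R -> \bar R) : 0 < c -> measurable_fun setT f ->
  (forall x, 0 <= f x)%E -> (\int[leb]_x f x = c%:E * \int[leb]_x f (c * x)%R)%E.
Proof.
move=> c0 mf f0.
have mscal : measurable_fun setT (fun x : R => c * x : measurableTypeR R).
  by apply: measurable_funM => //.
pose k := NngNum (ltW c0).
have U (A : set R) : measurable A ->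
    mscale k (pushforward leb (fun x : R => c * x : measurableTypeR R)) A = leb A.
  move=> mA; apply/esym.
  apply: (@lebesgue_measure_unique _ (mscale k (pushforward leb (fun x : R => c * x : measurableTypeR R)))) => //= _ [[u v]] _ <-.
  rewrite /mscale/=; have -> : pushforward leb (fun x : R => c * x : measurableTypeR R) [set` `]u, v]] =
      leb [set` `](u / c), (v / c)]].
    rewrite /pushforward; congr (leb _); apply/seteqP.
    by split => x /=; rewrite !in_itv/= ltr_pdivrMr// ler_pdivlMr// ![x * c]mulrC.
  rewrite !lebesgue_measure_itv/= !lte_fin ltr_pM2r ?invr_gt0//.
  case: ifPn => _; last by rewrite mule0.
  by rewrite -!EFinD -EFinM; congr EFin; field; exact: lt0r_neq0.
rewrite (@eq_measure_integral _ _ _ _ (mscale k (pushforward leb (fun x : R => c * x : measurableTypeR R)))); last first.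
  by move=> A mA _; apply/esym/U.
by rewrite ge0_integral_mscale// ge0_integral_pushforward.
Qed.

(** Variance 0, where the law is a point mass, is treated apart: of the limit variance only
    nonnegativity is established. *)
Lemma normal_law_scale (v : R) (A : set R) : 0 <= v -> measurable A ->
  normal_law 0 v A = gauss01 ((fun z => Num.sqrt v * z) @^-1` A).
Proof.
rewrite le_eqVlt => /predU1P[<-|v0] mA.
  rewrite /normal_law eqxx sqrtr0.
  have [A0|A0] := pselect (A 0).
    rewrite (_ : _ @^-1` A = setT); last by apply/seteqP; split => // x _ /=; rewrite mul0r.
    by rewrite probability_setT /= diracE mem_set.
  rewrite (_ : _ @^-1` A = set0); last by apply/seteqP; split => // x /=; rewrite mul0r.
  by rewrite measure0 /= diracE memNset.
set c := Num.sqrt v; have c0 : 0 < c by rewrite sqrtr_gt0.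
have mscal : measurable_fun setT (fun x : R => c * x) by apply: measurable_funM.
have mcA : measurable ((fun z => c * z) @^-1` A) by rewrite -[X in measurable X]setTI; exact: mscal.
have -> : normal_law 0 v = distribution (normal_prob 0 c) of_measurableTypeR.
  by rewrite /normal_law gt_eqF.
apply: etrans; last exact/esym/(gauss01E mcA).
have mp : measurable_fun setT (fun x => (normal_pdf 0 c x)%:E * (\1_A x)%:E)%E.
  apply: emeasurable_funM; apply/measurable_EFinP; first exact: measurable_normal_pdf.
  exact: measurable_indic.
transitivity (\int[leb]_x ((normal_pdf 0 c x)%:E * (\1_A x)%:E))%E.
  apply: (@etrans _ _ (\int[leb]_(x in A) (normal_pdf 0 c x)%:E)%E) => //.
  rewrite integral_mkcond; apply: eq_integral => x _.
  by rewrite patchE indicE /=; case: ifPn; rewrite ?mule1 ?mule0.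
rewrite (integral_scale c0)//; last by move=> x; rewrite mule_ge0// lee_fin// normal_pdf_ge0.
rewrite -ge0_integralZl//; last 3 first.
- by apply: (measurableT_comp mp).
- by move=> x _; rewrite mule_ge0// lee_fin// normal_pdf_ge0.
- by rewrite lee_fin ltW.
rewrite [RHS]integral_mkcond; apply: eq_integral => x _.
rewrite patchE indicE /= (_ : (c * x \in A) = (x \in (fun z => c * z) @^-1` A)); last first.
  by apply/idP/idP; rewrite !inE.
case: ifPn => _; last by rewrite !mule0.
rewrite mule1 -EFinM; congr EFin.
rewrite normal_pdfs// /pdf01 (@normal_peakE _ c^-1) ?invr_gt0// invrK mulrA; congr (_ * expR (- _)).
by field; exact: lt0r_neq0.
Qed.

Lemma normal_law_moments (v : R) : 0 <= v -> all_moments (normal_law 0 v) id.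
Proof.
move=> v0; have mscal : measurable_fun setT (fun x : R => Num.sqrt v * x) by apply: measurable_funM.
apply/(transfer_moments mscal (fun A mA => normal_law_scale v0 mA)) => //.
exact: all_momentsZ gauss01_moments.
Qed.

Lemma normal_law_Ex (v M : R) f : 0 <= v -> tame M f ->
  Ex (normal_law 0 v) f = Ex gauss01 (fun z => f (0 + Num.sqrt v * z)).
Proof.
move=> v0 tf; have mscal : measurable_fun setT (fun x : R => Num.sqrt v * x) by apply: measurable_funM.
have := tame_moments 0 (Num.sqrt v) tf.
under [X in all_moments _ X]eq_fun do rewrite add0r. move=> mf.
under [RHS]eq_Rintegral do rewrite add0r.
apply: (transfer_Ex mscal (fun A mA => normal_law_scale v0 mA)) => //.
by apply: continuous_measurable_fun; case: tf.
Qed.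

End centered_normal.

(** * Measurability *)

Section sequential_continuity.
Context {R : realType}.

Lemma measurable_floor_eq d (T : measurableType d) (f : T -> R) (z : int) :
  measurable_fun setT f -> measurable [set w | Num.floor (f w) = z].
Proof.
move=> mf; rewrite (_ : [set w | _] = f @^-1` [set` `[z%:~R, (z + 1)%:~R[]).
  by rewrite -[X in measurable X]setTI; apply: mf => //; exact: measurable_itv.
by apply/seteqP; split => w /=; rewrite in_itv/= -floor_eq => /eqP.
Qed.

(* [h \o a] is the limit of the functions obtained by rounding [a] down to a
   multiple of [1 / k]: these take countably many values *)
Lemma measurable_seq_continuous d (T : measurableType d) (I : finType) (a : I -> T -> R)
    (h : (I -> R) -> R) :
  (forall i, measurable_fun setT (a i)) ->
  (forall (u : nat -> I -> R) (v : I -> R),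
    (forall i, u k i @[k --> \oo] --> v i) -> h (u k) @[k --> \oo] --> h v) ->
  measurable_fun setT (fun w => h (a ^~ w)).
Proof.
move=> ma hc.
pose D k w : {ffun I -> int} := [ffun i => Num.floor (k.+1%:R * a i w)].
pose v k (z : {ffun I -> int}) : I -> R := fun i => (z i)%:~R / k.+1%:R.
apply: (@measurable_fun_cvg _ _ _ _ (fun k w => h (v k (D k w)))) => [k|w _].
  move=> _ B mB; rewrite setTI.
  rewrite (_ : _ @^-1` B = \bigcup_(z : {ffun I -> int})
      ([set w | D k w = z] `&` [set w | B (h (v k z))])); last first.
    apply/seteqP; split => w /=; first by move=> Bw; exists (D k w).
    by move=> [z _ [/= <-]].
  apply: countable_bigcupT_measurable; first exact: countableP.
  move=> z; apply: measurableI; last first.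
    have [Bz|Bz] := pselect (B (h (v k z))).
      by rewrite (_ : [set w | _] = setT)//; apply/seteqP; split.
    by rewrite (_ : [set w | _] = set0)//; apply/seteqP; split.
  rewrite (_ : [set w | _] = \bigcap_(i in [set: I]) [set w | Num.floor (k.+1%:R * a i w) = z i]).
    apply: fin_bigcap_measurable => [|i _]; first exact: finite_finset.
    apply: measurable_floor_eq; apply: measurable_funM => //; exact: measurable_cst.
  apply/seteqP; split => w /=; first by move=> <- i _; rewrite /D ffunE.
  by move=> H; apply/ffunP => i; rewrite ffunE; exact: H.
apply: hc => i; apply/cvgrPdist_le => /= e e0; near=> k.
rewrite /v /D ffunE; have := floor_itv (k.+1%:R * a i w); set z := _%:~R; rewrite intrD => /andP[z1 z2].
have k0 : 0 < k.+1%:R :> R by rewrite ltr0n.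
have ek : e^-1 <= k.+1%:R.
  rewrite (@le_trans _ _ k%:R)//; last by rewrite ler_nat.
  by near: k; exact: nbhs_infty_ger.
have -> : a i w - z / k.+1%:R = (k.+1%:R * a i w - z) / k.+1%:R by field; exact: lt0r_neq0.
rewrite ger0_norm; last by rewrite divr_ge0 ?subr_ge0// ltW.
rewrite ler_pdivrMr//; apply: (@le_trans _ _ 1).
  by rewrite lerBlDr addrC ltW.
by rewrite -(ler_pdivrMl _ _ e0) mulr1.
Unshelve. all: by end_near. Qed.

Definition mcvg m n (A : nat -> 'M[R]_(m, n)) (B : 'M[R]_(m, n)) :=
  forall i j, A k i j @[k --> \oo] --> B i j.

Lemma cvg_sumr (I : finType) (u : I -> nat -> R) (l : I -> R) :
  (forall i, u i k @[k --> \oo] --> l i) -> \sum_i u i k @[k --> \oo] --> \sum_i l i.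
Proof. by move=> H; apply: cvg_big => //; exact: add_continuous. Qed.

Lemma mcvg_cst m n (B : 'M[R]_(m, n)) : mcvg (fun=> B) B.
Proof. by move=> i j; exact: cvg_cst. Qed.

Lemma mcvgM m n p (A : nat -> 'M[R]_(m, n)) A' (B : nat -> 'M[R]_(n, p)) B' :
  mcvg A A' -> mcvg B B' -> mcvg (fun k => A k *m B k) (A' *m B').
Proof.
move=> HA HB i j; rewrite mxE; under eq_fun do rewrite mxE.
by apply: cvg_sumr => l; exact: cvgM (HA _ _) (HB _ _).
Qed.

Lemma mcvgB m n (A : nat -> 'M[R]_(m, n)) A' B B' :
  mcvg A A' -> mcvg B B' -> mcvg (fun k => A k - B k) (A' - B').
Proof.
move=> HA HB i j; rewrite !mxE; under eq_fun do rewrite !mxE.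
exact: cvgB (HA _ _) (HB _ _).
Qed.

Lemma mcvgZ m n c (A : nat -> 'M[R]_(m, n)) A' :
  mcvg A A' -> mcvg (fun k => c *: A k) (c *: A').
Proof.
move=> HA i j; rewrite !mxE; under eq_fun do rewrite !mxE.
exact: cvgMl_tmp (HA _ _).
Qed.

Lemma mcvgT m n (A : nat -> 'M[R]_(m, n)) A' :
  mcvg A A' -> mcvg (fun k => (A k)^T) A'^T.
Proof. by move=> HA i j; rewrite !mxE; under eq_fun do rewrite !mxE; exact: HA. Qed.

Lemma mcvg_sum (I : finType) m n (A : I -> nat -> 'M[R]_(m, n)) A' :
  (forall i, mcvg (A i) (A' i)) -> mcvg (fun k => \sum_i A i k) (\sum_i A' i).
Proof.
move=> HA i j; rewrite summxE; under eq_fun do rewrite summxE.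
by apply: cvg_sumr => l; exact: HA.
Qed.

Lemma mcvg_tr n (A : nat -> 'M[R]_n) A' : mcvg A A' -> \tr (A k) @[k --> \oo] --> \tr A'.
Proof. by move=> HA; apply: cvg_sumr => i; exact: HA. Qed.

(** [tr_sqrt_cont] in both directions, with [t] so small that its linear term stays below [e / 2];
    the limit may be singular. *)
Lemma tr_sqrtmx_cvg n (A : nat -> 'M[R]_n) A' :
  (forall k, covariance_matrix (A k)) -> covariance_matrix A' -> mcvg A A' ->
  \tr (sqrtmx (A k)) @[k --> \oo] --> \tr (sqrtmx A').
Proof.
move=> Ac Ac' AA'.
have N0 : nrm2 (A k - A') @[k --> \oo] --> (0 : R).
  have H : mcvg (fun k => A k - A') 0 by rewrite -(subrr A'); apply: mcvgB => //; exact: mcvg_cst.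
  rewrite -[X in _ --> X](mxtrace0 R n) -(mul0mx n (0 : 'M[R]_n)) -{1}(trmx0 R n n).
  by apply: mcvg_tr; apply: mcvgM => //; exact: mcvgT.
apply/cvgrPdist_le => /= e e0.
pose t := e / (2 * (n%:R + 1)).
have n1 : 0 < n%:R + 1 :> R by rewrite ltr_wpDl.
have t0 : 0 < t by rewrite divr_gt0// mulr_gt0.
have tn : t * n%:R <= e / 2.
  have : t * (2 * (n%:R + 1)) = e by rewrite /t divfK// gt_eqF// mulr_gt0.
  move: t0; lra.
near=> k.
have [sc ss] := sqrtmx_spec (Ac k). have [sc' ss'] := sqrtmx_spec Ac'.
have h1 := tr_sqrt_cont sc sc' t0; have h2 := tr_sqrt_cont sc' sc t0.
have small : nrm2 (A k - A') / t ^+ 3 <= e / 2.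
  rewrite ler_pdivrMr ?exprn_gt0//.
  have : `|0 - nrm2 (A k - A')| <= e / 2 * t ^+ 3.
    near: k; apply: cvgr_dist_le N0 _ _; by rewrite mulr_gt0 ?divr_gt0 ?exprn_gt0.
  by rewrite sub0r normrN => /(le_trans (ler_norm _)).
have E : nrm2 (A' - A k) = nrm2 (A k - A').
  rewrite !nrm2E; apply: eq_bigr => j _; apply: eq_bigr => i _.
  by rewrite -opprB mxE sqrrN.
move: h1 h2; rewrite ss ss' E => h1 h2.
apply/ler_normlP; split; move: small tn h1 h2; lra.
Unshelve. all: by end_near. Qed.

Section sample.
Context (d n : nat).
Variables (x : nat -> 'I_n -> 'cV[R]_d) (y : 'I_n -> 'cV[R]_d).
Hypothesis xy : forall i, mcvg (fun k => x k i) (y i).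

Lemma sample_mean_cvg : mcvg (fun k => sample_mean (x k)) (sample_mean y).
Proof. by apply: mcvgZ; apply: mcvg_sum. Qed.

Lemma sample_cov_cvg : mcvg (fun k => sample_cov (x k)) (sample_cov y).
Proof.
apply: mcvgZ; apply: mcvg_sum => i.
have H : mcvg (fun k => x k i - sample_mean (x k)) (y i - sample_mean y).
  by apply: mcvgB; [exact: xy|exact: sample_mean_cvg].
by apply: mcvgM => //; exact: mcvgT.
Qed.

Lemma GW_cvg (nu : 'cV[R]_d) (Xi : 'M[R]_d) (Q : probability 'cV[R]_d R) :
  covariance_matrix Xi -> Xi \in unitmx -> measure_eq Q (gaussian nu Xi) ->
  GW Q (x k) @[k --> \oo] --> GW Q y.
Proof.
move=> Xc Xu Qg; rewrite (GWE _ Xc Xu Qg); under eq_fun do rewrite (GWE _ Xc Xu Qg).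
apply: cvgD; last exact: cvg_cst.
apply: cvgD.
  apply: cvg_sumr => i.
  have H : mcvg (fun k => sample_mean (x k) - nu) (sample_mean y - nu).
    by apply: mcvgB; [exact: sample_mean_cvg|exact: mcvg_cst].
  by rewrite expr2; under eq_fun do rewrite expr2; exact: cvgM (H _ _) (H _ _).
apply: cvgB; first by apply: mcvg_tr; exact: sample_cov_cvg.
apply: cvgMl_tmp; apply: tr_sqrtmx_cvg => [k||].
- exact: sandwich_psd (sample_cov_psd _).
- exact: sandwich_psd (sample_cov_psd _).
- apply: mcvgM; last exact: mcvg_cst.
  by apply: mcvgM; [exact: mcvg_cst|exact: sample_cov_cvg].
Qed.

End sample.

(** The distance is a sequentially continuous function of the finitely many sample coordinates: each
    bootstrap error converges, hence the bootstrap laws converge weakly, and the triangle inequality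
    transfers this to the distance to [N]. *)
Lemma measurable_rho_bootstrap dO (Omega : measurableType dO) d n
    (X : 'I_n -> Omega -> 'cV[R]_d) (nu : 'cV[R]_d) (Xi : 'M[R]_d)
    (Q : probability 'cV[R]_d R) (N : probability R R)
    (rho : probability R R -> probability R R -> R) :
  (forall i, measurable_fun setT (X i)) ->
  covariance_matrix Xi -> Xi \in unitmx -> measure_eq Q (gaussian nu Xi) ->
  metrizes_weak_convergence rho ->
  measurable_fun setT (fun w => rho (bootstrap_law (GW Q) (fun i => X i w)) N).
Proof.
move=> mX Xc Xu Qg [rho0 _ rhoC rhoT rho_wc].
pose a (p : 'I_n * 'I_d) w := X p.1 w p.2 0.
pose x (u : 'I_n * 'I_d -> R) : 'I_n -> 'cV[R]_d := fun i => \col_j u (i, j).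
pose h u := rho (bootstrap_law (GW Q) (x u)) N.
rewrite (_ : (fun w => _) = (fun w => h (a ^~ w))); last first.
  apply/funext => w; rewrite /h; congr (rho (bootstrap_law _ _) N).
  by apply/funext => i; apply/matrixP => j k; rewrite !mxE (ord1 k).
apply: measurable_seq_continuous => [[i j]|u v uv].
  exact: (measurableT_comp (measurable_entry j 0) (mX i)).
have xc (J : 'I_n -> 'I_n) i : mcvg (fun k => (x (u k) \o J) i) ((x v \o J) i).
  by move=> j z; rewrite mxE; under eq_fun do rewrite mxE; exact: uv.
have ec (J : {ffun 'I_n -> 'I_n}) : bootstrap_error (GW Q) (x (u k)) J @[k --> \oo] -->
    bootstrap_error (GW Q) (x v) J.
  apply: cvgMl_tmp; apply: cvgB.
    exact: (GW_cvg (xc J) Xc Xu Qg).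
  exact: (GW_cvg (xc id) Xc Xu Qg).
rewrite /h; move: (GW Q) ec => T ec.
have /rho_wc rc : weakly_converges (fun k => bootstrap_law T (x (u k))) (bootstrap_law T (x v)).
  move=> f cf [M fM]; have mf := continuous_measurable_fun cf.
  have fQ (P : probability R R) : all_moments P f by apply: bounded_all_moments fM.
  have E z := etrans (ExE (fQ (bootstrap_law T z))) (congr1 EFin (bootstrap_law_Ex T z mf fM)).
  rewrite E; under eq_fun do rewrite E.
  apply: cvg_EFin; first by near=> k.
  apply: cvgMl_tmp; apply: cvg_sumr => J.
  by apply: continuous_cvg; [exact: cf|exact: ec].
apply/cvgrPdist_le => /= e e0.
move/cvgrPdist_le: rc => /(_ e e0); apply: filterS => k.
rewrite sub0r normrN (ger0_norm (rho0 _ _)) => H.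
set P := bootstrap_law _ (x v) in H *; set P' := bootstrap_law _ _ in H *.
have t1 := rhoT P P' N; have t2 := rhoT P' P N.
apply/ler_normlP; split; move: H t1 t2; rewrite (rhoC P P'); lra.
Unshelve. all: by end_near. Qed.

End sequential_continuity.

(** * Averages over resamples and over i.i.d. samples *)

Section averages.
Context {R : realType}.

Definition avg n (a : 'I_n -> R) : R := n%:R^-1 * \sum_i a i.

Lemma avgD n (a b : 'I_n -> R) : avg (fun i => a i + b i) = avg a + avg b.
Proof. by rewrite /avg big_split/= mulrDr. Qed.

Lemma avgZ n c (a : 'I_n -> R) : avg (fun i => c * a i) = c * avg a.
Proof. by rewrite /avg -mulr_sumr mulrCA. Qed.

Lemma avg_cst n c : (0 < n)%N -> avg (fun _ : 'I_n => c) = c.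
Proof.
by move=> n0; rewrite /avg sumr_const card_ord -[c *+ n]mulr_natl mulKf// pnatr_eq0 -lt0n.
Qed.

Lemma le_avg n (a b : 'I_n -> R) : (forall i, a i <= b i) -> avg a <= avg b.
Proof. by move=> ab; rewrite /avg ler_wpM2l ?invr_ge0// ler_sum. Qed.

Lemma avg_ge0 n (a : 'I_n -> R) : (forall i, 0 <= a i) -> 0 <= avg a.
Proof. by move=> a0; rewrite /avg mulr_ge0 ?invr_ge0// sumr_ge0. Qed.

Lemma avg_sum n (I : finType) (a : I -> 'I_n -> R) : avg (fun i => \sum_k a k i) = \sum_k avg (a k).
Proof. by rewrite /avg exchange_big/= mulr_sumr. Qed.

(** Squared mean plus variance: independent draws add up the empirical mean and the empirical
    variance [k] times. *)
Lemma draw_mean_sq n (a : 'I_n -> R) k x : (0 < n)%N ->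
  draw_mean a k (fun y => y ^+ 2) x =
  (x + k%:R * avg a) ^+ 2 + k%:R * (avg (fun i => a i ^+ 2) - avg a ^+ 2).
Proof.
move=> n0; elim: k x => [|k IH] x; first by rewrite draw_mean0 !mul0r !addr0.
rewrite draw_meanS (eq_bigr _ (fun i _ => IH (x + a i))).
rewrite -[LHS]/(avg (fun i => (x + a i + k%:R * avg a) ^+ 2 + k%:R * (avg (fun i => a i ^+ 2) - avg a ^+ 2))).
set m := avg a; set v := avg (fun i => a i ^+ 2).
rewrite (_ : (fun i => _) = (fun i => ((x + k%:R * m) ^+ 2 + k%:R * (v - m ^+ 2)) + (2 * (x + k%:R * m) * a i + a i ^+ 2))); last first.
  by apply/funext => i; ring.
rewrite avgD (avg_cst _ n0) avgD (avgZ _ a) -/v -/m -[k.+1]addn1 natrD; ring.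
Qed.

Lemma resample_mean_sq n (a : 'I_n -> R) : (0 < n)%N ->
  #|{ffun 'I_n -> 'I_n}|%:R^-1 * \sum_(J : {ffun 'I_n -> 'I_n}) avg (a \o J) ^+ 2
  <= avg a ^+ 2 + n%:R^-1 * avg (fun i => a i ^+ 2).
Proof.
move=> n0; have nR : n%:R != 0 :> R by rewrite pnatr_eq0 -lt0n.
have := draw_mean_sq a n 0 n0; rewrite /draw_mean card_ffun !card_ord natrX.
move=> E; rewrite (eq_bigr (fun J : {ffun 'I_n -> 'I_n} => n%:R ^- 2 * (0 + \sum_j a (J j)) ^+ 2)); last first.
  by move=> J _; rewrite add0r /avg exprMn exprVn.
rewrite -mulr_sumr mulrCA E add0r.
have -> : n%:R ^- 2 * ((n%:R * avg a) ^+ 2 + n%:R * (avg (fun i => a i ^+ 2) - avg a ^+ 2)) =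
   avg a ^+ 2 + n%:R^-1 * avg (fun i => a i ^+ 2) - n%:R^-1 * avg a ^+ 2 by field.
by rewrite gerBl mulr_ge0 ?invr_ge0// sqr_ge0.
Qed.

End averages.

Section iid.
Context {R : realType} dO (Omega : measurableType dO) (Pr : probability Omega R).
Context dV (V : measurableType dV) (G : probability V R) (X : nat -> {RV Pr >-> V}).
Hypothesis X_iid : iid_with_law X G.

Lemma iid_law i (A : set V) : measurable A -> G A = Pr (X i @^-1` A).
Proof. by move=> mA; have [_ /(_ i A mA) H] := X_iid; exact/esym/H. Qed.

Lemma iid_moments i f : all_moments G f -> all_moments Pr (fun w => f (X i w)).
Proof.
move=> mf; have [mf' _] := mf.
by apply/(transfer_moments (measurable_funPT (X i)) (iid_law i)).
Qed.

Lemma iid_Ex i f : all_moments G f -> Ex Pr (fun w => f (X i w)) = Ex G f.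
Proof.
move=> mf; have [mf' _] := mf; apply/esym.
apply: (transfer_Ex (measurable_funPT (X i)) (iid_law i)) => //.
exact: iid_moments.
Qed.

(** Serves the squares of averages, where the variables occur in pairs. The joint law is identified
    on rectangles, by independence for the list of the two indices. *)
Lemma iid_pair_law i j (E : set (V * V)) : i != j -> measurable E ->
  (G \x G)%E E = Pr ((fun w => (X i w, X j w)) @^-1` E).
Proof.
move=> ij mE.
have mT : measurable_fun setT (fun w => (X i w, X j w)).
  by apply: measurable_fun_pair; exact: measurable_funPT.
pose T : {mfun Omega >-> (V * V)%type} := HB.pack (fun w => (X i w, X j w)) (isMeasurableFun.Build _ _ _ _ _ mT).
apply: (@product_measure_unique _ _ _ _ _ G G (distribution Pr T)) => // A B mA mB.
have [ind _] := X_iid.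
have := ind [:: i; j] (fun k => if k == i then A else B).
rewrite /= inE ij => /(_ isT).
have H k : measurable (if k == i then A else B) by case: ifP.
move=> /(_ H); rewrite !big_cons !big_nil setIT mule1 eqxx eq_sym (negbTE ij).
by rewrite -!iid_law// => <-.
Qed.

Lemma iid_pair_Ex i j f g : i != j -> all_moments G f -> all_moments G g ->
  Ex Pr (fun w => f (X i w) * g (X j w)) = Ex G f * Ex G g.
Proof.
move=> ij mf mg.
have mT : measurable_fun setT (fun w => (X i w, X j w)).
  by apply: measurable_fun_pair; exact: measurable_funPT.
rewrite -(prod_Ex mf mg); apply/esym.
apply: (transfer_Ex (P := Pr) (Q := (G \x G)%E) (phi := fun w => (X i w, X j w)) mT).
- by move=> E mE; exact: iid_pair_law.
- apply: measurable_funM.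
    by apply: (measurableT_comp _ measurable_fst); case: mf.
  by apply: (measurableT_comp _ measurable_snd); case: mg.
- by apply: all_momentsM; exact: iid_moments.
Qed.

Variable n : nat.

Lemma avg_moments g : all_moments G g -> all_moments Pr (fun w => avg (fun i : 'I_n => g (X i w))).
Proof.
by move=> mg; apply: all_momentsZ; apply: all_moments_sum => i _; exact: iid_moments.
Qed.

Lemma avg_Ex g : (0 < n)%N -> all_moments G g ->
  Ex Pr (fun w => avg (fun i : 'I_n => g (X i w))) = Ex G g.
Proof.
move=> n0 mg; rewrite ExZ; last by apply: all_moments_sum => i _; exact: iid_moments.
rewrite Ex_sum => [|i _]; last exact: iid_moments.
rewrite (eq_bigr (fun=> Ex G g)); last by move=> i _; exact: iid_Ex.
exact: (@avg_cst R n).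
Qed.

Lemma avg_sq_Ex g : (0 < n)%N -> all_moments G g -> Ex G g = 0 ->
  Ex Pr (fun w => avg (fun i : 'I_n => g (X i w)) ^+ 2) = n%:R^-1 * Ex G (fun x => g x ^+ 2).
Proof.
move=> n0 mg g0; have nR : n%:R != 0 :> R by rewrite pnatr_eq0 -lt0n.
have mij i j : all_moments Pr (fun w => g (X i w) * g (X j w)).
  by apply: all_momentsM; exact: iid_moments.
rewrite (_ : (fun w => _) = (fun w => n%:R ^- 2 * \sum_(i < n) \sum_(j < n) g (X i w) * g (X j w))); last first.
  by apply/funext => w; rewrite /avg exprMn exprVn (expr2 (\sum_(i < n) _)) mulr_suml; congr (_ * _); apply: eq_bigr => i _; rewrite mulr_sumr.
rewrite ExZ; last by apply: all_moments_sum => i _; apply: all_moments_sum => j _; exact: mij.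
rewrite Ex_sum => [|i _]; last by apply: all_moments_sum => j _; exact: mij.
rewrite (eq_bigr (fun=> Ex G (fun x => g x ^+ 2))) => [|i _].
  by rewrite sumr_const card_ord -[_ *+ n]mulr_natl; field.
rewrite Ex_sum => [|j _]; last exact: mij.
rewrite (bigD1 i)//= big1 => [|j ji]; last by rewrite iid_pair_Ex// ?g0 ?mul0r// eq_sym.
rewrite addr0 -(iid_Ex i); last exact: all_momentsX.
by apply: eq_Rintegral => w _; rewrite expr2.
Qed.

End iid.

(** * Linearisation of the statistic *)

Section expansion.
Context {R : realType} (d : nat).

Lemma nrm2D p q (X Y : 'M[R]_(p, q)) : nrm2 (X + Y) <= 2 * nrm2 X + 2 * nrm2 Y.
Proof.
rewrite !nrm2E !mulr_sumr -big_split/= ler_sum// => j _.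
rewrite !mulr_sumr -big_split/= ler_sum// => i _; rewrite mxE.
have := sqr_ge0 (X i j - Y i j); lra.
Qed.

Lemma nrm2Z p q c (X : 'M[R]_(p, q)) : nrm2 (c *: X) = c ^+ 2 * nrm2 X.
Proof.
rewrite !nrm2E mulr_sumr; apply: eq_bigr => j _; rewrite mulr_sumr; apply: eq_bigr => i _.
by rewrite mxE exprMn.
Qed.

Lemma nrm2_cV p (y : 'cV[R]_p) : nrm2 y = \sum_i y i 0 ^+ 2.
Proof. by rewrite nrm2E big_ord1. Qed.

Lemma nrm2_outer p (y : 'cV[R]_p) : nrm2 (y *m y^T) = nrm2 y ^+ 2.
Proof.
rewrite nrm2E nrm2_cV expr2 mulr_suml; apply: eq_bigr => j _; rewrite mulr_sumr; apply: eq_bigr => i _.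
by rewrite !mxE big_ord1 mxE exprMn mulrC.
Qed.

Lemma tr_mul_le p (A M : 'M[R]_p) : `|\tr (A *m M)| <= nrm2 A + nrm2 M.
Proof.
rewrite /mxtrace !nrm2E [X in _ <= X + _]exchange_big/= -big_split/=.
rewrite (le_trans (ler_norm_sum _ _ _))// ler_sum// => i _.
rewrite mxE (le_trans (ler_norm_sum _ _ _))// -big_split/= ler_sum// => j _.
by have := sqr_ge0 (A i j - M j i); have := sqr_ge0 (A i j + M j i);
  have := sqr_ge0 (A i j); have := sqr_ge0 (M j i) => *; apply/ler_normlP; split; lra.
Qed.

Lemma quad_form_le p (A : 'M[R]_p) : exists2 C, 0 <= C &
  forall y : 'cV[R]_p, `|\tr (A *m (y *m y^T))| <= C * nrm2 y.
Proof.
exists (\sum_i \sum_j `|A i j|) => [|y].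
  by rewrite sumr_ge0// => i _; rewrite sumr_ge0.
have -> : \tr (A *m (y *m y^T)) = \sum_i \sum_j A i j * (y j 0 * y i 0).
  apply: eq_bigr => i _; rewrite mxE; apply: eq_bigr => j _; congr (_ * _).
  by rewrite mxE big_ord1 mxE.
have yn i : y i 0 ^+ 2 <= nrm2 y.
  rewrite nrm2_cV (bigD1 i)//= lerDl sumr_ge0// => j _; exact: sqr_ge0.
rewrite (le_trans (ler_norm_sum _ _ _))// mulr_suml ler_sum// => i _.
rewrite (le_trans (ler_norm_sum _ _ _))// mulr_suml ler_sum// => j _.
rewrite normrM ler_wpM2l//.
by have := sqr_ge0 (y i 0 - y j 0); have := sqr_ge0 (y i 0 + y j 0); have := yn i; have := yn j;
  move=> *; apply/ler_normlP; split; lra.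
Qed.

Variables (mu nu : 'cV[R]_d) (Sigma Xi : 'M[R]_d) (Q : probability 'cV[R]_d R).
Hypotheses (Sc : covariance_matrix Sigma) (Su : Sigma \in unitmx).
Hypotheses (Xc : covariance_matrix Xi) (Xu : Xi \in unitmx) (Qg : measure_eq Q (gaussian nu Xi)).

(** The influence function of the squared distance at [N(mu, Sigma)], the [phi] of the overview. *)
Definition influence : 'cV[R]_d -> R :=
  quad_fun mu Sigma (2 *: (mu - nu)) (1%:M - transport_mx Sigma Xi).

Definition coord_dev (a : 'I_d) (v : 'cV[R]_d) : R := v a 0 - mu a 0.
Definition cov_dev (a b : 'I_d) (v : 'cV[R]_d) : R := coord_dev a v * coord_dev b v - Sigma a b.

Section sample.
Variables (n : nat) (x : 'I_n -> 'cV[R]_d).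
Hypothesis n2 : (1 < n)%N.

Definition mean_dev : 'cV[R]_d := \col_a avg (coord_dev a \o x).
Definition second_moment_dev : 'M[R]_d := \matrix_(a, b) avg (cov_dev a b \o x).

Let n0 : (0 < n)%N. Proof. exact: ltnW. Qed.
Let nR : n%:R != 0 :> R. Proof. by rewrite pnatr_eq0 -lt0n. Qed.
Let nR1 : n.-1%:R != 0 :> R. Proof. by rewrite pnatr_eq0 -lt0n -subn1 subn_gt0. Qed.
Let nE : n%:R = n.-1%:R + 1 :> R. Proof. by rewrite natr1 prednK. Qed.

Lemma sample_mean_dev : sample_mean x = mu + mean_dev.
Proof.
apply/matrixP => a z; rewrite (ord1 z) !mxE summxE /avg.
rewrite [X in _ = _ + _ * X](eq_bigr (fun i => x i a 0 - mu a 0))// sumrB sumr_const card_ord.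
by rewrite -[_ *+ n]mulr_natl; field.
Qed.

(** Dividing by [n - 1] multiplies the empirical covariance [Sigma + W - m m^t] by
    [1 + 1 / (n - 1)], where [m] and [W] are the deviations of the mean and of the second
    moments. *)
Lemma sample_cov_dev : sample_cov x = Sigma + (second_moment_dev +
  (n.-1%:R^-1 *: (second_moment_dev + Sigma) + (- (1 + n.-1%:R^-1)) *: (mean_dev *m mean_dev^T))).
Proof.
apply/matrixP => a b; rewrite /sample_cov sample_mean_dev !mxE summxE big_ord1 !mxE.
pose u c i := coord_dev c (x i).
rewrite (eq_bigr (fun i => u a i * u b i - avg (u a) * u b i - avg (u b) * u a i + avg (u a) * avg (u b))); last first.
  by move=> i _; rewrite mxE big_ord1 !mxE /u /coord_dev /=; ring.
rewrite big_split/= !sumrB sumr_const card_ord -!mulr_sumr.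
have sumu c : \sum_i u c i = n%:R * avg (u c) by rewrite /avg mulVKf.
have SW : avg (cov_dev a b \o x) = n%:R^-1 * \sum_i u a i * u b i - Sigma a b.
  by rewrite -[in RHS](avg_cst (Sigma a b) n0) /avg -mulrBr -sumrB.
have -> : avg (coord_dev a \o x) = avg (u a) by [].
have -> : avg (coord_dev b \o x) = avg (u b) by [].
rewrite SW !sumu -[avg (u a) * avg (u b) *+ n]mulr_natl.
move: (avg (u a)) (avg (u b)) (\sum_i _) nR; rewrite nE => p q t nR'; field.
by rewrite nR1 nR'.
Qed.

Lemma avg_influence : avg (influence \o x) =
  2 * \sum_a (mu - nu) a 0 * mean_dev a 0 + \tr ((1%:M - transport_mx Sigma Xi) *m second_moment_dev).
Proof.
set A := 1%:M - _.
have AT i j : A i j = A j i.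
  by have : A^T = A by [rewrite /A linearB/= trmx1 transport_mx_tr]; move/matrixP => /(_ j i); rewrite mxE.
have E v : influence v = 2 * \sum_a (mu - nu) a 0 * coord_dev a v +
    \sum_a \sum_b A a b * cov_dev b a v.
  rewrite /influence /quad_fun quad_form_sum -/A -addrA; congr (_ + _).
    by rewrite mxE mulr_sumr; apply: eq_bigr => a _; rewrite !mxE mulrA.
  rewrite /mxtrace -sumrB; apply: eq_bigr => a _; rewrite [(A *m Sigma) a a]mxE -sumrB; apply: eq_bigr => b _.
  by rewrite /cov_dev /coord_dev !mxE; ring.
rewrite (_ : influence \o x = fun i => 2 * (\sum_a (mu - nu) a 0 * coord_dev a (x i)) +
    \sum_a \sum_b A a b * cov_dev b a (x i)); last by apply/funext => i; exact: E.
rewrite avgD avgZ !avg_sum; congr (2 * _ + _).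
  by apply: eq_bigr => a _; rewrite avgZ [mean_dev _ _]mxE.
apply: eq_bigr => a _; rewrite avg_sum mxE; apply: eq_bigr => b _.
by rewrite avgZ [second_moment_dev _ _]mxE.
Qed.

Definition sq_dev : R := nrm2 mean_dev + nrm2 second_moment_dev.

Lemma sq_devE : sq_dev = \sum_a avg (coord_dev a \o x) ^+ 2 +
  \sum_b \sum_a avg (cov_dev a b \o x) ^+ 2.
Proof.
rewrite /sq_dev nrm2_cV nrm2E; congr (_ + _); first by apply: eq_bigr => a _; rewrite mxE.
by apply: eq_bigr => b _; apply: eq_bigr => a _; rewrite mxE.
Qed.

Lemma sq_dev_ge0 : 0 <= sq_dev.
Proof. by rewrite addr_ge0 ?nrm2_ge0. Qed.

End sample.

(** The mean part is exactly quadratic. The covariance part is [bures_expand] at the sample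
    covariance, whose correction [D] enters both the linear term and the remainder. While [sq_dev]
    is at most 1, fourth-order quantities are bounded by second-order ones. [1 <= C] is for
    [min1_le]. *)
Lemma GW_expand : exists2 C : R, 1 <= C & forall n (x : 'I_n -> 'cV[R]_d), (1 < n)%N -> sq_dev x <= 1 ->
  `|GW Q x - (sqnorm (mu - nu) + bures Xi Sigma + \tr Xi) - avg (influence \o x)| <=
  C * (sq_dev x + n%:R^-1).
Proof.
have [C1 C10 H1] := bures_expand Sc Su Xc Xu.
set A := 1%:M - _ in H1.
have [b b0 H2] := quad_form_le A.
pose al := nrm2 A; have al0 : 0 <= al := nrm2_ge0 A.
pose s := nrm2 Sigma; have s0 : 0 <= s := nrm2_ge0 Sigma.
pose N := 2 + 2 * s; have N0 : 0 <= N by rewrite /N; lra.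
have C1N : 0 <= C1 * N by rewrite mulr_ge0.
exists (1 + 16 * C1 + 2 * b + 2 * (4 * (C1 * N) + al + N)) => [|n x n2 e1]; first lra.
have Sp := sample_cov_psd x.
move: e1; rewrite /sq_dev.
have p0 := nrm2_ge0 (mean_dev x); have w0 := nrm2_ge0 (second_moment_dev x).
set p := nrm2 (mean_dev x) in p0 *; set w := nrm2 (second_moment_dev x) in w0 * => e1.
pose q : R := n.-1%:R^-1.
have n1R : 1 <= n.-1%:R :> R by rewrite ler1n -subn1 subn_gt0.
have q0 : 0 <= q by rewrite invr_ge0.
have q1 : q <= 1 by rewrite invf_le1// (lt_le_trans _ n1R).
(* [n - 1] is at least [n / 2] because [n] exceeds 1. *)
have qn : q <= 2 * n%:R^-1.
  have nE : n%:R = n.-1%:R + 1 :> R by rewrite natr1 prednK// ltnW.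
  have qq : q * n.-1%:R = 1 by rewrite mulVf// gt_eqF// (lt_le_trans _ n1R).
  rewrite ler_pdivlMr ?ltr0n ?(ltnW n2)// nE mulrDr qq; lra.
rewrite (GWE _ Xc Xu Qg) avg_influence// sample_mean_dev ?(ltnW n2)//.
have H1' := H1 _ Sp; rewrite -/A.
set D := q *: (second_moment_dev x + Sigma) + (- (1 + q)) *: (mean_dev x *m (mean_dev x)^T).
have SE : sample_cov x - Sigma = second_moment_dev x + D.
  by rewrite sample_cov_dev// addrC addKr.
move: H1'; rewrite SE.
have sqE : sqnorm (mu + mean_dev x - nu) - sqnorm (mu - nu) - 2 * \sum_a (mu - nu) a 0 * mean_dev x a 0 = p.
  rewrite /sqnorm /p nrm2_cV mulr_sumr -!sumrB; apply: eq_bigr => a _; rewrite !mxE; ring.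
have WS : nrm2 (second_moment_dev x + Sigma) <= N.
  by rewrite (le_trans (nrm2D _ _))// -/w -/s /N; lra.
have p2 : p ^+ 2 <= p by rewrite expr2 ler_piMr//; lra.
have q2 : q ^+ 2 <= q by rewrite expr2 ler_piMr.
have hD : nrm2 D <= 2 * (q * N) + 8 * p.
  rewrite (le_trans (nrm2D _ _))// !nrm2Z nrm2_outer -/p.
  have h1 : q ^+ 2 * nrm2 (second_moment_dev x + Sigma) <= q * N.
    by rewrite ler_pM ?sqr_ge0 ?nrm2_ge0.
  have h2 : (- (1 + q)) ^+ 2 * p ^+ 2 <= 4 * p.
    rewrite ler_pM ?sqr_ge0// sqrrN; nra.
  lra.
have hW : nrm2 (second_moment_dev x + D) <= 2 * w + 4 * (q * N) + 16 * p.
  by rewrite (le_trans (nrm2D _ _))// -/w; lra.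
have tAD : `|\tr (A *m D)| <= q * (al + N) + 2 * (b * p).
  rewrite /D mulmxDr -!scalemxAr linearD/= !linearZ/= (le_trans (ler_normD _ _))// lerD//.
    rewrite normrM (ger0_norm q0) ler_wpM2l// (le_trans (tr_mul_le _ _))// lerD//.
  rewrite normrM normrN (@ger0_norm _ (1 + q)); last lra.
  by rewrite ler_pM ?H2//; lra.
rewrite mulmxDr mxtraceD => H1'.
have C1p : C1 * nrm2 (second_moment_dev x + D) <= 2 * (C1 * w) + 4 * (q * (C1 * N)) + 16 * (C1 * p).
  by rewrite (le_trans (ler_wpM2l C10 hW))//; lra.
have -> : sqnorm (mu + mean_dev x - nu) + bures Xi (sample_cov x) + \tr Xi -
   (sqnorm (mu - nu) + bures Xi Sigma + \tr Xi) -
   (2 * (\sum_a (mu - nu) a 0 * mean_dev x a 0) + \tr (A *m second_moment_dev x)) =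
   p + (bures Xi (sample_cov x) - bures Xi Sigma - (\tr (A *m second_moment_dev x) + \tr (A *m D))) + \tr (A *m D).
  by rewrite -sqE; ring.
rewrite (le_trans (ler_normD _ _))// (le_trans (lerD (ler_normD _ _) (lexx _)))//.
rewrite (ger0_norm p0).
apply: (@le_trans _ _ (p + (2 * (C1 * w) + 4 * (q * (C1 * N)) + 16 * (C1 * p)) + (q * (al + N) + 2 * (b * p)))).
  by rewrite lerD// lerD// (le_trans H1').
have K0 : 0 <= 4 * (C1 * N) + al + N by lra.
have qK := ler_wpM2r K0 qn.
have Cw : 0 <= C1 * w by rewrite mulr_ge0.
have Cp : 0 <= C1 * p by rewrite mulr_ge0.
have bw : 0 <= b * w by rewrite mulr_ge0.
have nV : 0 <= n%:R^-1 :> R by rewrite invr_ge0.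
have r1 : 0 <= (1 + 16 * C1 + 2 * b) * n%:R^-1 by rewrite mulr_ge0//; lra.
have r2 : 0 <= 2 * (4 * (C1 * N) + al + N) * (p + w) by rewrite mulr_ge0 ?addr_ge0//; lra.
move: qK r1 r2; set nn := n%:R^-1; set cn := C1 * N; lra.
Qed.

End expansion.

(** * From the linearised statistic to the bootstrap law *)

Section resampling_error.
Context {R : realType}.

Lemma normr_avg_cube n (a : 'I_n -> R) : (0 < n)%N ->
  `|avg a| ^+ 3 <= avg (fun i => `|a i| ^+ 3).
Proof.
move=> n0; pose b i := `|a i|.
have b0 : 0 <= avg b by apply: avg_ge0 => i; exact: normr_ge0.
have ab : `|avg a| <= avg b.
  by rewrite /avg normrM ger0_norm ?invr_ge0// ler_wpM2l ?invr_ge0// ler_norm_sum.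
apply: (@le_trans _ _ (avg b ^+ 3)); first by rewrite lerXn2r ?nnegrE.
(* the tangent line of the cube at [avg b] *)
apply: (@le_trans _ _ (avg (fun i => (3 * avg b ^+ 2) * b i + (- (2 * avg b ^+ 3))))).
  rewrite avgD avgZ (avg_cst _ n0); rewrite le_eqVlt; apply/orP; left; apply/eqP; ring.
apply: le_avg => i; rewrite -/(b i); have bi : 0 <= b i by exact: normr_ge0.
rewrite -subr_ge0 (_ : _ - _ = (b i - avg b) ^+ 2 * (b i + 2 * avg b)); last by ring.
by rewrite mulr_ge0 ?sqr_ge0// addr_ge0// mulr_ge0.
Qed.

Lemma avg_central_cube n (a : 'I_n -> R) : (0 < n)%N ->
  avg (fun i => `|a i - avg a| ^+ 3) <= 8 * avg (fun i => `|a i| ^+ 3).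
Proof.
move=> n0; have h := normr_avg_cube a n0.
apply: (@le_trans _ _ (avg (fun i => 4 * `|a i| ^+ 3 + 4 * `|avg a| ^+ 3))); last first.
  by rewrite avgD avgZ (avg_cst _ n0); lra.
apply: le_avg => i; apply: (@le_trans _ _ ((`|a i| + `|avg a|) ^+ 3)).
  by rewrite lerXn2r ?nnegrE ?addr_ge0// ler_normB.
have p0 := normr_ge0 (a i); have q0 := normr_ge0 (avg a).
set p := `|a i| in p0 *; set q := `|avg a| in q0 *.
rewrite -subr_ge0 (_ : _ - _ = 3 * (p + q) * (p - q) ^+ 2); last by ring.
by rewrite mulr_ge0 ?sqr_ge0// mulr_ge0// addr_ge0.
Qed.

(** Removes the restriction to small deviations in [GW_expand]: [e] and [e'] will be the [sq_dev] of
    the resample and of the sample. *)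
Lemma min1_le n (C D e e' q : R) : 1 <= C -> (0 < n)%N -> 0 <= e -> 0 <= e' -> 0 <= q ->
  (e <= 1 -> e' <= 1 -> `|D| <= C * (e + e' + q)) ->
  Num.min 1 `|Num.sqrt n%:R * D| <= C * (Num.sqrt n%:R * (e + e' + q)).
Proof.
move=> C1 n0 e0 e0' q0 H.
have r1 : 1 <= Num.sqrt n%:R :> R by rewrite -{1}sqrtr1 ler_sqrt ?ltr0n// ler1n.
set r := Num.sqrt _ in r1 *; have r0 : 0 <= r by exact: le_trans r1.
(* if [e > 1] or [e' > 1] then the right-hand side is at least 1 *)
have [e1|e1] := leP e 1; last first.
  rewrite ge_min; apply/orP; left.
  rewrite -[leLHS]mulr1 ler_pM// -[leLHS]mulr1 ler_pM//; lra.
have [e1'|e1'] := leP e' 1; last first.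
  rewrite ge_min; apply/orP; left.
  rewrite -[leLHS]mulr1 ler_pM// -[leLHS]mulr1 ler_pM//; lra.
rewrite ge_min; apply/orP; right.
by rewrite normrM (ger0_norm r0) mulrCA ler_wpM2l// H.
Qed.

(** [lindeberg] with [n] draws from [(phi i - avg phi) / sqrt n] against increments of variance
    [v / n]; the sum of the one-step errors is regrouped into quantities whose expectations are
    easy. *)
Lemma linearized_bootstrap n (phi : 'I_n -> R) (v L : R) (f : R -> R) : (0 < n)%N -> 0 <= v ->
  smooth3 L f ->
  `|#|{ffun 'I_n -> 'I_n}|%:R^-1 *
      \sum_(J : {ffun 'I_n -> 'I_n}) f (Num.sqrt n%:R * (avg (phi \o J) - avg phi))
    - Ex (normal_law 0 v) f| <=
  L * (Num.sqrt n%:R * (avg phi ^+ 2 + avg (fun i => phi i ^+ 2 - v) ^+ 2) +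
    (Num.sqrt n%:R)^-1 * (1 + Num.sqrt v ^+ 3 * @gauss01_abs3 R + 8 * avg (fun i => `|phi i| ^+ 3))).
Proof.
move=> n0 v0 sf; have [fL _] := sf; have L0 : 0 <= L by rewrite (le_trans _ (fL 0)).
have r1 : 1 <= Num.sqrt n%:R :> R by rewrite -{1}sqrtr1 ler_sqrt ?ltr0n// ler1n.
have rn : n%:R = Num.sqrt n%:R * Num.sqrt n%:R :> R by rewrite -expr2 sqr_sqrtr.
set r := Num.sqrt n%:R in r1 rn *; have r0 : 0 < r by exact: lt_le_trans r1.
have rN := lt0r_neq0 r0.
have tf := lipschitz_tame (smooth3_lipschitz sf) fL.
set m := avg phi.
pose psi i := r^-1 * (phi i - m).
have nN : n%:R != 0 :> R by rewrite pnatr_eq0 -lt0n.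
have sumE (a : 'I_n -> R) : \sum_i a i = n%:R * avg a by rewrite /avg mulVKf.
have avgB (a : 'I_n -> R) : avg (fun i => a i - m) = avg a - m.
  by rewrite avgD (avg_cst _ n0).
have psi0 : \sum_i psi i = 0 by rewrite /psi -mulr_sumr sumE avgB subrr !mulr0.
pose s := Num.sqrt v / r.
have s0 : 0 <= s by rewrite divr_ge0 ?sqrtr_ge0// ltW.
have := @lindeberg R n psi s n0 psi0 s0 L f n 0 sf.
have -> : heat s n f 0 = Ex (normal_law 0 v) f.
  rewrite (normal_law_Ex v0 tf) /heat -/r /s; apply: eq_Rintegral => z _.
  by rewrite [r * _]mulrC divfK.
have -> : draw_mean psi n f 0 = #|{ffun 'I_n -> 'I_n}|%:R^-1 *
      \sum_(J : {ffun 'I_n -> 'I_n}) f (r * (avg (phi \o J) - m)).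
  rewrite /draw_mean card_ffun !card_ord natrX; congr (_ * _); apply: eq_bigr => J _; congr f.
  by rewrite add0r -mulr_sumr (sumE (fun j => phi (J j) - m)) avgB rn; field.
move=> /le_trans; apply; rewrite mulrCA ler_wpM2l//.
have A1 : n%:R^-1 * \sum_i psi i ^+ 2 = r^-1 * r^-1 * (avg (fun i => phi i ^+ 2 - v) + v - m ^+ 2).
  rewrite (eq_bigr (fun i => r^-1 * r^-1 * (phi i ^+ 2 - v + (-2 * m * phi i + (m ^+ 2 + v))))); last first.
    by move=> i _; rewrite /psi; ring.
  rewrite -mulr_sumr mulrCA; congr (_ * _).
  rewrite -[LHS]/(avg (fun i => phi i ^+ 2 - v + (-2 * m * phi i + (m ^+ 2 + v)))).
  rewrite (avgD (fun i => phi i ^+ 2 - v)) (avgD (fun i => - 2 * m * phi i)) (avgZ _ phi) (avg_cst _ n0) -/m; ring.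
have A2 : n%:R^-1 * (\sum_i `|psi i| ^+ 3) <= r^-1 ^+ 3 * (8 * avg (fun i => `|phi i| ^+ 3)).
  rewrite (eq_bigr (fun i => r^-1 ^+ 3 * `|phi i - m| ^+ 3)); last first.
    by move=> i _; rewrite /psi normrM exprMn ger0_norm// invr_ge0 ltW.
  rewrite -mulr_sumr mulrCA ler_wpM2l ?exprn_ge0 ?invr_ge0 ?(ltW r0)//.
  exact: avg_central_cube.
rewrite /lindeberg_error A1.
set t := avg (fun i => phi i ^+ 2 - v); set c := avg (fun i => `|phi i| ^+ 3) in A2 *.
have -> : r^-1 * r^-1 * (t + v - m ^+ 2) - s ^+ 2 = r^-1 * r^-1 * (t - m ^+ 2).
  rewrite /s expr_div_n sqr_sqrtr//; field; exact: rN.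
rewrite normrM ger0_norm; last by rewrite mulr_ge0// invr_ge0 ltW.
rewrite rn !mulrDr.
have -> : r * r * (r^-1 * r^-1 * `|t - m ^+ 2|) = `|t - m ^+ 2| by field.
have -> : r * r * (s ^+ 3 * gauss01_abs3) = r^-1 * (Num.sqrt v ^+ 3 * gauss01_abs3) by rewrite /s; field.
have B2 : r * r * (n%:R^-1 * (\sum_i `|psi i| ^+ 3)) <= r^-1 * (8 * c).
  rewrite (le_trans (ler_wpM2l _ A2)) ?mulr_ge0 ?(ltW r0)//.
  by rewrite le_eqVlt; apply/orP; left; apply/eqP; field.
have B1 : `|t - m ^+ 2| <= r * m ^+ 2 + r * t ^+ 2 + r^-1 * 1.
  have h1 : m ^+ 2 <= r * m ^+ 2 by rewrite ler_peMl ?sqr_ge0.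
  (* Trades [|t|] for [t ^+ 2], whose mean over i.i.d. samples can be computed and is of order
     [1 / n]; both terms are then of order [1 / r]. *)
  have h2 : `|t| <= r * t ^+ 2 + r^-1 * 1.
    rewrite -[t ^+ 2](real_normK (num_real t)); have u0 := normr_ge0 t; set u := `|t| in u0 *.
    rewrite -(ler_pM2l r0) mulrDr [r * (r^-1 * 1)]mulrA divff// mul1r mulrA.
    have := sqr_ge0 (r * u - 1); have : 0 <= r * u by rewrite mulr_ge0// ltW.
    rewrite (_ : r * r * u ^+ 2 = (r * u) ^+ 2); [lra|ring].
  by rewrite (le_trans (ler_normB _ _))// [`|m ^+ 2|]ger0_norm ?sqr_ge0//; lra.
rewrite rn in B2; move: B1 B2; lra.
Qed.

End resampling_error.

Section bootstrap_comparison.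
Context {R : realType} (d : nat).
Variables (mu nu : 'cV[R]_d) (Sigma Xi : 'M[R]_d) (Q : probability 'cV[R]_d R).
Hypotheses (Sc : covariance_matrix Sigma) (Su : Sigma \in unitmx).
Hypotheses (Xc : covariance_matrix Xi) (Xu : Xi \in unitmx) (Qg : measure_eq Q (gaussian nu Xi)).
Local Notation phi := (influence mu nu Sigma Xi).
Local Notation y := (coord_dev mu).
Local Notation z := (cov_dev mu Sigma).
Variable v : R.
Hypothesis v0 : 0 <= v.

(** The [b_n] of the overview. Under [N(mu, Sigma)], with [v] the variance of [phi], the squared
    averages are of centered functions and have mean of order [1 / n], while the last average has a
    fixed mean; hence the two powers of [sqrt n]. *)
Definition discrepancy n (x : 'I_n -> 'cV[R]_d) : R :=
  Num.sqrt n%:R * (\sum_a avg (y a \o x) ^+ 2 + \sum_b \sum_a avg (z a b \o x) ^+ 2 +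
    (avg (phi \o x) ^+ 2 + avg ((fun u => phi u ^+ 2 - v) \o x) ^+ 2)) +
  (Num.sqrt n%:R)^-1 * (1 + avg ((fun u => \sum_a y a u ^+ 2 + \sum_b \sum_a z a b u ^+ 2 + `|phi u| ^+ 3) \o x)).

Lemma resample_sq_dev n (x : 'I_n -> 'cV[R]_d) : (0 < n)%N ->
  #|{ffun 'I_n -> 'I_n}|%:R^-1 * \sum_(J : {ffun 'I_n -> 'I_n}) sq_dev mu Sigma (x \o J) <=
  sq_dev mu Sigma x + n%:R^-1 * avg ((fun u => \sum_a y a u ^+ 2 + \sum_b \sum_a z a b u ^+ 2) \o x).
Proof.
move=> n0; rewrite (eq_bigr _ (fun (J : {ffun 'I_n -> 'I_n}) _ => sq_devE mu Sigma (x \o J))) sq_devE.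
rewrite big_split/= exchange_big/= [X in _ * (_ + X)]exchange_big/=.
rewrite (_ : _ \o x = fun i => \sum_a y a (x i) ^+ 2 + \sum_b \sum_a z a b (x i) ^+ 2)//.
rewrite avgD !avg_sum !mulrDr addrACA lerD//.
  rewrite !mulr_sumr -big_split/= ler_sum// => a _.
  exact: (resample_mean_sq (y a \o x) n0).
rewrite !mulr_sumr -big_split/= ler_sum// => b _.
rewrite exchange_big/= avg_sum !mulr_sumr -big_split/= ler_sum// => a _.
exact: (resample_mean_sq (z a b \o x) n0).
Qed.

Lemma bootstrap_comparison : exists2 K : R, 0 <= K &
  forall n (x : 'I_n -> 'cV[R]_d) (L : R) (f : R -> R), (1 < n)%N -> smooth3 L f ->
  `|Ex (bootstrap_law (GW Q) x) f - Ex (normal_law 0 v) f| <= L * K * discrepancy x.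
Proof.
have [C C1 HC] := GW_expand mu Sc Su Xc Xu Qg.
have k3 : 0 <= @gauss01_abs3 R by apply: Ex_ge0 => w; rewrite exprn_ge0.
have sk : 0 <= Num.sqrt v ^+ 3 * @gauss01_abs3 R by rewrite mulr_ge0// exprn_ge0// sqrtr_ge0.
(* [6 C] comes from the linearisation, where the Lipschitz factor is 3 and the deviation of the
   sample counts twice; the rest covers the constants of [linearized_bootstrap]. *)
exists (6 * C + 9 + Num.sqrt v ^+ 3 * @gauss01_abs3 R); first lra.
move=> n x L f n2 sf; have n0 : (0 < n)%N := ltnW n2.
have [fL _] := sf; have L0 : 0 <= L by rewrite (le_trans _ (fL 0)).
have tf := lipschitz_tame (smooth3_lipschitz sf) fL; have [cf _] := tf.
rewrite (bootstrap_law_Ex _ _ (continuous_measurable_fun cf) fL).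
have r1 : 1 <= Num.sqrt n%:R :> R by rewrite -{1}sqrtr1 ler_sqrt ?ltr0n// ler1n.
have rn : n%:R = Num.sqrt n%:R * Num.sqrt n%:R :> R by rewrite -expr2 sqr_sqrtr.
have B := linearized_bootstrap (phi \o x) n0 v0 sf.
set F := #|{ffun 'I_n -> 'I_n}|%:R^-1 in B *.
have F0 : 0 <= F by rewrite invr_ge0.
have FN : F * (\sum_(J : {ffun 'I_n -> 'I_n}) 1) = 1.
  rewrite sumr_const mulVf// pnatr_eq0 -lt0n; apply/card_gt0P; by exists [ffun i => i].
pose rem m (w : 'I_m -> 'cV[R]_d) := GW Q w - (sqnorm (mu - nu) + bures Xi Sigma + \tr Xi) - avg (phi \o w).
pose e m (w : 'I_m -> 'cV[R]_d) := sq_dev mu Sigma w.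
have A (J : {ffun 'I_n -> 'I_n}) :
    `|f (bootstrap_error (GW Q) x J) - f (Num.sqrt n%:R * (avg (phi \o x \o J) - avg (phi \o x)))| <=
    3 * L * (C * (Num.sqrt n%:R * (e _ (x \o J) + e _ x + 2 * n%:R^-1))).
  have -> : bootstrap_error (GW Q) x J = Num.sqrt n%:R * (avg (phi \o x \o J) - avg (phi \o x)) +
      Num.sqrt n%:R * (rem _ (x \o J) - rem _ x).
    rewrite /bootstrap_error /rem -mulrDr; congr (_ * _).
    have -> : avg (phi \o (x \o J)) = avg (phi \o x \o J) by [].
    move: (GW Q (x \o J)) (GW Q x) (avg (phi \o x \o J)) (avg (phi \o x)) (_ + \tr Xi) => a b a' b' c.
    ring.
  rewrite (le_trans (smooth3_lip sf _ _))// ler_wpM2l ?mulr_ge0//.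
  apply: (min1_le C1 n0 (sq_dev_ge0 mu Sigma (x \o J)) (sq_dev_ge0 mu Sigma x)).
    by rewrite mulr_ge0 ?invr_ge0.
  move=> e1 e2; have h1 := HC n (x \o J) n2 e1; have h2 := HC n x n2 e2.
  by rewrite (le_trans (ler_normB _ _))// /e; move: h1 h2; rewrite /rem; lra.
have A' : `|F * \sum_(J : {ffun 'I_n -> 'I_n}) f (bootstrap_error (GW Q) x J) -
    F * \sum_(J : {ffun 'I_n -> 'I_n}) f (Num.sqrt n%:R * (avg (phi \o x \o J) - avg (phi \o x)))| <=
    3 * L * (C * (Num.sqrt n%:R * (F * (\sum_(J : {ffun 'I_n -> 'I_n}) e _ (x \o J)) + e _ x + 2 * n%:R^-1))).
  rewrite -mulrBr -sumrB normrM (ger0_norm F0).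
  apply: (@le_trans _ _ (F * \sum_(J : {ffun 'I_n -> 'I_n}) 3 * L * (C * (Num.sqrt n%:R * (e _ (x \o J) + e _ x + 2 * n%:R^-1))))).
    by rewrite ler_wpM2l// (le_trans (ler_norm_sum _ _ _))// ler_sum.
  rewrite -mulr_sumr -mulr_sumr -mulr_sumr.
  rewrite (eq_bigr (fun J : {ffun 'I_n -> 'I_n} => e _ (x \o J) + (e _ x + 2 * n%:R^-1) * 1)); last first.
    by move=> J _; rewrite [(_ + _) * 1]mulr1 -addrA.
  rewrite big_split/= -mulr_sumr [F * (3 * L * _)]mulrCA [F * (C * _)]mulrCA [F * (Num.sqrt _ * _)]mulrCA.
  by rewrite [F * (_ + _)]mulrDr [F * (_ * \sum_J 1)]mulrCA FN mulr1 addrA.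
have := resample_sq_dev x n0; rewrite -/F => Be.
move: A' B; rewrite /discrepancy -sq_devE -/(e _ x) in Be *.
set U := F * \sum_J f _; set W := F * \sum_J f _; set V := Ex _ f => A' B.
pose h1 := avg ((fun u => \sum_a y a u ^+ 2 + \sum_b \sum_a z a b u ^+ 2) \o x).
pose h2 := avg (fun i => `|phi (x i)| ^+ 3).
have hE : avg ((fun u => \sum_a y a u ^+ 2 + \sum_b \sum_a z a b u ^+ 2 + `|phi u| ^+ 3) \o x) = h1 + h2.
  by rewrite -avgD.
have h10 : 0 <= h1.
  apply: avg_ge0 => i /=; rewrite addr_ge0// sumr_ge0// => [a|a] _; first exact: sqr_ge0.
  by rewrite sumr_ge0// => b _; exact: sqr_ge0.
have h20 : 0 <= h2 by apply: avg_ge0 => i; rewrite exprn_ge0.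
rewrite hE.
have -> : U - V = (U - W) + (W - V) by ring.
rewrite (le_trans (ler_normD _ _))// (le_trans (lerD A' B))//.
have e0 : 0 <= e _ x := sq_dev_ge0 mu Sigma x.
set r := Num.sqrt n%:R in r1 rn *; have r0 : 0 < r by exact: lt_le_trans r1.
rewrite -[3 * L * _]mulrA [3 * (L * _)]mulrCA -[L * (_ + _) * _]mulrA -mulrDr ler_wpM2l//.
set m2 := avg (phi \o x) ^+ 2; have m20 : 0 <= m2 := sqr_ge0 _.
have -> : avg (fun i => (phi \o x) i ^+ 2 - v) = avg ((fun u => phi u ^+ 2 - v) \o x) by [].
set t2 := avg (_ \o x) ^+ 2; have t20 : 0 <= t2 := sqr_ge0 _.
set k := Num.sqrt v ^+ 3 * gauss01_abs3 in sk *.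
have C0 : 0 <= C by lra.
have E1 : C * (r * (F * (\sum_(J : {ffun 'I_n -> 'I_n}) e _ (x \o J)) + e _ x + 2 * n%:R^-1)) <=
    C * (r * (2 * e _ x)) + C * (r^-1 * (h1 + 2)).
  rewrite -mulrDr ler_wpM2l// (@le_trans _ _ (r * (2 * e _ x + n%:R^-1 * (h1 + 2))))//.
    by rewrite ler_wpM2l ?(ltW r0)//; move: Be; rewrite -/h1; lra.
  by rewrite mulrDr lerD2l rn le_eqVlt; apply/orP; left; apply/eqP; field; exact: lt0r_neq0.
rewrite -/h2.
have p1 : 0 <= r * e _ x by rewrite mulr_ge0// ltW.
have p2 : 0 <= r * (m2 + t2) by rewrite mulr_ge0 ?addr_ge0// ltW.
have ri : 0 <= r^-1 by rewrite invr_ge0 ltW.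
have p3 : 0 <= r^-1 * h1 by rewrite mulr_ge0.
have p4 : 0 <= r^-1 * h2 by rewrite mulr_ge0.
have q1 : 0 <= C * (r * e _ x) by rewrite mulr_ge0.
have q2 : 0 <= C * (r * (m2 + t2)) by rewrite mulr_ge0.
have q3 : 0 <= C * (r^-1 * h1) by rewrite mulr_ge0.
have q4 : 0 <= C * (r^-1 * h2) by rewrite mulr_ge0.
have q5 : 0 <= C * r^-1 by rewrite mulr_ge0.
have s1 : 0 <= k * (r * e _ x) by rewrite mulr_ge0.
have s2 : 0 <= k * (r * (m2 + t2)) by rewrite mulr_ge0.
have s3 : 0 <= k * (r^-1 * h1) by rewrite mulr_ge0.
have s4 : 0 <= k * (r^-1 * h2) by rewrite mulr_ge0.
have s5 : 0 <= k * r^-1 by rewrite mulr_ge0.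
move: E1 p1 p2 p3 p4 q1 q2 q3 q4 q5 s1 s2 s3 s4 s5; rewrite -/(e _ x); lra.
Qed.

End bootstrap_comparison.

(** * Markov's inequality and the expected discrepancy *)

Lemma measurable_superlevel {R : realType} dO (Omega : measurableType dO) (f : Omega -> R) (e : R) :
  measurable_fun setT f -> measurable [set w | e <= f w].
Proof.
move=> mf; rewrite (_ : [set w | _] = f @^-1` [set` `[e, +oo[]).
  by rewrite -[X in measurable X]setTI; apply: mf => //; exact: measurable_itv.
by apply/seteqP; split => w /=; rewrite in_itv/= andbT.
Qed.

Lemma markov_ge {R : realType} dO (Omega : measurableType dO) (Pr : probability Omega R)
    (B : Omega -> R) (e : R) : all_moments Pr B -> (forall w, 0 <= B w) -> 0 < e ->
  (Pr [set w | (e <= B w)%R] <= (Ex Pr B / e)%:E)%E.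
Proof.
move=> mB B0 e0; have [mf _] := mB.
set A := [set w | _]; have mA : measurable A by exact: measurable_superlevel.
have mI : all_moments Pr (\1_A : Omega -> R).
  apply: (@bounded_all_moments _ _ _ _ _ 1) => [|w]; first exact: measurable_indic.
  by rewrite indicE; case: (w \in A); rewrite ?normr1 ?normr0.
have -> : Pr A = (Ex Pr (\1_A : Omega -> R))%:E by rewrite -(ExE mI) integral_indic// setIT.
rewrite lee_fin ler_pdivlMr// mulrC -ExZ//; apply: le_Ex => //; first exact: all_momentsZ.
move=> w; rewrite indicE; case: (boolP (w \in A)) => [|_]; last by rewrite mulr0.
by rewrite inE /A /= mulr1.
Qed.

Section discrepancy_expectation.
Context {R : realType} (d : nat).
Variables (mu nu : 'cV[R]_d) (Sigma Xi : 'M[R]_d).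
Hypotheses (Sc : covariance_matrix Sigma) (Xc : covariance_matrix Xi).
Local Notation G := (gaussian mu Sigma).
Local Notation phi := (influence mu nu Sigma Xi).
Local Notation y := (coord_dev mu).
Local Notation z := (cov_dev mu Sigma).

Lemma coord_dev_moments a : all_moments G (y a).
Proof. by apply: all_momentsB; [exact: gaussian_coord|exact: all_moments_cst]. Qed.

Lemma coord_dev_Ex a : Ex G (y a) = 0.
Proof.
rewrite (ExB (gaussian_coord mu Sigma a) (all_moments_cst G (mu a 0))).
by rewrite gaussian_mean Ex_cst subrr.
Qed.

Lemma cov_dev_moments a b : all_moments G (z a b).
Proof.
apply: all_momentsB; last exact: all_moments_cst.
by apply: all_momentsM; exact: coord_dev_moments.
Qed.

Lemma cov_dev_Ex a b : Ex G (z a b) = 0.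
Proof.
have m := all_momentsM (coord_dev_moments a) (coord_dev_moments b).
rewrite (ExB m (all_moments_cst G (Sigma a b))).
by rewrite Ex_cst; have := gaussian_cov mu Sc a b; rewrite /coord_dev => ->; rewrite subrr.
Qed.

Lemma influence_moments : all_moments G phi.
Proof. exact: quad_fun_moments. Qed.

Let AT : (1%:M - transport_mx Sigma Xi)^T = 1%:M - transport_mx Sigma Xi.
Proof. by rewrite linearB/= trmx1 transport_mx_tr. Qed.

Lemma influence_Ex : Ex G phi = 0.
Proof. by have [] := quad_fun_Ex mu Sc (2 *: (mu - nu)) AT. Qed.

(** [quad_fun_Ex] adds the variances of the linear and the quadratic part. The coefficient
    [2 (mu - nu)] accounts for the factor 4, [bures_variance] for the rest. *)
Lemma influence_sq_Ex (Su : Sigma \in unitmx) (Xu : Xi \in unitmx)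
    (kappa : 'I_d -> R) (r : 'I_d -> 'cV[R]_d) :
  orthonormal_eigenpairs (sqrtmx Xi *m Sigma *m sqrtmx Xi) kappa r ->
  Ex G (fun u => phi u ^+ 2) = upsilon2 mu nu Sigma Xi kappa r.
Proof.
move=> kr; have [_ ->] := quad_fun_Ex mu Sc (2 *: (mu - nu)) AT.
have sc c (u : 'cV[R]_d) : (c *: u)^T *m Sigma *m (c *: u) = c ^+ 2 *: (u^T *m Sigma *m u).
  by rewrite [(c *: u)^T]linearZ/= -!scalemxAl -scalemxAr scalerA.
rewrite (bures_variance Sc Su Xc Xu kr) /upsilon2 -opprB scalerN -scaleNr sc mxE; ring.
Qed.

Context dO (Omega : measurableType dO) (Pr : probability Omega R).
Variable X : nat -> {RV Pr >-> 'cV[R]_d}.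
Hypothesis X_iid : iid_with_law X G.
Variable v : R.
Hypothesis vE : Ex G (fun u => phi u ^+ 2) = v.

Lemma discrepancy_ge0 n (x : 'I_n -> 'cV[R]_d) : 0 <= discrepancy mu nu Sigma Xi v x.
Proof.
rewrite addr_ge0// mulr_ge0 ?invr_ge0 ?sqrtr_ge0//.
  rewrite !addr_ge0 ?sqr_ge0// sumr_ge0// => a _; first exact: sqr_ge0.
  by rewrite sumr_ge0// => b _; exact: sqr_ge0.
rewrite addr_ge0// avg_ge0// => i /=; rewrite !addr_ge0 ?exprn_ge0// sumr_ge0// => a _.
  exact: sqr_ge0.
by rewrite sumr_ge0// => b _; exact: sqr_ge0.
Qed.

(** An equality, because [y], [z], [phi] and [phi ^+ 2 - v] are all centered under [G]: the mean of
    each squared average is exactly the second moment divided by [n]. *)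
Lemma discrepancy_Ex : exists2 K : R, 0 <= K & forall n, (0 < n)%N ->
  all_moments Pr (fun w => discrepancy mu nu Sigma Xi v (fun i : 'I_n => X i w)) /\
  Ex Pr (fun w => discrepancy mu nu Sigma Xi v (fun i : 'I_n => X i w)) = (Num.sqrt n%:R)^-1 * K.
Proof.
have my := coord_dev_moments; have mz := cov_dev_moments; have mp := influence_moments.
have mq : all_moments G (fun u => phi u ^+ 2 - v).
  by apply: all_momentsB; [exact: all_momentsX|exact: all_moments_cst].
have q0 : Ex G (fun u => phi u ^+ 2 - v) = 0.
  by rewrite (ExB (all_momentsX 2 mp) (all_moments_cst G v)) vE Ex_cst subrr.
have mh : all_moments G (fun u => \sum_a y a u ^+ 2 + \sum_b \sum_a z a b u ^+ 2 + `|phi u| ^+ 3).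
  apply: all_momentsD; last by apply: all_momentsX; exact: all_moments_norm.
  apply: all_momentsD; first by apply: all_moments_sum => a _; exact: all_momentsX.
  by apply: all_moments_sum => b _; apply: all_moments_sum => a _; exact: all_momentsX.
set h := (fun u => _ + _) in mh.
have h0 : 0 <= Ex G h.
  apply: Ex_ge0 => u; rewrite /h !addr_ge0 ?exprn_ge0// sumr_ge0// => a _; first exact: sqr_ge0.
  by rewrite sumr_ge0// => b _; exact: sqr_ge0.
have E0 (g : 'cV[R]_d -> R) : 0 <= Ex G (fun u => g u ^+ 2) by apply: Ex_ge0 => u; exact: sqr_ge0.
pose k := \sum_a Ex G (fun u => y a u ^+ 2) + \sum_b \sum_a Ex G (fun u => z a b u ^+ 2) +
  (Ex G (fun u => phi u ^+ 2) + Ex G (fun u => (phi u ^+ 2 - v) ^+ 2)).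
exists (k + (1 + Ex G h)).
  rewrite addr_ge0 ?addr_ge0//; rewrite sumr_ge0// => b _; rewrite sumr_ge0//.
move=> n n0.
have sq g : all_moments G g -> all_moments Pr (fun w => avg (fun i : 'I_n => g (X i w)) ^+ 2).
  by move=> mg; apply: all_momentsX; exact: (avg_moments X_iid).
have r0 : Num.sqrt n%:R != 0 :> R by rewrite sqrtr_eq0 -ltNge ltr0n.
have rn : n%:R = Num.sqrt n%:R * Num.sqrt n%:R :> R by rewrite -expr2 sqr_sqrtr.
pose D1 w := \sum_a avg (fun i : 'I_n => y a (X i w)) ^+ 2.
pose D2 w := \sum_b \sum_a avg (fun i : 'I_n => z a b (X i w)) ^+ 2.
pose D3 w := avg (fun i : 'I_n => phi (X i w)) ^+ 2.
pose D4 w := avg (fun i : 'I_n => phi (X i w) ^+ 2 - v) ^+ 2.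
pose D5 w := avg (fun i : 'I_n => h (X i w)).
have m1 : all_moments Pr D1 by apply: all_moments_sum => a _; exact: sq.
have m2 : all_moments Pr D2.
  by apply: all_moments_sum => b _; apply: all_moments_sum => a _; exact: sq.
have m3 : all_moments Pr D3 by exact: sq.
have m4 : all_moments Pr D4 by exact: (sq (fun u => phi u ^+ 2 - v)).
have m5 : all_moments Pr D5 by exact: (avg_moments X_iid).
have m12 := all_momentsD m1 m2; have m34 := all_momentsD m3 m4; have m14 := all_momentsD m12 m34.
have m6 := all_momentsD (all_moments_cst Pr (1 : R)) m5.
rewrite -[fun w => discrepancy _ _ _ _ _ _]/(fun w =>
  Num.sqrt n%:R * (D1 w + D2 w + (D3 w + D4 w)) + (Num.sqrt n%:R)^-1 * (1 + D5 w)).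
split; first by apply: all_momentsD; exact: all_momentsZ.
rewrite (ExD (all_momentsZ _ m14) (all_momentsZ _ m6)) (ExZ _ m14) (ExZ _ m6).
rewrite (ExD m12 m34) (ExD m1 m2) (ExD m3 m4) (ExD (all_moments_cst Pr (1 : R)) m5) Ex_cst.
have -> : Ex Pr D1 = n%:R^-1 * \sum_a Ex G (fun u => y a u ^+ 2).
  rewrite Ex_sum => [|a _]; last exact: sq.
  by rewrite mulr_sumr; apply: eq_bigr => a _; apply: (avg_sq_Ex X_iid n0 (my a)); exact: coord_dev_Ex.
have -> : Ex Pr D2 = n%:R^-1 * \sum_b \sum_a Ex G (fun u => z a b u ^+ 2).
  rewrite Ex_sum => [|b _]; last by apply: all_moments_sum => a _; exact: sq.
  rewrite mulr_sumr; apply: eq_bigr => b _; rewrite Ex_sum => [|a _]; last exact: sq.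
  by rewrite mulr_sumr; apply: eq_bigr => a _; apply: (avg_sq_Ex X_iid n0 (mz a b)); exact: cov_dev_Ex.
have -> : Ex Pr D3 = n%:R^-1 * Ex G (fun u => phi u ^+ 2).
  exact: (avg_sq_Ex X_iid n0 mp influence_Ex).
have -> : Ex Pr D4 = n%:R^-1 * Ex G (fun u => (phi u ^+ 2 - v) ^+ 2).
  exact: (avg_sq_Ex X_iid n0 mq q0).
have -> : Ex Pr D5 = Ex G h by exact: (avg_Ex X_iid).
have nV : n%:R^-1 = (Num.sqrt n%:R)^-1 * (Num.sqrt n%:R)^-1 :> R by rewrite -invfM -rn.
by rewrite -!mulrDr -/k nV !mulrA divff// mul1r -mulrDr.
Qed.

End discrepancy_expectation.

Theorem proposition2p7 (R : realType) (d : nat)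
  (mu nu : 'cV[R]_d) (Sigma Xi : 'M[R]_d)
  (Sigma_cov : covariance_matrix Sigma) (Sigma_full : \rank Sigma = d)
  (Xi_cov : covariance_matrix Xi) (Xi_full : \rank Xi = d)
  (P Q : probability 'cV[R]_d R)
  (P_gaussian : measure_eq P (gaussian mu Sigma))
  (Q_gaussian : measure_eq Q (gaussian nu Xi))
  (P_neq_Q : ~ measure_eq P Q)
  (dO : measure_display) (Omega : measurableType dO) (Pr : probability Omega R)
  (X : nat -> {RV Pr >-> 'cV[R]_d}) (X_iid : iid_with_law X P)
  (kappa : 'I_d -> R) (r : 'I_d -> 'cV[R]_d)
  (kappa_r : orthonormal_eigenpairs (sqrtmx Xi *m Sigma *m sqrtmx Xi) kappa r)
  (rho : probability R R -> probability R R -> R)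
  (rho_metric : metrizes_weak_convergence rho)
  (eps : R) (eps_gt0 : 0 < eps) :
  Pr [set w | eps <=
        rho (bootstrap_law (GW Q) (fun i : 'I_n => X i w))
            (normal_law 0 (upsilon2 mu nu Sigma Xi kappa r))]
    @[n --> \oo] --> 0%E.
Proof.
have Su : Sigma \in unitmx by rewrite -row_full_unit /row_full Sigma_full.
have Xu : Xi \in unitmx by rewrite -row_full_unit /row_full Xi_full.
have X_iid' : iid_with_law X (gaussian mu Sigma).
  by have [ind law] := X_iid; split=> // i A mA; rewrite law// P_gaussian.
set v := upsilon2 _ _ _ _ _ _.
have vE := influence_sq_Ex mu nu Sigma_cov Xi_cov Su Xu kappa_r; rewrite -/v in vE.
have v0 : 0 <= v by rewrite -vE; apply: Ex_ge0 => u; exact: sqr_ge0.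
have [K K0 HK] := bootstrap_comparison mu Sigma_cov Su Xi_cov Xu Q_gaussian v0.
have [D D0 HD] := discrepancy_Ex Sigma_cov Xi_cov X_iid' vE.
(* The coefficient at scale [m] is the [smooth3] constant of the test functions times [K]; the bound
   [b] will be the discrepancy. *)
have [de de0 Hde] := rho_control (fun m => 4 * (1 + m%:R) ^+ 3 * K) rho_metric (normal_law_moments v0) eps_gt0.
pose b n w := discrepancy mu nu Sigma Xi v (fun i : 'I_n => X i w).
pose S n := [set w | eps <= rho (bootstrap_law (GW Q) (fun i : 'I_n => X i w)) (normal_law 0 v)].
(* [Pr] means something on measurable sets only *)
have mS n : measurable (S n).
  apply: measurable_superlevel; apply: (measurable_rho_bootstrap _ _ Xi_cov Xu Q_gaussian rho_metric) => i.
  exact: measurable_funPT.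
(* By the choice of [de], the discrepancy is at least [de] wherever the distance to the limit is at
   least [eps]; Markov's inequality applies to the former. From [n = 2] on, the sample covariance
   divides by a nonzero number. *)
have bound n : (1 < n)%N -> (Pr (S n) <= ((Num.sqrt n%:R)^-1 * D / de)%:E)%E.
  move=> n2; have [mb Eb] := HD n (ltnW n2).
  rewrite -Eb; apply: (@le_trans _ _ (Pr [set w | (de <= b n w)%R])); last first.
    by apply: markov_ge => // w; exact: discrepancy_ge0.
  apply: le_measure; rewrite ?inE//.
    exact: measurable_superlevel (all_moments_meas mb).
  move=> w; rewrite /S /= => Hw; rewrite leNgt; apply/negP => bd.
  move: Hw; rewrite leNgt => /negP; apply.
  apply: (Hde _ (b n w)) => //; first exact: discrepancy_ge0.
  move=> m J i; exact: HK n2 (smooth3_test_fun m J i).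
apply: (@squeeze_cvge _ _ _ _ (fun=> 0%E) _ (fun n => ((Num.sqrt n%:R)^-1 * D / de)%:E)).
- near=> n; rewrite measure_ge0 bound//.
  by near: n; exists 2%N.
- exact: cvg_cst.
- apply: cvg_EFin; first by near=> n.
  apply/cvgrPdist_le => /= e e0; near=> n.
  have n0 : 0 < Num.sqrt n%:R :> R.
    by rewrite sqrtr_gt0 ltr0n; near: n; exists 1%N.
  rewrite sub0r normrN ger0_norm; last by rewrite !mulr_ge0 ?invr_ge0// ltW.
  rewrite -mulrA ler_pdivrMl// -ler_pdivrMr// (le_trans (ler_norm _))// -sqrtr_sqr.
  by apply: ler_wsqrtr; near: n; exact: nbhs_infty_ger.
Unshelve. all: by end_near. Qed.
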